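(* For any weak composition $a$ of length $n$, \[ \overline{\mathfrak{D}}_a^{(\beta)}=\sum_{b\in\mathrm{Qlswap}(a)}\overline{\mathfrak{Q}}_b^{(\beta)}. \] In particular, every Lascoux polynomial $\overline{\mathfrak{D}}_a^{(\beta)}$ is a positive sum of quasiLascoux polynomials.
   Context: Fix $n\ge1$; $\beta$ is a formal parameter. A weak composition of length $n$ is a sequence $a=(a_1,\dots,a_n)$ of nonnegative integers, and $\mathbf{x}^a=x_1^{a_1}\cdots x_n^{a_n}$. The positive part $a^+$ is the sequence obtained by deleting all zeros of $a$. $b\ge a$ means $b_1+\dots+b_i\ge a_1+\dots+a_i$ for all $1\le i\le n$. A left swap on $a$ is the exchange of two entries $a_i\le a_j$ where $i<j$; $\mathrm{lswap}(a)$ is the set of weak compositions obtainable from $a$ by a (possibly empty) sequence of left swaps. $\mathrm{Qlswap}(a)$ is the set of all $b\in\mathrm{lswap}(a)$ such that if $c\in\mathrm{lswap}(a)$ and $b^+=c^+$, then $c\ge b$. The skyline diagram $D(a)$ has $a_i$ left-justified boxes in row $i$; row $1$ is the lowest row. A triple consists of three boxes, two of them adjacent in a row (left box with entry $\beta'$, right box with entry $\alpha'$) and a third box with entry $\gamma'$, such that either (Type A) the third box is above the right box, in the same column as it, and the lower of the two rows is weakly longer, or (Type B) the third box is below the left box, in the same column as it, and the higher of the two rows is strictly longer. A triple is an inversion triple if $\gamma'<\alpha'\le\beta'$ or $\alpha'\le\beta'<\gamma'$. A set-valued filling assigns a nonempty set of positive integers to each box; the maximum of each box is its anchor, all other entries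 are free. Consider the conditions (S.1) entries do not repeat in a column; (S.2) rows are weakly decreasing from left to right, where $A\ge B$ means $\min A\ge\max B$; (S.3) every triple of anchors is an inversion triple; (S.4) each free entry is in the cell of the least anchor in its column such that (S.2) is not violated (i.e. among the cells of its column with larger anchor in which it could be placed without violating (S.2), it is in the one with least anchor); (S.5) anchors in the first column equal their row index. For a filling $F$, $\mathrm{wt}(F)=(c_1,\dots,c_n)$ with $c_i$ the number of $i$'s in $F$, and $\mathrm{ex}(F)$ is the number of free entries. Lascoux atoms and quasiLascoux polynomials. $\overline{\mathfrak{A}}_a^{(\beta)}=\sum_{F}\beta^{\mathrm{ex}(F)}\mathbf{x}^{\mathrm{wt}(F)}$, the sum over set-valued fillings $F$ of $D(a)$ satisfying (S.1)--(S.5), and $\overline{\mathfrak{Q}}_a^{(\beta)}=\sum_{b\ge a,\ b^+=a^+}\overline{\mathfrak{A}}_b^{(\beta)}$, the sum over weak compositions $b$ of length $n$. Lascoux polynomials. Let $\overleftarrow{a}=(a_n,\dots,a_1)$. Augment $D(\overleftarrow{a})$ on the left with a column $0$ (the basement) having one box in each of the rows $1,\dots,n$, with the fixed single entry $b_i=n-i+1$ in row $i$. Let $\overline{\mathfrak{D}}\mathsf{SSF}(a)$ be the set of set-valued fillings of $D(\overleftarrow{a})$ which, including the basement, satisfy (S.1)--(S.4) (not (S.5)). Basement entries do not count towards weight. Then $\overline{\mathfrak{D}}_a^{(\beta)}=\sum_{F\in\overline{\mathfrak{D}}\mathsf{SSF}(a)}\beta^{\mathrm{ex}(F)}\mathbf{x}^{\mathrm{wt}(F)}$.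 *)

(* Defs.v *)
From mathcomp Require Import all_boot all_order all_fingroup all_algebra.
From mathcomp.multinomials Require Export mpoly.

Set Implicit Arguments.
Unset Strict Implicit.
Unset Printing Implicit Defensive.

Import GRing.Theory.

Section WeakCompositions.

Variable n : nat.
Implicit Types a b c : 'X_{1..n}.

(* A weak composition of length n is the same datum as an exponent vector, so
   it is represented by a monomial a : 'X_{1..n}; then 'X_[a] is x^a.  Indices
   i : 'I_n are numbered from 0 instead of 1. *)

Definition pos_part a : seq nat := [seq x <- (a : n.-tuple nat) | x != 0].

Definition dominates b a : bool :=
  [forall i : 'I_n, \sum_(j < n | j <= i) a j <= \sum_(j < n | j <= i) b j].

Definition mnm_rev a : 'X_{1..n} := [multinom a (rev_ord i) | i < n].

Definition mnm_swap (i j : 'I_n) a : 'X_{1..n} :=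
  [multinom a (tperm i j k) | k < n].

Definition left_swap a b : bool :=
  [exists i : 'I_n, exists j : 'I_n,
    [&& i < j, a i <= a j & b == mnm_swap i j a]].

(* Rearranging the entries and inserting or deleting zeros does not change the
   degree.  Hence sets and sums of weak compositions obtained from a in this
   way can be taken in the finite type of weak compositions of degree at most
   mdeg a, without losing any of them. *)
Definition wcomp_upto a : finType := 'X_{1..n < (mdeg a).+1}.

Definition self_upto a : wcomp_upto a := BMultinom (ltnSn (mdeg a)).

Definition lswap a : {set wcomp_upto a} :=
  [set b | connect (fun x y : wcomp_upto a => left_swap x y) (self_upto a) b].

Definition Qlswap a : {set wcomp_upto a} :=
  [set b in lswap a |
    [forall c in lswap a, (pos_part b == pos_part c) ==> dominates c b]].

End WeakCompositions.

Section Fillings.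

(* A box is a pair (row, column).  Row 0 is the lowest row.  Column 0 is
   reserved for the basement, so that the first column of a skyline diagram is
   column 1. *)
Variables n N : nat.
Local Notation box := ('I_n * 'I_N)%type.

(* The element e : 'I_n stands for the entry e + 1.  No entry larger than n
   can occur: rows are weakly decreasing, and their leftmost maxima are at most
   n, by S5 or because of the basement.  Boxes outside the diagram receive
   the empty set. *)
Definition filling : finType := {ffun box -> {set 'I_n}}.

Implicit Types (D : {set box}) (F : filling) (u v w : box) (e : 'I_n).

Definition filling_of D F : bool := [forall u, (F u != set0) == (u \in D)].

(* Only meaningful when F u is nonempty; 0-based like the entries. *)
Definition anchor F u : nat := \max_(e in F u) e.

Definition free_entries F u : {set 'I_n} := [set e in F u | e < anchor F u].

(* min A >= max B *)
Definition set_ge (A B : {set 'I_n}) : bool :=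
  [forall x in A, forall y in B, y <= x].

Definition S1 F : bool :=
  [forall u, forall v, (u != v) && (u.2 == v.2) ==> [disjoint F u & F v]].

Definition S2 D F : bool :=
  [forall u in D, forall v in D,
    (u.1 == v.1) && (v.2 == u.2.+1 :> nat) ==> set_ge (F u) (F v)].

Definition row_length D (r : 'I_n) : nat := #|[set k | (r, k) \in D]|.

(* u, v, w are the boxes with entries beta', alpha', gamma'. *)
Definition typeA D u v w : bool :=
  [&& u.1 == v.1, v.2 == u.2.+1 :> nat, w.2 == v.2, v.1 < w.1
    & row_length D w.1 <= row_length D v.1].

Definition typeB D u v w : bool :=
  [&& u.1 == v.1, v.2 == u.2.+1 :> nat, w.2 == u.2, w.1 < u.1
    & row_length D w.1 < row_length D u.1].

Definition inversion (al be ga : nat) : bool :=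
  (ga < al <= be) || (al <= be < ga).

Definition S3 D F : bool :=
  [forall u in D, forall v in D, forall w in D,
    typeA D u v w || typeB D u v w
      ==> inversion (anchor F v) (anchor F u) (anchor F w)].

Definition move_entry F e u v : filling :=
  [ffun w => if w == v then e |: F w else if w == u then F w :\ e else F w].

Definition S4 D F : bool :=
  [forall u in D, forall e in free_entries F u, forall v in D,
    [&& v.2 == u.2, e < anchor F v & S2 D (move_entry F e u v)]
      ==> (anchor F u <= anchor F v)].

Definition S5 D F : bool :=
  [forall u in D, (u.2 == 1 :> nat) ==> (anchor F u == u.1)].

(* Basement entries (column 0) are not counted. *)
Definition wt F : 'X_{1..n} :=
  [multinom #|[set u : box | (0 < u.2) && (i \in F u)]| | i < n].

Definition ex F : nat := \sum_(u : box) #|free_entries F u|.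

(* beta is the variable 'X of the coefficient ring Z[beta]. *)
Definition filling_term F : {mpoly {poly int}[n]} :=
  ('X ^+ ex F *: 'X_[wt F])%R.

(* The entry n - i + 1 in row i, with 1-based i; 0-based, this is rev_ord. *)
Definition has_basement F : bool :=
  [forall u : box, (u.2 == 0 :> nat) ==> (F u == [set rev_ord u.1])].

End Fillings.

Section Polynomials.

Variable n : nat.
Implicit Types a b : 'X_{1..n}.

(* No row is longer than mdeg a, so columns 0, ..., mdeg a suffice. *)
Definition skyline a : {set 'I_n * 'I_(mdeg a).+1} :=
  [set u : 'I_n * 'I_(mdeg a).+1 | 0 < u.2 <= a u.1].

Definition augmented_skyline a : {set 'I_n * 'I_(mdeg a).+1} :=
  [set u : 'I_n * 'I_(mdeg a).+1 | u.2 <= a u.1].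

Definition atom_fillings a : {set filling n (mdeg a).+1} :=
  let D := skyline a in
  [set F | [&& filling_of D F, S1 F, S2 D F, S3 D F, S4 D F & S5 D F]].

Definition lascoux_atom a : {mpoly {poly int}[n]} :=
  (\sum_(F in atom_fillings a) filling_term F)%R.

Definition quasi_lascoux a : {mpoly {poly int}[n]} :=
  (\sum_(b : wcomp_upto a | dominates b a && (pos_part b == pos_part a))
    lascoux_atom b)%R.

Definition DSSF a : {set filling n (mdeg (mnm_rev a)).+1} :=
  let D := augmented_skyline (mnm_rev a) in
  [set F | [&& filling_of D F, has_basement F,
               S1 F, S2 D F, S3 D F & S4 D F]].

Definition lascoux a : {mpoly {poly int}[n]} :=
  (\sum_(F in DSSF a) filling_term F)%R.

End Polynomials.

(* Main.v *)
(** Fix the anchors of a filling.  By (S4) the free entries of a column may be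
    any set of admissible values, their boxes being then determined, and the
    admissible values depend only on the sets of anchors of this column and of
    the next one.  So the sum over the set-valued fillings of given row lengths
    and basement is a sum, over ordinary skyline fillings, of a weight of their
    column sets.  Write a_v for the length of the row with basement entry v, and
    exchange two adjacent rows with basement entries y > x.  Cutting the two
    rows after a column where both continuations are possible, and exchanging
    their initial parts, gives a bijection preserving column sets, from the
    fillings with lengths a before the exchange, to those after the exchange
    with lengths a or, if a_x < a_y and no c strictly between x and y has
    a_x < a_c <= a_y, with lengths a or t_xy a.  Going from the reversed basement
    to the identity, every element of lswap(a) is produced exactly once, hence
    the Lascoux polynomial of a is the sum of the Lascoux atoms of lswap(a).
    Finally, the elements of lswap(a) with a given positive part are exactly
    the compositions with this positive part which dominate the smallest one. *)

Require Import Defs.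
From mathcomp Require Import all_boot all_order all_algebra.
From mathcomp.multinomials Require Import mpoly.
From mathcomp Require Import fingroup perm zify.

Set Implicit Arguments.
Unset Strict Implicit.
Unset Printing Implicit Defensive.

(** * Pairs of rows *)

(** The columnwise maxima [h] and minima [l] determine two rows up to the choice, in each column, of
    the row that takes the minimum. The inversion condition of the pair leaves one choice: if the
    longer row has the smaller basement entry, the rows cross after the first free column in type A
    and after the last one in type B; otherwise they never cross, and type B then excludes free
    columns. So exchanging initial parts is invertible, with nothing to record. The obstacle is a
    third row. It can notice the exchange only if its length is intermediate and its entry lies
    strictly between [l] and [h] in some exchanged column. Its own inversion conditions then spread
    this separation: right of the cut they forbid any later free column, left of it they carry it
    back towards the basement. Hence only basement entries can obstruct, which is the origin of the
    condition on [c] between [x] and [y]. That each element of lswap appears exactly once is proved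
    by describing the compositions reached at each moment through prefix counts, a tableau criterion
    for the Bruhat order, and not by following sequences of swaps. *)

Lemma not_between_cases (l c h : nat) :
  ~~ ((l < c) && (c < h)) -> l < h -> c != l -> c != h ->
  (c < l) && (c < h) || (l < c) && (h < c).
Proof. lia. Qed.

(** For a third row shorter than both rows of the pair and below them. The sides can differ only if
    [l < c <= h]; then [h' <= l < c] refutes [c < l'] and [c < h'], and both sides say [h < c], up
    to a guard that the hypothesis on [l' = 0] controls. *)
Lemma short_below_free l l' h h' c :
  l' <= h' -> h' <= l -> l < h -> (l' = 0 -> c = 0) ->
  ((l' != 0) ==> (c < l') || (l < c)) && ((h' != 0) ==> (c < h') || (h < c)) =
  ((h' != 0) ==> (c < h') || (l < c)) && ((l' != 0) ==> (c < l') || (h < c)).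
Proof. lia. Qed.

(** The analogue for a third row above the pair, [c] being its entry in the second of the two
    columns. *)
Lemma short_above_free l l' h h' c : l' <= h' -> h' <= l -> l < h ->
  ((c < l') || (l < c)) && ((c < h') || (h < c)) =
  ((c < h') || (l < c)) && ((c < l') || (h < c)).
Proof. lia. Qed.

(* The conditions, for entries in two adjacent columns, on a row c whose length
   is between those of the rows L and S and which is below (resp. above) both. *)
Definition mixed_below (L L' S S' c c' : nat) :=
  ((L' != 0) ==> (c < L') || (L < c)) && ((S' != 0) ==> (S' < c') || (c < S')).

Definition mixed_above (L L' S S' c c' : nat) :=
  ((c' != 0) ==> (c' < L') || (L < c')) && ((c' != 0) ==> (S < c') || (c < S)).

Lemma mixed_exchange l l' h h' c c' :
  l' < h' -> l < h -> l' <= l -> h' <= h -> c' <= c -> c' != 0 -> l' != 0 ->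
  c != l -> c' != l' -> c != h -> c' != h' ->
  ~~ ((l < c) && (c < h)) -> ~~ ((l' < c') && (c' < h')) ->
  mixed_below l l' h h' c c' = mixed_below h h' l l' c c' /\
  mixed_above l l' h h' c c' = mixed_above h h' l l' c c'.
Proof.
rewrite /mixed_below /mixed_above => lh' lh ll hh cc c0 l0 cl cl' ch ch' n n'.
rewrite l0 c0 (_ : h' != 0); last by lia.
case/orP: (not_between_cases n lh cl ch) => /andP[a1 a2];
case/orP: (not_between_cases n' lh' cl' ch') => /andP[b1 b2].
all: lia.
Qed.

Lemma mixed_free_next l l' h h' c c' :
  l' < h' -> l < h -> h' <= l -> c' <= c -> c' != 0 -> l' != 0 ->
  c' != l' -> c' != h' -> ~~ ((l' < c') && (c' < h')) ->
  mixed_below l l' h h' c c' = mixed_below l h' h l' c c' /\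
  mixed_above l l' h h' c c' = mixed_above l h' h l' c c'.
Proof.
rewrite /mixed_below /mixed_above => lh' lh hl cc c0 l0 cl' ch' n'.
rewrite l0 c0 (_ : h' != 0); last by lia.
case/orP: (not_between_cases n' lh' cl' ch') => /andP[b1 b2].
all: lia.
Qed.

Lemma mixed_free_here l l' h h' c c' :
  l' <= h' -> l < h -> h' <= l -> c' <= c ->
  c != l -> c != h -> ~~ ((l < c) && (c < h)) ->
  mixed_below h h' l l' c c' = mixed_below l h' h l' c c' /\
  mixed_above h h' l l' c c' = mixed_above l h' h l' c c'.
Proof.
rewrite /mixed_below /mixed_above => lh' lh hl cc cl ch n.
case/orP: (not_between_cases n lh cl ch) => /andP[a1 a2].
all: lia.
Qed.

Section Rows.

Implicit Types (u v h l c : nat -> nat) (k m K : nat).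

(* Rows are functions of the column, with value 0 beyond their end.  In a triple,
   u is the lower row and v the upper one; u is the longer row in type A, and
   v in type B. *)
Definition invA u v k :=
  (v k.+1 != 0) ==> ((v k.+1 < u k.+1) || (u k < v k.+1)).

Definition invB u v k :=
  (v k.+1 != 0) ==> ((u k < v k.+1) || (v k < u k)).

(** Column 0 is the basement, so a row of length [m] fills the columns 0 to [m]. *)
Definition row_of_length u m := forall k, (u k != 0) = (k <= m).
Definition weakly_decr u := forall k, u k.+1 <= u k.

(* Here h and l are the larger and the smaller entries of two rows, columnwise:
   at a free column k both matchings of columns k and k + 1 are decreasing. *)
Definition free_at h l k := (l k != 0) && (h k.+1 <= l k).

Definition long_row h l K k := if k < K then l k else h k.
Definition short_row h l K k := if k < K then h k else l k.

(* [long_row h l K] and [short_row h l K] are rows only if K is a cut; K = 0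
   means that the longer row has all the larger entries. *)
Definition cut h l K := if K is k.+1 then free_at h l k else true.

Variables (h l : nat -> nat) (LL MM : nat).
Hypotheses (hL : row_of_length h LL) (lM : row_of_length l MM).
Hypotheses (leML : MM <= LL) (hd : weakly_decr h) (ld : weakly_decr l).
Hypothesis (lt_lh : forall k, h k != 0 -> l k < h k).

Variables (c : nat -> nat) (R : nat).
Hypotheses (cR : row_of_length c R) (cd : weakly_decr c).
Hypotheses (ch : forall k, c k != 0 -> c k != h k).
Hypotheses (cl : forall k, c k != 0 -> c k != l k).

Let L := long_row h l.
Let S := short_row h l.

(* The inversion conditions of a third row c, of length R, with the longer row L
   and the shorter row S of a pair of rows which are both above (resp. below)
   it. *)
Definition below_ok LL MM R L S c k :=
  (if LL <= R then invA c L k else invB c L k) &&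
  (if MM <= R then invA c S k else invB c S k).

Definition above_ok LL MM R L S c k :=
  (if R <= LL then invA L c k else invB L c k) &&
  (if R <= MM then invA S c k else invB S c k).

Definition between l c h k := (l k < c k) && (c k < h k).

Lemma lt_lh0 p : l p != 0 -> l p < h p.
Proof. by move=> l0; apply: lt_lh; rewrite hL (leq_trans _ leML) // -lM. Qed.

Lemma le_lh p : l p <= h p.
Proof. by have [/lt_lh0/ltnW|/negbNE/eqP->] := boolP (l p != 0). Qed.

(** If [c] separates the two entries in column [p], type B with the longer row leaves only
    [c p < h p.+1], and type A with the shorter one only [l p.+1 < c p.+1], unless that row has
    ended. So the separation moves on to the right, and [l p < h p.+1] in each such column. *)
Lemma between_forced_below K k :
  MM <= R < LL -> (forall k, below_ok LL MM R (L K) (S K) c k) ->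
  K <= k -> between l c h k -> forall m, k <= m -> ~~ free_at h l m.
Proof.
case/andP=> MR RL ok leKk bk m lekm.
have step p : k <= p -> p <= MM -> between l c h p ->
    (c p < h p.+1) && ((l p.+1 == 0) || (l p.+1 < c p.+1)).
  move=> lekp lepM /andP[lc ch'].
  have /andP := ok p; rewrite leqNgt RL MR /= => -[].
  rewrite /invA /invB /L /S /long_row /short_row !ifF; try by lia.
  have h1 : h p.+1 != 0 by rewrite hL; lia.
  rewrite h1 /= => /orP[-> | ?]; last by lia.
  case: eqP => //= _ /orP[-> // | ?]; have := ld p; lia.
have Hb: m <= MM -> between l c h m.
  elim: m lekm => [|m IH]; first by rewrite leqn0 => /eqP <-.
  rewrite leq_eqVlt => /orP[/eqP<- //|]; rewrite ltnS => lekm lemM.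
  have /andP[c1 c2] := step m lekm (ltnW lemM) (IH lekm (ltnW lemM)).
  rewrite /between (leq_ltn_trans (cd m) c1) andbT.
  case/orP: c2 => // /eqP->; rewrite lt0n cR; lia.
rewrite /free_at; apply/negP => /andP[lm0 hl].
have lemM: m <= MM by rewrite -lM.
have b := Hb lemM; have /andP[c1 _] := step m lekm lemM b.
move/andP: b; lia.
Qed.

(** The two types exchange their roles here: together they give [l p < c p.+1 < h p.+1]. *)
Lemma between_forced_above K k :
  MM < R <= LL -> (forall k, above_ok LL MM R (L K) (S K) c k) ->
  K <= k -> between l c h k -> forall m, k <= m -> ~~ free_at h l m.
Proof.
case/andP=> MR RL ok leKk bk m lekm.
have step p : k <= p -> p <= MM -> between l c h p ->
    (l p < c p.+1) && (c p.+1 < h p.+1).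
  move=> lekp lepM /andP[lc ch'].
  have /andP := ok p; rewrite RL leqNgt MR /= => -[].
  rewrite /invA /invB /L /S /long_row /short_row !ifF; try by lia.
  have h1 : c p.+1 != 0 by rewrite cR; lia.
  rewrite h1 /= => /orP[-> | ?]; last by have := cd p; lia.
  by case/orP=> [-> // | ?]; lia.
have Hb: m <= MM -> between l c h m.
  elim: m lekm => [|m IH]; first by rewrite leqn0 => /eqP <-.
  rewrite leq_eqVlt => /orP[/eqP<- //|]; rewrite ltnS => lekm lemM.
  have /andP[c1 c2] := step m lekm (ltnW lemM) (IH lekm (ltnW lemM)).
  by rewrite /between (leq_ltn_trans (ld m) c1).
rewrite /free_at; apply/negP => /andP[lm0 hl].
have lemM: m <= MM by rewrite -lM.
have b := Hb lemM; have /andP[c1 c2] := step m lekm lemM b.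
lia.
Qed.

(** Left of the cut the longer row carries the smaller entries, so the same two conditions move the
    separation to the left. *)
Lemma between_back_below K k0 k :
  MM <= R < LL -> (forall k, below_ok LL MM R (L K) (S K) c k) ->
  k < K -> k <= MM -> k0 <= k -> between l c h k ->
  between l c h k0.
Proof.
case/andP=> MR RL ok + + lek0 bk.
elim: k lek0 bk => [|k IH]; first by rewrite leqn0 => /eqP->.
rewrite leq_eqVlt => /orP[/eqP-> //|lek0] /andP[lc ch'] ltK ltM.
apply: IH => //; try lia.
have /andP := ok k; rewrite leqNgt RL MR /= => -[].
rewrite /invA /invB /L /S /long_row /short_row !ifT; try by lia.
have -> /= : l k.+1 != 0 by rewrite lM.
rewrite (_ : h k.+1 != 0) /=; last by rewrite hL; lia.
have := cd k; have := hd k; rewrite /between; lia.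
Qed.

Lemma between_back_above K k0 k :
  MM < R <= LL -> (forall k, above_ok LL MM R (L K) (S K) c k) ->
  k < K -> k <= MM -> k0 <= k -> between l c h k ->
  between l c h k0.
Proof.
case/andP=> MR RL ok + + lek0 bk.
elim: k lek0 bk => [|k IH]; first by rewrite leqn0 => /eqP->.
rewrite leq_eqVlt => /orP[/eqP-> //|lek0] /andP[lc ch'] ltK ltM.
apply: IH => //; try lia.
have /andP := ok k; rewrite RL leqNgt MR /= => -[].
rewrite /invA /invB /L /S /long_row /short_row !ifT; try by lia.
rewrite (_ : c k.+1 != 0) /=; last by rewrite cR; lia.
have := cd k; have := hd k; rewrite /between; lia.
Qed.

(* Between two cuts the two arrangements of the pair differ by an exchange, and
   there the third row cannot separate the two entries. *)
Lemma not_between_below K1 K2 k :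
  MM <= R < LL -> cut h l K1 -> cut h l K2 ->
  (forall k, below_ok LL MM R (L K1) (S K1) c k) ->
  (0 < minn K1 K2) || ~~ between l c h 0 ->
  minn K1 K2 <= k < maxn K1 K2 -> ~~ between l c h k.
Proof.
move=> MRL cut1 cut2 ok nb0 /andP[le1 le2]; apply/negP => bk.
(* If the second cut is to the right of the first, it comes after a free column, which the
   separation in column [k] forbids. *)
have [le12|lt21] := leqP K1 K2.
  move: le1 le2; rewrite (minn_idPl le12) (maxn_idPr le12) => le1 le2.
  case: K2 cut2 le12 le2 {nb0} => // K2 /= f2 le12 le2.
  by have := between_forced_below MRL ok le1 bk le2; rewrite f2.
move: le1 le2 nb0; rewrite (minn_idPr (ltnW lt21)) (maxn_idPl (ltnW lt21)).
move=> le1 le2; case: K1 cut1 lt21 le2 ok => // K1 /= /andP[l1 _] lt21 le2 ok.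
have leM : k <= MM by move: l1; rewrite lM; lia.
(* The second cut is to the left: the separation goes back to it. It reaches column 0 if this cut is
   0, against [nb0]; otherwise it holds on both sides of the cut, and the conditions there
   contradict that the column before the cut is free. *)
case: K2 cut2 lt21 le1 => [|K2] /= f2 lt21 le1.
  by rewrite (between_back_below MRL ok le2 leM (leq0n k) bk).
have := between_back_below MRL ok le2 leM (leq_trans (leqnSn K2) le1) bk.
case/andP=> ? ? _; have /andP[? ?] := between_back_below MRL ok le2 leM le1 bk.
case/andP: MRL => MR RL.
have /andP := ok K2; rewrite leqNgt RL MR /= => -[].
rewrite /invA /invB /L /S /long_row /short_row !ifT; try by lia.
have -> /= : l K2.+1 != 0 by rewrite lM; lia.
rewrite (_ : h K2.+1 != 0) /=; last by rewrite hL; lia.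
case/andP: f2; lia.
Qed.

Lemma not_between_above K1 K2 k :
  MM < R <= LL -> cut h l K1 -> cut h l K2 ->
  (forall k, above_ok LL MM R (L K1) (S K1) c k) ->
  (0 < minn K1 K2) || ~~ between l c h 0 ->
  minn K1 K2 <= k < maxn K1 K2 -> ~~ between l c h k.
Proof.
move=> MRL cut1 cut2 ok nb0 /andP[le1 le2]; apply/negP => bk.
have [le12|lt21] := leqP K1 K2.
  move: le1 le2; rewrite (minn_idPl le12) (maxn_idPr le12) => le1 le2.
  case: K2 cut2 le12 le2 {nb0} => // K2 /= f2 le12 le2.
  by have := between_forced_above MRL ok le1 bk le2; rewrite f2.
move: le1 le2 nb0; rewrite (minn_idPr (ltnW lt21)) (maxn_idPl (ltnW lt21)).
move=> le1 le2; case: K1 cut1 lt21 le2 ok => // K1 /= /andP[l1 _] lt21 le2 ok.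
have leM : k <= MM by move: l1; rewrite lM; lia.
case: K2 cut2 lt21 le1 => [|K2] /= f2 lt21 le1.
  by rewrite (between_back_above MRL ok le2 leM (leq0n k) bk).
have := between_back_above MRL ok le2 leM (leq_trans (leqnSn K2) le1) bk.
case/andP=> ? ? _; have /andP[? ?] := between_back_above MRL ok le2 leM le1 bk.
case/andP: MRL => MR RL.
have /andP := ok K2; rewrite RL leqNgt MR /= => -[].
rewrite /invA /invB /L /S /long_row /short_row !ifT; try by lia.
rewrite (_ : c K2.+1 != 0) /=; last by rewrite cR; lia.
case/andP: f2; lia.
Qed.

(** Columns [k] and [k.+1] are both left of the cut, separated by it, or both right of it. In the
    first case [l k.+1] is nonzero because [l] still is at the cut. *)
Lemma cut_cases K k : cut h l K ->
  [\/ [/\ k < K, k.+1 < K & l k.+1 != 0],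
      [/\ k < K, (k.+1 < K) = false & free_at h l k]
    | (k < K) = false /\ (k.+1 < K) = false].
Proof.
case: K => [|K] /=; first by constructor 3.
move=> fK; have [lt|gt|->] := ltngtP k K.
- constructor 1; split=> //; first by rewrite ltnS ltnW.
  by case/andP: fK; rewrite !lM => leKM _; apply: leq_trans leKM.
- by constructor 3; rewrite !ltnS [k <= K]leqNgt gt [k < K]ltnNge ltnW.
by constructor 2; rewrite ltnSn ltnn.
Qed.

Lemma between_cuts K1 K2 k : (k < K1) != (k < K2) -> minn K1 K2 <= k < maxn K1 K2.
Proof.
by case: ltnP => a; case: ltnP => b //= _; rewrite geq_min leq_max a b ?orbT.
Qed.

Lemma mixed_cut K1 K2 k (L1 := L K1) (L2 := L K2) (S1 := S K1) (S2 := S K2) :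
  cut h l K1 -> cut h l K2 -> MM <= R ->
  (forall p, minn K1 K2 <= p < maxn K1 K2 -> ~~ between l c h p) ->
    mixed_below (L1 k) (L1 k.+1) (S1 k) (S1 k.+1) (c k) (c k.+1)
      = mixed_below (L2 k) (L2 k.+1) (S2 k) (S2 k.+1) (c k) (c k.+1)
 /\ mixed_above (L1 k) (L1 k.+1) (S1 k) (S1 k.+1) (c k) (c k.+1)
      = mixed_above (L2 k) (L2 k.+1) (S2 k) (S2 k.+1) (c k) (c k.+1).
Proof.
move=> cut1 cut2 MR nb.
have lh := lt_lh0.
have c0 p : l p != 0 -> c p != 0.
  by move=> l0; rewrite cR (leq_trans _ MR) // -lM.
have l0 : l k.+1 != 0 -> l k != 0 by rewrite !lM; apply: ltnW.
have lh' := le_lh k.+1.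
have hl' p : l p != 0 -> c p != 0 -> [/\ l p < h p, c p != l p & c p != h p].
  by move=> lp cp; rewrite lh // cl // ch.
(* [H12] compares two columns left of a cut with two columns right of it; [H13] compares two left
   columns, and [H23] two right columns, with columns separated by a cut. *)
have H12 : l k.+1 != 0 -> ~~ between l c h k -> ~~ between l c h k.+1 -> _ :=
  fun a n n' => let: And3 p q r := hl' _ (l0 a) (c0 _ (l0 a)) in
    let: And3 p' q' r' := hl' _ a (c0 _ a) in
    mixed_exchange p' p (ld k) (hd k) (cd k) (c0 _ a) a q q' r r' n n'.
have H13 : free_at h l k -> l k.+1 != 0 -> ~~ between l c h k.+1 -> _ :=
  fun f a n' => let: conj f1 f2 := andP f in
    let: And3 p q r := hl' _ f1 (c0 _ f1) in
    let: And3 p' q' r' := hl' _ a (c0 _ a) in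
    mixed_free_next p' p f2 (cd k) (c0 _ a) a q' r' n'.
have H23 : free_at h l k -> ~~ between l c h k -> _ :=
  fun f n => let: conj f1 f2 := andP f in
    let: And3 p q r := hl' _ f1 (c0 _ f1) in
    mixed_free_here lh' p f2 (cd k) q r n.
rewrite /L1 /L2 /S1 /S2 /L /S /long_row /short_row.
case: (cut_cases k cut1) => [[a1 a2 a3]|[a1 a2 a3]|[a1 a2]];
case: (cut_cases k cut2) => [[b1 b2 b3]|[b1 b2 b3]|[b1 b2]];
rewrite a1 a2 b1 b2 //=.
- have [|-> ->] // := H13 b3 a3; by apply/nb/between_cuts;
  rewrite ?a1 ?a2 ?b1 ?b2.
- have [||-> ->] // := H12 a3; by apply/nb/between_cuts; rewrite ?a1 ?a2 ?b1 ?b2.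
- have [|-> ->] // := H13 a3 b3; by apply/nb/between_cuts;
  rewrite ?a1 ?a2 ?b1 ?b2.
- have [|-> ->] // := H23 a3; by apply/nb/between_cuts; rewrite ?a1 ?a2 ?b1 ?b2.
- have [||-> ->] // := H12 b3; by apply/nb/between_cuts; rewrite ?a1 ?a2 ?b1 ?b2.
- have [|-> ->] // := H23 b3; by apply/nb/between_cuts; rewrite ?a1 ?a2 ?b1 ?b2.
Qed.

(** If [c] is at least as long as both rows, both conditions are of type A and see the pair only
    through the set of its entries in column [k.+1]. If it is shorter than both, [short_below_free]
    applies. Only the intermediate lengths require that [c] does not separate the pair. *)
Lemma below_transfer K1 K2 :
  cut h l K1 -> cut h l K2 ->
  (MM <= R < LL -> K1 != K2 -> (0 < minn K1 K2) || ~~ between l c h 0) ->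
  (forall k, below_ok LL MM R (L K1) (S K1) c k) ->
  forall k, below_ok LL MM R (L K2) (S K2) c k.
Proof.
move=> cut1 cut2 nb0 ok k.
have [<-|neq] := eqVneq K1 K2; first exact: ok.
have := ok k.
have [RL|RL] := leqP LL R.
  rewrite /below_ok RL (leq_trans leML RL) /invA /L /S /long_row /short_row.
  by case: (k.+1 < K1); case: (k.+1 < K2); rewrite // andbC.
have [MR|RM] := leqP MM R.
  have MRL : MM <= R < LL by rewrite MR RL.
  have nb p := @not_between_below K1 K2 p MRL cut1 cut2 ok (nb0 MRL neq).
  have [E _] := @mixed_cut K1 K2 k cut1 cut2 MR nb.
  by rewrite /below_ok leqNgt RL MR /= /invA /invB; move: E;
    rewrite /mixed_below => ->.
have lh' := le_lh.
have F := @short_below_free (l k) (l k.+1) (h k) (h k.+1) (c k) (lh' k.+1).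
have lc0 : l k.+1 = 0 -> c k = 0.
  move/eqP; rewrite -[_ == _]negbK lM -ltnNge ltnS => Mk.
  by apply/eqP; rewrite -[_ == _]negbK cR -ltnNge (leq_trans RM).
have lh0 := @lt_lh0 k.
rewrite /below_ok [LL <= R]leqNgt [MM <= R]leqNgt RL RM /= /invA /invB /L /S
  /long_row /short_row.
case: (cut_cases k cut1) => [[a1 a2 a3]|[a1 a2 /andP[a3 a4]]|[a1 a2]];
case: (cut_cases k cut2) => [[b1 b2 b3]|[b1 b2 /andP[b3 b4]]|[b1 b2]];
rewrite a1 a2 b1 b2 //=.
- by rewrite F // lh0.
- by rewrite andbC.
- by rewrite -F // lh0.
- by rewrite -F ?lh0 // andbC.
- by rewrite andbC.
- by rewrite andbC F // lh0.
Qed.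

(** Same three ranges of lengths; a row longer than both now gives two conditions of type B, which
    see the pair only in column [k]. *)
Lemma above_transfer K1 K2 :
  cut h l K1 -> cut h l K2 ->
  (MM < R <= LL -> K1 != K2 -> (0 < minn K1 K2) || ~~ between l c h 0) ->
  (forall k, above_ok LL MM R (L K1) (S K1) c k) ->
  forall k, above_ok LL MM R (L K2) (S K2) c k.
Proof.
move=> cut1 cut2 nb0 ok k.
have [<-|neq] := eqVneq K1 K2; first exact: ok.
have := ok k.
have [RL|RL] := leqP R LL; last first.
  rewrite /above_ok [_ <= LL]leqNgt RL leqNgt (leq_ltn_trans leML RL) /=.
  rewrite /invB /L /S /long_row /short_row.
  by case: (k < K1); case: (k < K2); rewrite // andbC.
have [RM|MR] := leqP R MM; last first.
  have MRL : MM < R <= LL by rewrite MR RL.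
  have nb p := @not_between_above K1 K2 p MRL cut1 cut2 ok (nb0 MRL neq).
  have [_ E] := @mixed_cut K1 K2 k cut1 cut2 (ltnW MR) nb.
  by rewrite /above_ok RL leqNgt MR /= /invA /invB; move: E;
    rewrite /mixed_above => ->.
rewrite /above_ok RL RM /invA /L /S /long_row /short_row.
have [//|/= c0] := boolP (c k.+1 == 0).
have lh' := le_lh.
have lh0 := @lt_lh0 k.
have F := @short_above_free (l k) (l k.+1) (h k) (h k.+1) (c k.+1) (lh' k.+1).
case: (cut_cases k cut1) => [[a1 a2 a3]|[a1 a2 /andP[a3 a4]]|[a1 a2]];
case: (cut_cases k cut2) => [[b1 b2 b3]|[b1 b2 /andP[b3 b4]]|[b1 b2]];
rewrite a1 a2 b1 b2 //=.
- by rewrite F // lh0.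
- by rewrite andbC.
- by rewrite -F // lh0.
- by rewrite -F ?lh0 // andbC.
- by rewrite andbC.
- by rewrite andbC F // lh0.
Qed.

End Rows.

(** * The inversion condition of two rows determines their cut *)

Section Pair.

Variables (L S : nat -> nat) (LL MM : nat).
Hypotheses (LLL : row_of_length L LL) (SMM : row_of_length S MM).
Hypotheses (leML : MM <= LL) (Ld : weakly_decr L) (Sd : weakly_decr S).
Hypothesis (neq : forall k, L k != 0 -> L k != S k).

Definition max_row (u v : nat -> nat) k := maxn (u k) (v k).
Definition min_row (u v : nat -> nat) k := minn (u k) (v k).

Let free := free_at (max_row L S) (min_row L S).

Definition arranged (u v : nat -> nat) K :=
  forall k, if k < K then u k <= v k else v k <= u k.

Lemma freeE k :
  free k = [&& k <= MM, L k.+1 <= L k, L k.+1 <= S k,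
    S k.+1 <= L k & S k.+1 <= S k].
Proof.
rewrite /free /free_at /min_row /max_row geq_max !leq_min -!lt0n leq_min !lt0n.
rewrite LLL SMM; case: (leqP k MM) => [leM|]; last by rewrite andbF.
by rewrite (leq_trans leM leML) /= -andbA.
Qed.

(** The alternative [L k < S k.+1] of type A is impossible when the rows are sorted in column [k],
    since [S] decreases, and also when [k] is free. *)
Lemma typeA_step k :
  invA L S k -> (S k <= L k) || free k -> S k.+1 <= L k.+1.
Proof.
rewrite /invA => + ok; case: eqP => [-> //|_ /= /orP[/ltnW //|lt]].
by case/orP: ok => [le|]; [have := Sd k|rewrite freeE => /and5P[_ _ _]]; lia.
Qed.

Lemma typeA_sorted_from k0 : (forall k, invA L S k) -> S k0 <= L k0 ->
  forall k, k0 <= k -> S k <= L k.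
Proof.
move=> ok le0; elim=> [|k IH]; first by rewrite leqn0 => /eqP <-.
rewrite leq_eqVlt => /orP[/eqP<- //|/IH le]; apply: typeA_step => //.
by rewrite le.
Qed.

(** Of the inequalities in [freeE] only [S k.+1 <= L k] can fail here. No inversion condition
    enters, so this serves both types. *)
Lemma typeA_unfree k :
  k <= MM -> L k < S k -> ~~ free k -> (S k.+1 != 0) && (L k.+1 < S k.+1).
Proof.
move=> leM lt; rewrite freeE leM /= (Ld k) (leq_trans (Ld k)) ?(ltnW lt) //=.
rewrite Sd andbT -ltnNge => lt'; rewrite -lt0n (leq_ltn_trans _ lt') //=.
by apply: leq_ltn_trans lt'; apply: Ld.
Qed.

Lemma unfree_typeA k0 : L k0 < S k0 -> forall k, k0 <= k -> k <= MM ->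
  (forall m, k0 <= m < k -> ~~ free m) -> L k < S k.
Proof.
move=> lt0; elim=> [|k IH]; first by rewrite leqn0 => /eqP<-.
rewrite leq_eqVlt => /orP[/eqP<- //|le0k] leM nf.
have lt : L k < S k.
  by apply: IH (ltnW leM) _ => // m /andP[a b]; apply: nf; rewrite a ltnW.
by have /andP[] := typeA_unfree (ltnW leM) lt (nf k (introT andP (conj le0k
  (ltnSn k)))).
Qed.

(** Without a free column the crossing would persist to column [MM] and then make [S] nonzero beyond
    its end. *)
Lemma crossed_has_free k0 : k0 <= MM -> L k0 < S k0 ->
  exists2 k, k0 <= k & free k.
Proof.
move=> le0 lt0; have [|nf] := boolP [exists k : 'I_MM.+1, (k0 <= k) && free k].
  by case/existsP=> k /andP[le fk]; exists (k : nat).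
have nf' m : k0 <= m < MM.+1 -> ~~ free m.
  case/andP=> le lt; move: nf; rewrite negb_exists => /forallP/(_ (Ordinal lt)).
  by rewrite /= le.
have lt : L MM < S MM.
  by apply: (unfree_typeA lt0) => // m /andP[a b]; apply: nf'; rewrite a ltnW.
have nM : ~~ free MM by apply: nf'; rewrite le0 /=.
have /andP[] := typeA_unfree (leqnn MM) lt nM.
by rewrite SMM ltnn.
Qed.

Lemma typeA_sorted :
  (forall k, invA L S k) -> S 0 <= L 0 -> arranged L S 0.
Proof. by move=> ok le0 k; apply: (typeA_sorted_from ok le0). Qed.

(** Decrease alone keeps the rows crossed up to the first free column; type A then sorts them just
    after it and for ever. *)
Lemma typeA_crossed K : (forall k, invA L S k) -> L 0 < S 0 ->
  free K -> (forall m, m < K -> ~~ free m) -> arranged L S K.+1.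
Proof.
move=> ok lt0 fK nf k; have leM : K <= MM by move: fK; rewrite freeE => /andP[].
rewrite ltnS; case: leqP => [lekK|].
  apply: ltnW; apply: (unfree_typeA lt0) => // [|m /andP[_ lt]].
    exact: leq_trans lekK _.
  by apply: nf; apply: leq_trans lekK.
apply: typeA_sorted_from => //; apply: typeA_step => //; by rewrite fK orbT.
Qed.

(** Type B turns [S k < L k] into [S k < L k.+1]. This keeps the rows sorted, and makes column [k]
    not free. *)
Lemma typeB_forced k0 : MM < LL -> (forall k, invB S L k) -> S k0 < L k0 ->
  forall k, k0 <= k -> k <= MM -> (S k < L k) && ~~ free k.
Proof.
move=> ltM ok lt0.
have step k : k <= MM -> S k < L k -> S k < L k.+1.
  move=> leM lt; have := ok k; rewrite /invB LLL (leq_ltn_trans leM ltM) /=.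
  by case/orP=> // lt'; have := ltn_trans lt lt'; rewrite ltnn.
have main k : k0 <= k -> k <= MM -> S k < L k.
  elim: k => [|k IH]; first by rewrite leqn0 => /eqP<-.
  rewrite leq_eqVlt => /orP[/eqP<- //|/IH lt] leM.
  by apply: leq_ltn_trans (Sd k) (step _ (ltnW leM) (lt (ltnW leM))).
move=> k le leM; rewrite main // freeE leM /=.
by rewrite [L k.+1 <= S k]leqNgt step ?andbF // main.
Qed.

Lemma typeB_sorted : MM < LL -> (forall k, invB S L k) -> S 0 < L 0 ->
  arranged L S 0 /\ forall k, ~~ free k.
Proof.
move=> ltM ok lt0; have F := typeB_forced ltM ok lt0.
split=> k /=; last first.
  case: (leqP k MM) => leM; first by have /andP[] := F k (leq0n k) leM.
  by rewrite freeE leqNgt leM.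
case: (leqP k MM) => leM; first by have /andP[/ltnW] := F k (leq0n k) leM.
by move: leM; rewrite ltnNge -SMM negbK => /eqP->.
Qed.

(** Rows sorted at or before [K] would make [K] not free by [typeB_forced]; rows crossed after [K]
    would have a later free column by [crossed_has_free]. *)
Lemma typeB_crossed K : MM < LL -> (forall k, invB S L k) -> L 0 < S 0 ->
  free K -> (forall m, K < m -> ~~ free m) -> arranged L S K.+1.
Proof.
move=> ltM ok lt0 fK nf k; have leM : K <= MM by move: fK;
  rewrite freeE => /andP[].
rewrite ltnS; case: (leqP k K) => [lekK|ltKk].
  rewrite leqNgt; apply/negP => lt.
  by have /andP[_] := typeB_forced ltM ok lt lekK leM; rewrite fK.
case: (leqP k MM) => leM'; last first.
  by move: leM'; rewrite ltnNge -SMM negbK => /eqP->.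
rewrite leqNgt; apply/negP => lt.
have [m le] := crossed_has_free leM' lt.
by apply/negP/nf; apply: leq_trans le.
Qed.

End Pair.

(** * Conversely, the cut 0, the first and the last cut give rows satisfying the conditions *)

Section Arrangements.

Variables (h l : nat -> nat) (LL MM : nat).
Hypotheses (hL : row_of_length h LL) (lM : row_of_length l MM).
Hypotheses (leML : MM <= LL) (hd : weakly_decr h) (ld : weakly_decr l).
Hypothesis (lt_lh : forall k, h k != 0 -> l k < h k).

Lemma long_row_length K : cut h l K -> row_of_length (long_row h l K) LL.
Proof.
move=> cK k; rewrite /long_row; case: ltnP => // lt.
case: K cK lt => // K /andP[]; rewrite lM => leK _; rewrite ltnS => lt.
by rewrite lM (leq_trans lt leK) (leq_trans lt (leq_trans leK leML)).
Qed.

Lemma short_row_length K : cut h l K -> row_of_length (short_row h l K) MM.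
Proof.
move=> cK k; rewrite /short_row; case: ltnP => // lt.
case: K cK lt => // K /andP[]; rewrite lM => leK _; rewrite ltnS => lt.
by rewrite hL (leq_trans lt leK) (leq_trans lt (leq_trans leK leML)).
Qed.

Lemma long_row_decr K : cut h l K -> weakly_decr (long_row h l K).
Proof.
move=> cK k; rewrite /long_row.
case: (cut_cases lM k cK) => [[-> -> _]|[-> -> /andP[_]]|[-> ->]] //.
Qed.

Lemma short_row_decr K : cut h l K -> weakly_decr (short_row h l K).
Proof.
move=> cK k; rewrite /short_row.
case: (cut_cases lM k cK) => [[-> -> _]|[-> -> _]|[-> ->]] //.
apply: leq_trans (ld k) _; exact: (le_lh hL lM).
Qed.

Lemma typeA_arranged0 k : invA (long_row h l 0) (short_row h l 0) k.
Proof.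
by apply/implyP => l0; rewrite /long_row /short_row /= (lt_lh0 hL lM).
Qed.

(** Before the first free column, not being free is exactly the alternative [l k < h k.+1] of type
    A; from there on the smaller entry is in the upper row. *)
Lemma typeA_arranged K k : free_at h l K -> (forall m,
  m < K -> ~~ free_at h l m) ->
  invA (long_row h l K.+1) (short_row h l K.+1) k.
Proof.
move=> fK nf; apply/implyP; rewrite /long_row /short_row !ltnS.
case: ltnP => [lt h0|_ l0]; last by rewrite (lt_lh0 hL lM).
rewrite (ltnW lt); have := nf k lt; rewrite /free_at negb_and -ltnNge.
case/orP=> [|->]; last by rewrite orbT.
by move: fK => /andP[]; rewrite !lM => leM _; rewrite (leq_trans (ltnW lt) leM).
Qed.

Lemma typeB_arranged0 k : (forall m, ~~ free_at h l m) ->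
  invB (short_row h l 0) (long_row h l 0) k.
Proof.
move=> nf; apply/implyP; rewrite /long_row /short_row /= => h0.
have := nf k; rewrite /free_at negb_and -ltnNge => /orP[|-> //].
by move/negbNE/eqP->; rewrite lt0n h0.
Qed.

(** Up to [K] the longer row has the smaller entry, which is one alternative of type B; after the
    last free column, [l k < h k.+1] is the other. *)
Lemma typeB_arranged K k : free_at h l K -> (forall m,
  K < m -> ~~ free_at h l m) ->
  invB (short_row h l K.+1) (long_row h l K.+1) k.
Proof.
move=> fK nf; apply/implyP; rewrite /long_row /short_row !ltnS.
case: (leqP k K) => [le _|lt].
  suff lt : l k < h k by rewrite /= lt orbT.
  apply: (lt_lh0 hL lM) => //; move: fK => /andP[]; rewrite !lM => leM _.
  exact: leq_trans leM.
rewrite ltnNge (ltnW lt) /= => h0.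
have := nf k lt; rewrite /free_at negb_and -ltnNge => /orP[|-> //].
by move/negbNE/eqP->; rewrite lt0n h0.
Qed.

End Arrangements.

Definition pair_ok (a b : nat) (u v : nat -> nat) k :=
  if b <= a then invA u v k else invB u v k.

Record skyline_spec n (sigma : 'I_n -> 'I_n) (len : 'I_n -> nat)
    (g : 'I_n -> nat -> nat) : Prop := SkylineSpec {
  spec_length r : row_of_length (g r) (len r);
  spec_basement r : g r 0 = (sigma r).+1;
  spec_column (r r' : 'I_n) k : r != r' -> g r k != 0 -> g r k != g r' k;
  spec_decr r : weakly_decr (g r);
  spec_pair (p q : 'I_n) k : p < q -> pair_ok (len p) (len q) (g p) (g q) k
}.

Definition rearrange n (h l : nat -> nat) (p q : 'I_n) K
    (g : 'I_n -> nat -> nat) (r : 'I_n) k :=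
  if r == p then long_row h l K k
  else if r == q then short_row h l K k else g r k.

(** * Recutting two adjacent rows inside a whole filling *)

Section Rearrange.

Variables (n : nat) (p1 q1 p2 q2 : 'I_n) (h l : nat -> nat) (LL MM : nat).
Hypothesis adjacent : (p1.+1 == q1) || (q1.+1 == p1).
Hypothesis same_rows : (p2 == p1) && (q2 == q1) || (p2 == q1) && (q2 == p1).
Hypotheses (hL : row_of_length h LL) (lM : row_of_length l MM).
Hypotheses (leML : MM <= LL) (hd : weakly_decr h) (ld : weakly_decr l).
Hypothesis (lt_lh : forall k, h k != 0 -> l k < h k).

Variables (g : 'I_n -> nat -> nat) (K1 K2 : nat).
Hypotheses (cut1 : cut h l K1) (cut2 : cut h l K2).
Hypotheses (gp1 : g p1 =1 long_row h l K1) (gq1 : g q1 =1 short_row h l K1).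

Variables (s1 s2 : 'I_n -> 'I_n) (len1 len2 : 'I_n -> nat).
Hypothesis spec1 : skyline_spec s1 len1 g.
Hypotheses (len1p : len1 p1 = LL) (len1q : len1 q1 = MM).
Hypotheses (len2p : len2 p2 = LL) (len2q : len2 q2 = MM).
Hypothesis len12 : forall r, r != p1 -> r != q1 -> len2 r = len1 r.

Let g2 := rearrange h l p2 q2 K2 g.

Hypothesis base2 : forall r, g2 r 0 = (s2 r).+1.
Hypothesis ok_pq : p2 < q2 ->
  forall k, pair_ok LL MM (long_row h l K2) (short_row h l K2) k.
Hypothesis ok_qp : q2 < p2 ->
  forall k, pair_ok MM LL (short_row h l K2) (long_row h l K2) k.
Hypothesis nb_below : forall r : 'I_n, r < p1 -> r < q1 -> MM <= len1 r < LL ->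
  K1 != K2 ->
  (0 < minn K1 K2) || ~~ between l (g r) h 0.
Hypothesis nb_above : forall r : 'I_n, p1 < r -> q1 < r -> MM < len1 r <= LL ->
  K1 != K2 ->
  (0 < minn K1 K2) || ~~ between l (g r) h 0.

Lemma neq_pq1 : p1 != q1.
Proof.
by apply/eqP => E; move: adjacent; rewrite E orbb -[_ == _]/(_ == _ :> nat)
  eqn_leq ltnn.
Qed.

Lemma neq_pq2 : p2 != q2.
Proof.
by case/orP: same_rows => /andP[/eqP-> /eqP->];
  rewrite // ?neq_pq1 // eq_sym neq_pq1.
Qed.

Lemma other_rows r : r != p2 -> r != q2 -> (r != p1) && (r != q1).
Proof. by case/orP: same_rows => /andP[/eqP-> /eqP->] -> ->. Qed.

Lemma rearrange_long : g2 p2 =1 long_row h l K2.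
Proof. by move=> k; rewrite /g2 /rearrange eqxx. Qed.

Lemma rearrange_short : g2 q2 =1 short_row h l K2.
Proof. by move=> k; rewrite /g2 /rearrange eq_sym (negbTE neq_pq2) eqxx. Qed.

Lemma rearrange_other r : r != p2 -> r != q2 -> g2 r = g r.
Proof. by move=> /negbTE rp /negbTE rq; rewrite /g2 /rearrange rp rq. Qed.

Lemma other_neq r k : r != p1 -> r != q1 ->
  [/\ g r k != 0 -> g r k != h k, g r k != 0 -> g r k != l k,
      h k != 0 -> h k != g r k & l k != 0 -> l k != g r k].
Proof.
move=> rp rq; have := gp1 k; have := gq1 k; rewrite /long_row /short_row.
have H := spec_column spec1.
case: ifP => _ <- <-; split; apply: H => //; by rewrite eq_sym.
Qed.

(** Adjacency leaves no room for a third row between the two, so it sees both from the same side, as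
    the transfer lemmas require. *)
Lemma other_side r : r != p1 -> r != q1 -> (r < p1) = (r < q1).
Proof.
move=> rp rq; have {rp}rp : r != p1 :> nat by [];
  have {rq}rq : r != q1 :> nat by [].
by case/orP: adjacent rp rq => /eqP<-; rewrite ltnS; case: ltngtP.
Qed.

Lemma other_side' r : r != p1 -> r != q1 -> (p1 < r) = (q1 < r).
Proof.
move=> rp rq; have {rp}rp : r != p1 :> nat by [];
  have {rq}rq : r != q1 :> nat by [].
case/orP: adjacent rp rq => /eqP<- a b.
  by rewrite [_.+1 < _]ltn_neqAle eq_sym b.
by rewrite [_.+1 < _]ltn_neqAle eq_sym a.
Qed.

Lemma rearrange_below r k : r != p1 -> r != q1 -> r < p1 ->
  pair_ok (len1 r) LL (g r) (long_row h l K2) k &&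
  pair_ok (len1 r) MM (g r) (short_row h l K2) k.
Proof.
move=> rp rq ltp; have ltq : r < q1 by rewrite -other_side.
apply: (below_transfer hL lM leML hd ld lt_lh (spec_length spec1 r)
  (spec_decr spec1 r) _ _ cut1 cut2 (nb_below ltp ltq) _ k).
- by move=> k' c0; have [] := other_neq k' rp rq; auto.
- by move=> k' c0; have [] := other_neq k' rp rq; auto.
move=> k'; have := spec_pair spec1 k' ltp; have := spec_pair spec1 k' ltq.
rewrite /pair_ok /below_ok len1p len1q /invA /invB.
by rewrite !gp1 !gq1 => -> ->.
Qed.

Lemma rearrange_above r k : r != p1 -> r != q1 -> p1 < r ->
  pair_ok LL (len1 r) (long_row h l K2) (g r) k &&
  pair_ok MM (len1 r) (short_row h l K2) (g r) k.
Proof.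
move=> rp rq ltp; have ltq : q1 < r by rewrite -other_side'.
apply: (above_transfer hL lM leML hd ld lt_lh (spec_length spec1 r)
  (spec_decr spec1 r) _ _ cut1 cut2 (nb_above ltp ltq) _ k).
- by move=> k' c0; have [] := other_neq k' rp rq; auto.
- by move=> k' c0; have [] := other_neq k' rp rq; auto.
move=> k'; have := spec_pair spec1 k' ltp; have := spec_pair spec1 k' ltq.
rewrite /pair_ok /above_ok len1p len1q /invA /invB.
by rewrite !gp1 !gq1 => -> ->.
Qed.

Lemma same_row_cases r : r = p2 \/ r = q2 -> r = p1 \/ r = q1.
Proof.
by case/orP: same_rows => /andP[/eqP-> /eqP->] [] ->; auto.
Qed.

Lemma pair_ok_ext a b u u' v v' k :
  u =1 u' -> v =1 v' -> pair_ok a b u v k = pair_ok a b u' v' k.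
Proof. by move=> eu ev; rewrite /pair_ok /invA /invB !eu !ev. Qed.

Lemma side_row (r s : 'I_n) : r != p1 -> r != q1 -> s = p2 \/ s = q2 ->
  ((r < s) = (r < p1)) * ((s < r) = (p1 < r)).
Proof.
move=> rp rq /same_row_cases[]->; first by split.
by rewrite (other_side rp rq) (other_side' rp rq).
Qed.

(** Each condition involves at most two rows: the pair itself is handled by [ok_pq] and [ok_qp], one
    row of it with a third row by the transfer lemmas, and two other rows are unchanged. *)
Lemma rearrange_spec : skyline_spec s2 len2 g2.
Proof.
have Dp := rearrange_long; have Dq := rearrange_short.
have rowP r : [\/ r = p2, r = q2 | [/\ g2 r = g r, r != p1 & r != q1]].
  have [->|rp] := eqVneq r p2; first by constructor 1.
  have [->|rq] := eqVneq r q2; first by constructor 2.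
  have /andP[] := other_rows rp rq.
  by constructor 3; split=> //; apply: rearrange_other.
have Lh := long_row_length hL lM leML cut2.
have Sh := short_row_length hL lM leML cut2.
have L0 k : long_row h l K2 k != 0 -> short_row h l K2 k != long_row h l K2 k /\
  long_row h l K2 k != short_row h l K2 k.
  move=> nz; suff : long_row h l K2 k != short_row h l K2 k by rewrite eq_sym.
  have := @lt_lh k; rewrite hL -Lh nz => /(_ isT).
  by rewrite /long_row /short_row; case: ifP => _; case: ltngtP.
split.
- move=> r; case: (rowP r) => [->|->|[-> rp rq]] k.
  + by rewrite Dp len2p Lh.
  + by rewrite Dq len2q Sh.
  by rewrite len12 // (spec_length spec1).
- exact: base2.
- have LS k x : (h k != 0 -> h k != x) -> (l k != 0 -> l k != x) ->
     (long_row h l K2 k != 0 -> long_row h l K2 k != x) /\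
     (short_row h l K2 k != 0 -> short_row h l K2 k != x).
    by rewrite /long_row /short_row; case: ifP.
  move=> r r' k; case: (rowP r) => [->|->|[-> rp rq]];
    case: (rowP r') => [->|->|[-> rp' rq']]; rewrite ?eqxx ?Dp ?Dq // => neq nz.
  + by case: (L0 k nz).
  + have [_ _ a b] := other_neq k rp' rq'; by case: (LS k _ a b) => A _; apply: A.
  + have nz' : long_row h l K2 k != 0.
      by rewrite Lh (leq_trans _ leML) // -Sh.
    by case: (L0 k nz').
  + have [_ _ a b] := other_neq k rp' rq'; by case: (LS k _ a b) => _; apply.
  + have [a b _ _] := other_neq k rp rq.
    by rewrite /long_row; case: ifP => _; auto.
  + have [a b _ _] := other_neq k rp rq.
    by rewrite /short_row; case: ifP => _; auto.
  exact: (spec_column spec1).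
- move=> r k; case: (rowP r) => [->|->|[-> rp rq]].
  + by rewrite !Dp (long_row_decr lM hd ld).
  + by rewrite !Dq (short_row_decr hL lM leML hd ld lt_lh).
  exact: (spec_decr spec1).
move=> r r' k; case: (rowP r) => [->|->|[Er rp rq]];
  case: (rowP r') => [->|->|[Er' rp' rq']]; rewrite ?ltnn // => lt.
- by rewrite (pair_ok_ext _ _ _ Dp Dq) len2p len2q ok_pq.
- have [] := side_row rp' rq' (or_introl (erefl p2)); rewrite lt => _ /esym lt'.
  have /andP[A _] := rearrange_above k rp' rq' lt'.
  by rewrite Er' len2p len12 // (pair_ok_ext _ _ _ Dp (frefl _)).
- by rewrite (pair_ok_ext _ _ _ Dq Dp) len2p len2q ok_qp.
- have [] := side_row rp' rq' (or_intror (erefl q2)); rewrite lt => _ /esym lt'.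
  have /andP[_ A] := rearrange_above k rp' rq' lt'.
  by rewrite Er' len2q len12 // (pair_ok_ext _ _ _ Dq (frefl _)).
- have [+ _] := side_row rp rq (or_introl (erefl p2)); rewrite lt => /esym lt'.
  have /andP[A _] := rearrange_below k rp rq lt'.
  by rewrite Er len2p len12 // (pair_ok_ext _ _ _ (frefl _) Dp).
- have [+ _] := side_row rp rq (or_intror (erefl q2)); rewrite lt => /esym lt'.
  have /andP[_ A] := rearrange_below k rp rq lt'.
  by rewrite Er len2q len12 // (pair_ok_ext _ _ _ (frefl _) Dq).
rewrite Er Er' !len12 //; exact: (spec_pair spec1).
Qed.

End Rearrange.

(** * Exchanging adjacent rows *)

Section PlainFillings.

Variables n N : nat.

(* An entry [e] is stored as [e.+1] and an empty box as [0]. *)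
Definition plain := {ffun 'I_n * 'I_N -> 'I_n.+1}.

Implicit Types (f : plain) (g : 'I_n -> nat -> nat).

Definition entry f (r : 'I_n) (k : nat) : nat :=
  if insub k is Some k' then f (r, k') : nat else 0.

Definition plain_of g : plain := [ffun u : 'I_n * 'I_N => inord (g u.1 u.2)].

Definition columns f : {ffun 'I_N -> {set 'I_n}} :=
  [ffun k : 'I_N => [set e : 'I_n | [exists r, entry f r k == e.+1]]].

Lemma entry_out f r k : N <= k -> entry f r k = 0.
Proof. by move=> le; rewrite /entry insubF // ltnNge le. Qed.

Lemma entry_ord f r (k : 'I_N) : entry f r k = f (r, k).
Proof. by rewrite /entry valK. Qed.

Lemma entry_le f r k : entry f r k <= n.
Proof. by rewrite /entry; case: insub => // k'; rewrite -ltnS. Qed.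

Lemma entry_inj f f' : (forall r k, entry f r k = entry f' r k) -> f = f'.
Proof.
by move=> E; apply/ffunP=> -[r k]; apply: ord_inj; rewrite -!entry_ord.
Qed.

Lemma entry_plain_of g :
  (forall r k, g r k <= n) -> (forall r k, N <= k -> g r k = 0) ->
  forall r k, entry (plain_of g) r k = g r k.
Proof.
move=> le out r k; case: (ltnP k N) => lt; last by rewrite entry_out // out.
by rewrite -[k]/(Ordinal lt : nat) entry_ord ffunE inordK // ltnS.
Qed.

Definition skyline_plain (sigma : 'I_n -> 'I_n) (len : 'I_n -> nat) f : bool :=
  [&& [forall r, forall k : 'I_N, (entry f r k != 0) == (k <= len r)],
      [forall r, entry f r 0 == (sigma r).+1],
      [forall r, forall r', forall k : 'I_N,
        (r != r') && (entry f r k != 0) ==> (entry f r k != entry f r' k)],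
      [forall r, forall k : 'I_N, entry f r k.+1 <= entry f r k]
    & [forall p : 'I_n, forall q : 'I_n, forall k : 'I_N,
        (p < q) ==> pair_ok (len p) (len q) (entry f p) (entry f q) k]].

Lemma skyline_plainP sigma len f : (forall r, len r < N) ->
  reflect (skyline_spec sigma len (entry f)) (skyline_plain sigma len f).
Proof.
move=> lenN; apply: (iffP and5P) => [[A B C D E]|[A B C D E]]; split.
- move=> r k; case: (ltnP k N) => lt.
    by have /forallP/(_ (Ordinal lt))/eqP := forallP A r.
  rewrite entry_out //=; apply/esym/negbTE; rewrite -ltnNge.
  exact: leq_trans (lenN r) lt.
- by move=> r; apply/eqP/(forallP B).
- move=> r r' k neq nz; case: (ltnP k N) => lt; last by rewrite entry_out in nz.
  have /forallP/(_ r')/forallP/(_ (Ordinal lt))/implyP := forallP C r.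
  by apply; rewrite neq.
- move=> r k; case: (ltnP k N) => lt; last by rewrite entry_out // ltnW.
  by have /forallP/(_ (Ordinal lt)) := forallP D r.
- move=> p q k lt; case: (ltnP k N) => ltN.
    have /forallP/(_ q)/forallP/(_ (Ordinal ltN))/implyP := forallP E p.
    exact.
  by rewrite /pair_ok /invA /invB !(@entry_out _ _ k.+1 (leqW ltN)); case: ifP.
- by apply/forallP=> r; apply/forallP=> k; rewrite A.
- by apply/forallP=> r; rewrite B.
- apply/forallP=> r; apply/forallP=> r'; apply/forallP=> k; apply/implyP.
  by case/andP; apply: C.
- by apply/forallP=> r; apply/forallP=> k; apply: D.
apply/forallP=> p; apply/forallP=> q; apply/forallP=> k; apply/implyP.
exact: E.
Qed.

Variables i j : 'I_n.
Hypothesis neq_ij : i != j.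

Definition hrow f := max_row (entry f i) (entry f j).
Definition lrow f := min_row (entry f i) (entry f j).

(** The rule [kappa] computes the cut from the columnwise maxima and minima, which recutting
    preserves; hence recuttings can be inverted. *)
Definition recut (p q : 'I_n) (kappa : (nat -> nat) -> (nat -> nat) -> nat) f :=
  plain_of (rearrange (hrow f) (lrow f) p q (kappa (hrow f) (lrow f)) (entry f)).

Definition pair_ij p q := (p == i) && (q == j) || (p == j) && (q == i).

Lemma entry_recut p q kappa f r k : entry (recut p q kappa f) r k =
  rearrange (hrow f) (lrow f) p q (kappa (hrow f) (lrow f)) (entry f) r k.
Proof.
apply: entry_plain_of => {}r {}k; rewrite /rearrange /long_row /short_row
  /hrow /lrow /max_row /min_row.
  by repeat case: ifP => _; rewrite ?geq_max ?geq_min !entry_le.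
move=> le; rewrite !(entry_out _ _ le).
by repeat case: ifP => _; rewrite ?maxnn ?minnn ?entry_out.
Qed.

Lemma neq_pair p q : pair_ij p q -> p != q.
Proof. by case/orP=> /andP[/eqP-> /eqP->] //; rewrite eq_sym. Qed.

Lemma hrow_pair p q f : pair_ij p q -> hrow f =1 max_row (entry f p) (entry f q).
Proof. by case/orP=> /andP[/eqP-> /eqP->] k //; rewrite /max_row maxnC. Qed.

Lemma lrow_pair p q f : pair_ij p q -> lrow f =1 min_row (entry f p) (entry f q).
Proof. by case/orP=> /andP[/eqP-> /eqP->] k //; rewrite /min_row minnC. Qed.

Lemma lrow_le f k : lrow f k <= hrow f k.
Proof. by rewrite /lrow /hrow /min_row /max_row geq_min leq_max leqnn. Qed.

Lemma rearrange_p h l p q K g k : rearrange h l p q K g p k = long_row h l K k.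
Proof. by rewrite /rearrange eqxx. Qed.

Lemma rearrange_q h l p q K g k :
  p != q -> rearrange h l p q K g q k = short_row h l K k.
Proof. by move=> neq; rewrite /rearrange eq_sym (negbTE neq) eqxx. Qed.

Lemma hrow_recut p q kappa f : pair_ij p q -> hrow (recut p q kappa f) =1 hrow f.
Proof.
move=> pq k; rewrite (hrow_pair _ pq) /max_row !entry_recut rearrange_p.
rewrite rearrange_q ?neq_pair // /long_row /short_row.
by case: ifP => _; rewrite ?(maxn_idPl (lrow_le f k)) ?(maxn_idPr (lrow_le f k)).
Qed.

Lemma lrow_recut p q kappa f : pair_ij p q -> lrow (recut p q kappa f) =1 lrow f.
Proof.
move=> pq k; rewrite (lrow_pair _ pq) /min_row !entry_recut rearrange_p.
rewrite rearrange_q ?neq_pair // /long_row /short_row.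
by case: ifP => _; rewrite ?(minn_idPl (lrow_le f k)) ?(minn_idPr (lrow_le f k)).
Qed.

Lemma arranged_rows f p q K : pair_ij p q ->
  arranged (entry f p) (entry f q) K ->
  (entry f p =1 long_row (hrow f) (lrow f) K) *
  (entry f q =1 short_row (hrow f) (lrow f) K).
Proof.
move=> pq ar; split=> k; rewrite /long_row /short_row (hrow_pair _ pq)
  (lrow_pair _ pq) /max_row /min_row; have := ar k; case: ifP => _ le;
  by rewrite ?(maxn_idPl le) ?(maxn_idPr le) ?(minn_idPl le) ?(minn_idPr le).
Qed.

(** Rows are only known to be equal pointwise, so a cut rule has to respect pointwise equality. *)
Definition ext_cut (kappa : (nat -> nat) -> (nat -> nat) -> nat) :=
  forall h h' l l', h =1 h' -> l =1 l' -> kappa h l = kappa h' l'.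

Lemma mem_pair p q r : pair_ij p q -> (r == p) || (r == q) = (r == i) || (r == j).
Proof. by case/orP=> /andP[/eqP-> /eqP->] //; rewrite orbC. Qed.

(** The first recutting forgets only the cut of [f], and [kappa] finds that cut again in the
    unchanged maxima and minima. *)
Lemma recutK p q kappa p' q' kappa' f : pair_ij p q -> pair_ij p' q' ->
  ext_cut kappa -> arranged (entry f p) (entry f q) (kappa (hrow f) (lrow f)) ->
  recut p q kappa (recut p' q' kappa' f) = f.
Proof.
move=> pq pq' ext ar; apply: entry_inj => r k; rewrite entry_recut.
have [Hh Hl] := (hrow_recut kappa' f pq', lrow_recut kappa' f pq').
rewrite (ext _ _ _ _ Hh Hl); have [P Q] := arranged_rows pq ar.
rewrite /rearrange; case: eqP => [->|rp].
  by rewrite P /long_row Hh Hl.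
case: eqP => [->|rq]; first by rewrite Q /short_row Hh Hl.
have := mem_pair r pq; rewrite (introF eqP rp) (introF eqP rq) -(mem_pair r pq').
by rewrite entry_recut /rearrange; case: ifP => //= _; case: ifP.
Qed.

Lemma columns_recut p q kappa f : pair_ij p q -> columns (recut p q kappa f) =
  columns f.
Proof.
move=> pq; apply/ffunP=> k; rewrite !ffunE; apply/setP=> e; rewrite !inE.
have Pij (P : pred 'I_n) : P i || P j = P p || P q.
  by case/orP: pq => /andP[/eqP-> /eqP->] //; rewrite orbC.
have ex (P : pred 'I_n) : [exists r, P r] =
    [exists r, ~~ ((r == i) || (r == j)) && P r] || (P i || P j).
  apply/existsP/idP=> [[r Pr]|].
    case E: ((r == i) || (r == j)).
      by case/orP: E => /eqP <-; rewrite Pr ?orbT.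
    by apply/orP; left; apply/existsP; exists r; rewrite E.
  by case/or3P=> [/existsP[r /andP[_ Pr]]||] *; [exists r|exists i|exists j].
rewrite [LHS]ex [RHS]ex; congr (_ || _).
  apply: eq_existsb => r; case E: ((r == i) || (r == j)) => //=.
  rewrite entry_recut /rearrange.
  by move: E; rewrite -(mem_pair _ pq); case: (r == p); case: (r == q).
rewrite !(Pij (fun r => entry _ r k == _)) !entry_recut rearrange_p.
rewrite rearrange_q ?neq_pair //.
rewrite /long_row /short_row (hrow_pair _ pq) (lrow_pair _ pq) /max_row /min_row.
case: ifP => _; case: (leqP (entry f p k) (entry f q k)) => // _; by rewrite orbC.
Qed.

Variables (R : nmodType) (W : {ffun 'I_N -> {set 'I_n}} -> R).

(** The two recuttings are inverse bijections between [P1] and [P2], and [columns_recut] preserves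
    the weight. *)
Lemma sum_recut p1 q1 kappa1 p2 q2 kappa2 (P1 P2 : pred plain) :
  pair_ij p1 q1 -> pair_ij p2 q2 -> ext_cut kappa1 -> ext_cut kappa2 ->
  (forall f, P1 f ->
    arranged (entry f p1) (entry f q1) (kappa1 (hrow f) (lrow f)) /\
    P2 (recut p2 q2 kappa2 f)) ->
  (forall f, P2 f ->
    arranged (entry f p2) (entry f q2) (kappa2 (hrow f) (lrow f)) /\
    P1 (recut p1 q1 kappa1 f)) ->
  (\sum_(f | P1 f) W (columns f) = \sum_(f | P2 f) W (columns f))%R.
Proof.
move=> pq1 pq2 e1 e2 H1 H2.
rewrite (reindex_onto (recut p1 q1 kappa1) (recut p2 q2 kappa2)) /=; last first.
  by move=> f /H1[ar _]; apply: recutK.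
apply: eq_big => [f|f _]; last by rewrite columns_recut.
apply/andP/idP=> [[/H1[_ +] /eqP E]|P2f]; first by rewrite E.
by have [ar P1f] := H2 f P2f; split=> //; apply/eqP/recutK.
Qed.

End PlainFillings.

Section Cuts.

Variables (N : nat) (h l : nat -> nat).

Definition no_cut (h l : nat -> nat) := 0.
(** The successor is there because a cut after column [k] is encoded as [k.+1]. *)
Definition first_cut (h l : nat -> nat) := (find (free_at h l) (iota 0 N)).+1.
Definition last_cut (h l : nat -> nat) := \max_(k < N | free_at h l k) k.+1.

Definition has_free := has (free_at h l) (iota 0 N).

Hypothesis lN : forall k, N <= k -> l k = 0.

Lemma free_lt k : free_at h l k -> k < N.
Proof. by case/andP=> l0 _; rewrite ltnNge; apply: contra l0 => /lN->. Qed.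

Lemma has_freeP : reflect (exists k, free_at h l k) has_free.
Proof.
apply: (iffP hasP) => [[k _ fk]|[k fk]]; exists k => //.
by rewrite mem_iota (free_lt fk).
Qed.

Lemma first_cutP : has_free -> exists K, [/\ first_cut h l = K.+1, free_at h l K
  & forall m, m < K -> ~~ free_at h l m].
Proof.
move=> hf; have lt : find (free_at h l) (iota 0 N) < N.
  by rewrite -[X in _ < X](size_iota 0) -has_find.
exists (find (free_at h l) (iota 0 N)); split=> //.
  by have := nth_find 0 hf; rewrite nth_iota.
move=> m ltm; have := before_find 0 ltm.
by rewrite nth_iota ?add0n => [->|]; rewrite ?(ltn_trans ltm).
Qed.

Lemma last_cutP : has_free -> exists K, [/\ last_cut h l = K.+1, free_at h l K
  & forall m, K < m -> ~~ free_at h l m].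
Proof.
case/has_freeP=> k fk; have ltN := free_lt fk.
have [|K fK E] := eq_bigmax_cond (fun k : 'I_N => k.+1)
  (A := [pred k : 'I_N | free_at h l k]).
  by apply/card_gt0P; exists (Ordinal ltN).
exists K; split=> //; move=> m ltm; apply/negP => fm.
have := @leq_bigmax_cond _ (fun k : 'I_N => free_at h l k) (fun k => k.+1)
  (Ordinal (free_lt fm)) fm.
by rewrite [X in _ <= X]E /= ltnS leqNgt ltm.
Qed.

End Cuts.

Lemma no_cut_ext : ext_cut no_cut.
Proof. by []. Qed.

Lemma free_at_ext h h' l l' : h =1 h' -> l =1 l' -> free_at h l =1 free_at h' l'.
Proof. by move=> eh el k; rewrite /free_at eh el. Qed.

Lemma first_cut_ext N : ext_cut (first_cut N).
Proof. by move=> h h' l l' eh el; rewrite /first_cut (eq_find (free_at_ext eh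
  el)). Qed.

Lemma last_cut_ext N : ext_cut (last_cut N).
Proof.
move=> h h' l l' eh el; apply: eq_bigl => k; exact: free_at_ext.
Qed.

Lemma has_free_ext N h h' l l' : h =1 h' -> l =1 l' -> has_free N h l =
  has_free N h' l'.
Proof. by move=> eh el; apply: eq_has; apply: free_at_ext. Qed.

Section RowPairs.

Variables (n : nat) (sigma : 'I_n -> 'I_n) (len : 'I_n -> nat).
Variables (g : 'I_n -> nat -> nat) (p q : 'I_n).
Hypotheses (sp : skyline_spec sigma len g) (neq_pq : p != q).
Hypothesis (le_qp : len q <= len p).

Lemma max_row_length : row_of_length (max_row (g p) (g q)) (len p).
Proof.
move=> k; rewrite /max_row -lt0n leq_max !lt0n !(spec_length sp).
by apply/orP/idP => [[//|le]|]; [apply: leq_trans le_qp|left].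
Qed.

Lemma min_row_length : row_of_length (min_row (g p) (g q)) (len q).
Proof.
move=> k; rewrite /min_row -lt0n leq_min !lt0n !(spec_length sp).
by apply/andP/idP => [[]//|le]; split=> //; apply: leq_trans le_qp.
Qed.

Lemma max_row_decr : weakly_decr (max_row (g p) (g q)).
Proof.
move=> k; rewrite /max_row geq_max !leq_max.
by rewrite !(spec_decr sp) orbT.
Qed.

Lemma min_row_decr : weakly_decr (min_row (g p) (g q)).
Proof.
move=> k; rewrite /min_row leq_min !geq_min.
by rewrite !(spec_decr sp) orbT.
Qed.

Lemma lt_min_max k : max_row (g p) (g q) k != 0 ->
  min_row (g p) (g q) k < max_row (g p) (g q) k.
Proof.
rewrite max_row_length => le; have := @spec_column _ _ _ _ sp p q k neq_pq.
rewrite (spec_length sp) le => /(_ isT); rewrite /max_row /min_row.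
by case: (ltngtP (g p k) (g q k)).
Qed.

End RowPairs.

Lemma skyline_spec_ext n sigma len (g g' : 'I_n -> nat -> nat) :
  (forall r k, g r k = g' r k) ->
  skyline_spec sigma len g -> skyline_spec sigma len g'.
Proof.
move=> E [A B C D F]; split; move=> *; first 1 last.
- by rewrite -E.
- by rewrite -!E; apply: C => //; rewrite E.
- by move=> k; rewrite -!E; apply: D.
- by rewrite -(pair_ok_ext _ _ _ (E _) (E _)); apply: F.
by move=> k; rewrite -E; apply: A.
Qed.

(** * Exchange of the basement entries of two adjacent rows *)

Section RowSwap.

Variables (n N : nat) (i j : 'I_n).
Hypothesis ij : i.+1 = j.

Implicit Types (f : plain n N) (sigma : 'I_n -> 'I_n) (len : 'I_n -> nat).

Lemma neq_ij : i != j.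
Proof. by apply/eqP => E; have := ltnn j; rewrite -{1}E -ij ltnSn. Qed.

Let H f := hrow i j f.
Let L f := lrow i j f.
Let pij p q := pair_ij i j p q.

Lemma lrow_out f k : N <= k -> L f k = 0.
Proof. by move=> le; rewrite /L /lrow /min_row !entry_out. Qed.

Lemma adjacent_pair p q : pij p q -> (p.+1 == q) || (q.+1 == p).
Proof. by case/orP=> /andP[/eqP-> /eqP->]; rewrite ij eqxx ?orbT. Qed.

Lemma free_pair p q f : pij p q ->
  free_at (max_row (entry f p) (entry f q)) (min_row (entry f p) (entry f q))
    =1 free_at (H f) (L f).
Proof.
by move=> pq; apply: free_at_ext => k; rewrite /H /L (hrow_pair _ pq,
  lrow_pair _ pq).
Qed.

Lemma pair_facts p q f sigma len : pij p q -> skyline_spec sigma len (entry f) ->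
  len q <= len p ->
  [/\ row_of_length (H f) (len p), row_of_length (L f) (len q),
      weakly_decr (H f), weakly_decr (L f)
    & forall k, H f k != 0 -> L f k < H f k].
Proof.
move=> pq sp le; have npq := neq_pair neq_ij pq.
split=> k; rewrite /H /L ?(hrow_pair _ pq) ?(lrow_pair _ pq).
- exact: (max_row_length sp).
- exact: (min_row_length sp).
- exact: (max_row_decr _ _ sp).
- exact: (min_row_decr _ _ sp).
exact: (lt_min_max sp).
Qed.

(** In column 0 the longer row has the larger entry exactly when the cut is 0. So the long and the
    short row exchange basement entries exactly when one of the two cuts is 0 and the other is not,
    which explains the tests on [0 < K1] and [0 < K2]. *)
Lemma recut_plain s1 s2 len1 len2 p1 q1 p2 q2 K1 kappa2 f
    (K2 := kappa2 (H f) (L f)) :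
  pij p1 q1 -> pij p2 q2 -> (forall r, len2 r < N) ->
  skyline_spec s1 len1 (entry f) -> len1 q1 <= len1 p1 ->
  len2 p2 = len1 p1 -> len2 q2 = len1 q1 ->
  (forall r, r != i -> r != j -> len2 r = len1 r /\ s2 r = s1 r) ->
  arranged (entry f p1) (entry f q1) K1 -> cut (H f) (L f) K1 -> cut (H f) (L
    f) K2 ->
  s2 p2 = (if (0 < K1) == (0 < K2) then s1 p1 else s1 q1) ->
  s2 q2 = (if (0 < K1) == (0 < K2) then s1 q1 else s1 p1) ->
  (p2 < q2 -> forall k, pair_ok (len1 p1) (len1 q1)
     (long_row (H f) (L f) K2) (short_row (H f) (L f) K2) k) ->
  (q2 < p2 -> forall k, pair_ok (len1 q1) (len1 p1)
     (short_row (H f) (L f) K2) (long_row (H f) (L f) K2) k) ->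
  (forall r : 'I_n, r < i -> len1 q1 <= len1 r < len1 p1 ->
    K1 != K2 ->
    (0 < minn K1 K2) || ~~ between (L f) (entry f r) (H f) 0) ->
  (forall r : 'I_n, j < r -> len1 q1 < len1 r <= len1 p1 ->
    K1 != K2 ->
    (0 < minn K1 K2) || ~~ between (L f) (entry f r) (H f) 0) ->
  skyline_plain s2 len2 (recut i j p2 q2 kappa2 f).
Proof.
move=> pq1 pq2 lenN sp le lp lq other ar cut1 cut2 bp bq okpq okqp nbb nba.
have [hL lM hd ld lt_lh] := pair_facts pq1 sp le.
have [P Q] := arranged_rows pq1 ar.
apply/skyline_plainP => //.
have mem r : r != p2 -> r != q2 -> r != i /\ r != j.
  by move=> /negbTE rp /negbTE rq; apply/andP;
    rewrite -negb_or -(mem_pair r pq2) rp rq.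
suff : skyline_spec s2 len2 (rearrange (H f) (L f) p2 q2 K2 (entry f)).
  by apply: skyline_spec_ext => r k; rewrite entry_recut.
apply: (rearrange_spec (adjacent_pair pq1) _ hL lM le hd ld lt_lh cut1 cut2 P
  Q sp) => //.
- move: pq1 pq2; rewrite /pij /pair_ij.
  by move=> /orP[]/andP[/eqP-> /eqP->] /orP[]/andP[/eqP-> /eqP->];
    rewrite !eqxx ?orbT.
- move=> r rp rq; apply: (proj1 (other r _ _)).
    by move: (mem_pair r pq1); rewrite (negbTE rp) (negbTE rq) => /esym/norP[].
  by move: (mem_pair r pq1); rewrite (negbTE rp) (negbTE rq) => /esym/norP[].
- move=> r; rewrite /rearrange.
  have := spec_basement sp p1; have := spec_basement sp q1.
  rewrite P Q /long_row /short_row; case: eqP => [->|/eqP rp].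
    by rewrite bp; case: (0 < K1); case: (0 < K2) => /=.
  case: eqP => [->|/eqP rq]; first by rewrite bq; case: (0 < K1);
    case: (0 < K2) => /=.
  by move=> _ _; rewrite (spec_basement sp); have [ri rj] := mem r rp rq;
    have [_ ->] := other r ri rj.
- move=> r rp rq; apply: nbb.
  by case/orP: pq1 rp rq => /andP[/eqP-> /eqP->].
- move=> r rp rq; apply: nba.
  by case/orP: pq1 rp rq => /andP[/eqP-> /eqP->].
Qed.

Variables (R : nmodType) (W : {ffun 'I_N -> {set 'I_n}} -> R).

Definition plain_sum sigma len : R :=
  (\sum_(f : plain n N | skyline_plain sigma len f) W (columns f))%R.

Variables (sigma : 'I_n -> 'I_n) (len : 'I_n -> nat).
Hypotheses (descent : sigma j < sigma i) (lenN : forall r, len r < N).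

Let sigma' r := sigma (tperm i j r).
Let len' r := len (tperm i j r).
Let free f := has_free N (H f) (L f).

Lemma ltij : i < j. Proof. by rewrite -ij. Qed.

Lemma nltji : (j < i) = false. Proof. by apply/negbTE;
  rewrite -leqNgt ltnW // ltij. Qed.

Lemma pij1 : pij i j. Proof. by rewrite /pij /pair_ij !eqxx. Qed.

Lemma pij2 : pij j i. Proof. by rewrite /pij /pair_ij !eqxx orbT. Qed.

Lemma tperm_other r : r != i -> r != j -> tperm i j r = r.
Proof. by move=> ri rj; rewrite tpermD // eq_sym. Qed.

Lemma has_free_recut p q kappa f : pij p q ->
  has_free N (H (recut i j p q kappa f)) (L (recut i j p q kappa f)) = free f.
Proof.
move=> pq; apply: has_free_ext => k; first exact: (hrow_recut neq_ij).
exact: (lrow_recut neq_ij).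
Qed.

Lemma between_base s f r l0 : skyline_spec s l0 (entry f) ->
  (forall r, r != i -> r != j -> s r = sigma r) ->
  (s i = sigma i) /\ (s j = sigma j) \/ (s i = sigma j) /\ (s j = sigma i) ->
  r != i -> r != j ->
  between (L f) (entry f r) (H f) 0 = (sigma j < sigma r < sigma i).
Proof.
move=> sp other eqs ri rj; rewrite /between /L /H /lrow /hrow /max_row /min_row.
rewrite !(spec_basement sp) (other r ri rj) minnSS maxnSS ltnS.
have le := ltnW descent.
by case: eqs => [[-> ->]|[-> ->]]; rewrite ?(minn_idPl le) ?(minn_idPr le)
  ?(maxn_idPl le) ?(maxn_idPr le).
Qed.

(** The longer row keeps the smaller basement entry and moves from the upper to the lower position:
    type B becomes type A, the last cut becomes the first one. Both cuts are positive, so no third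
    row obstructs. *)
Lemma plain_sum_shorter : len i < len j ->
  plain_sum sigma len = plain_sum sigma' len'.
Proof.
move=> lt; have le := ltnW lt.
have len'i : len' i = len j by rewrite /len' tpermL.
have len'j : len' j = len i by rewrite /len' tpermR.
have len'N r : len' r < N by apply: lenN.
apply: (sum_recut neq_ij W pij2 pij1 (@last_cut_ext N) (@first_cut_ext N)).
- move=> f /(skyline_plainP _ _ lenN) sp.
  have [hL lM hd ld lt_lh] := pair_facts pij2 sp le.
  have lt0 : entry f j 0 < entry f i 0 by rewrite !(spec_basement sp).
  have hf : free f.
    apply/(has_freeP _ (@lrow_out f)).
    have [k _ fk] := crossed_has_free (spec_length sp j) (spec_length sp i) le
      (spec_decr sp j) (spec_decr sp i) (leq0n _) lt0.
    by exists k; rewrite -(free_pair f pij2).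
  have [K [EK fK nK]] := last_cutP (@lrow_out f) hf.
  have [K' [EK' fK' nK']] := first_cutP hf.
  have ar : arranged (entry f j) (entry f i) K.+1.
    apply: (typeB_crossed (spec_length sp j) (spec_length sp i) le
      (spec_decr sp j) (spec_decr sp i) lt) => //.
    + by move=> k; have := spec_pair sp k ltij; rewrite /pair_ok leqNgt lt.
    + by rewrite (free_pair f pij2).
    by move=> m ltm; rewrite (free_pair f pij2) nK.
  rewrite -/(H f) -/(L f) EK; split=> //.
  apply: (recut_plain (K1 := K.+1) pij2 pij1 len'N sp le) => //;
    rewrite -/(H f) -/(L f) ?EK ?EK' //=.
  + move=> r ri rj; rewrite /len' /sigma' tperm_other //.
  + by rewrite /sigma' tpermL.
  + by rewrite /sigma' tpermR.
  + move=> _ k; rewrite /pair_ok le.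
    exact: (typeA_arranged hL lM le lt_lh).
  + by rewrite nltji.
  + by rewrite minnSS.
  by rewrite minnSS.
move=> f /(skyline_plainP _ _ len'N) sp.
have le' : len' j <= len' i by rewrite len'i len'j.
have [hL lM hd ld lt_lh] := pair_facts pij1 sp le'.
have lt0 : entry f i 0 < entry f j 0.
  by rewrite !(spec_basement sp) /sigma' tpermL tpermR.
have hf : free f.
  apply/(has_freeP _ (@lrow_out f)).
  have [k _ fk] := crossed_has_free (spec_length sp i) (spec_length sp j) le'
    (spec_decr sp i) (spec_decr sp j) (leq0n _) lt0.
  by exists k; rewrite -(free_pair f pij1).
have [K [EK fK nK]] := first_cutP hf.
have [K' [EK' fK' nK']] := last_cutP (@lrow_out f) hf.
have ar : arranged (entry f i) (entry f j) K.+1.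
  apply: (typeA_crossed (spec_length sp i) (spec_length sp j) le'
    (spec_decr sp i) (spec_decr sp j)) => //.
  by move=> k; have := spec_pair sp k ltij; rewrite /pair_ok le'.
rewrite -/(H f) -/(L f) EK; split=> //.
apply: (recut_plain (K1 := K.+1) pij1 pij2 lenN sp le') => //;
  rewrite -/(H f) -/(L f) ?EK ?EK' //=.
- by move=> r ri rj; rewrite /len' /sigma' tperm_other.
- by rewrite /sigma' tpermL.
- by rewrite /sigma' tpermR.
- by rewrite nltji.
- move=> _ k; rewrite /pair_ok len'i len'j leqNgt lt /=.
  by apply: (typeB_arranged hL lM le' lt_lh).
- by rewrite minnSS.
by rewrite minnSS.
Qed.

(** The lower row stays the longer one but receives the smaller basement entry, so the cut moves
    from 0 to the first free column. Column 0 is exchanged, whence the assumptions on the basement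
    entries of third rows. *)
Lemma plain_sum_free : len j <= len i ->
  (forall r : 'I_n, r < i -> len j <= len r < len i ->
    ~~ (sigma j < sigma r < sigma i)) ->
  (forall r : 'I_n, j < r -> len j < len r <= len i ->
    ~~ (sigma j < sigma r < sigma i)) ->
  (\sum_(f | skyline_plain sigma len f && free f) W (columns f))%R
    = plain_sum sigma' len.
Proof.
move=> le nbb nba.
have ltr (r : 'I_n) : r < i -> (r != i) && (r != j).
  move=> lt; have lt' := ltn_trans lt ltij.
  by apply/andP; split; apply/eqP => E; move: lt lt'; rewrite E ltnn.
have gtr (r : 'I_n) : j < r -> (r != i) && (r != j).
  move=> lt; have lt' := ltn_trans ltij lt.
  by apply/andP; split; apply/eqP => E; move: lt lt'; rewrite E ltnn.
apply: (sum_recut neq_ij W pij1 pij1 no_cut_ext (@first_cut_ext N)).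
- move=> f /andP[/(skyline_plainP _ _ lenN) sp hf].
  have [hL lM hd ld lt_lh] := pair_facts pij1 sp le.
  have [K' [EK' fK' nK']] := first_cutP hf.
  have ar : arranged (entry f i) (entry f j) 0.
    apply: (typeA_sorted (spec_length sp i) (spec_length sp j) le (spec_decr
      sp j)).
    + by move=> k; have := spec_pair sp k ltij; rewrite /pair_ok le.
    by rewrite !(spec_basement sp) ltnW.
  split=> //.
  apply: (recut_plain (K1 := 0) pij1 pij1 lenN sp le) => //;
    rewrite -/(H f) -/(L f) ?EK' //=.
  + by move=> r ri rj; rewrite /sigma' tperm_other.
  + by rewrite /sigma' tpermL.
  + by rewrite /sigma' tpermR.
  + move=> _ k; rewrite /pair_ok le.
    exact: (typeA_arranged hL lM le lt_lh).
  + by rewrite nltji.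
  + move=> r lt lens; have /andP[ri rj] := ltr r lt.
    by rewrite (between_base sp) ?nbb //; left.
  move=> r lt lens; have /andP[ri rj] := gtr r lt.
  by rewrite (between_base sp) ?nba //; left.
move=> f /(skyline_plainP _ _ lenN) sp.
have [hL lM hd ld lt_lh] := pair_facts pij1 sp le.
have lt0 : entry f i 0 < entry f j 0.
  by rewrite !(spec_basement sp) /sigma' tpermL tpermR.
have hf : free f.
  apply/(has_freeP _ (@lrow_out f)).
  have [k _ fk] := crossed_has_free (spec_length sp i) (spec_length sp j) le
    (spec_decr sp i) (spec_decr sp j) (leq0n _) lt0.
  by exists k; rewrite -(free_pair f pij1).
have [K [EK fK nK]] := first_cutP hf.
have ar : arranged (entry f i) (entry f j) K.+1.
  apply: (typeA_crossed (spec_length sp i) (spec_length sp j) le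
    (spec_decr sp i) (spec_decr sp j)) => //.
  by move=> k; have := spec_pair sp k ltij; rewrite /pair_ok le.
have oth r : r != i -> r != j -> sigma' r = sigma r.
  by move=> ri rj; rewrite /sigma' tperm_other.
rewrite -/(H f) -/(L f) EK; split=> //.
rewrite /= /free (has_free_recut _ _ pij1) hf andbT.
apply: (recut_plain (K1 := K.+1) pij1 pij1 lenN sp le) => //;
  rewrite -/(H f) -/(L f) ?EK //=.
- by move=> r ri rj; rewrite oth.
- by rewrite /sigma' tpermR.
- by rewrite /sigma' tpermL.
- move=> _ k; rewrite /pair_ok le.
  exact: (typeA_arranged0 hL lM le lt_lh).
- by rewrite nltji.
- move=> r lt lens; have /andP[ri rj] := ltr r lt.
  by rewrite (between_base sp) ?nbb //; right; rewrite /sigma' tpermL tpermR.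
move=> r lt lens; have /andP[ri rj] := gtr r lt.
by rewrite (between_base sp) ?nba //; right; rewrite /sigma' tpermL tpermR.
Qed.

(** Whole rows change places and the cut stays 0. The longer row becomes the upper one, and type B
    then demands that no column be free. *)
Lemma plain_sum_unfree : len j < len i ->
  (\sum_(f | skyline_plain sigma len f && ~~ free f) W (columns f))%R
    = plain_sum sigma' len'.
Proof.
move=> lt; have le := ltnW lt.
have len'i : len' i = len j by rewrite /len' tpermL.
have len'j : len' j = len i by rewrite /len' tpermR.
have len'N r : len' r < N by apply: lenN.
apply: (sum_recut neq_ij W pij1 pij2 no_cut_ext no_cut_ext).
- move=> f /andP[/(skyline_plainP _ _ lenN) sp hf].
  have [hL lM hd ld lt_lh] := pair_facts pij1 sp le.
  have ar : arranged (entry f i) (entry f j) 0.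
    apply: (typeA_sorted (spec_length sp i) (spec_length sp j) le (spec_decr
      sp j)).
    + by move=> k; have := spec_pair sp k ltij; rewrite /pair_ok le.
    by rewrite !(spec_basement sp) ltnW.
  split=> //.
  apply: (recut_plain (K1 := 0) pij1 pij2 len'N sp le) => //;
    rewrite -/(H f) -/(L f) //=.
  + by move=> r ri rj; rewrite /len' /sigma' tperm_other.
  + by rewrite /sigma' tpermR.
  + by rewrite /sigma' tpermL.
  + by rewrite nltji.
  + move=> _ k; rewrite /pair_ok leqNgt lt /=.
    apply: typeB_arranged0 => m; apply: contra hf => fm.
    by apply/(has_freeP _ (@lrow_out f)); exists m.
move=> f /(skyline_plainP _ _ len'N) sp.
have le' : len' i <= len' j by rewrite len'i len'j.
have lt' : len' i < len' j by rewrite len'i len'j.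
have [hL lM hd ld lt_lh] := pair_facts pij2 sp le'.
have lt0 : entry f i 0 < entry f j 0.
  by rewrite !(spec_basement sp) /sigma' tpermL tpermR.
have okB k : invB (entry f i) (entry f j) k.
  by have := spec_pair sp k ltij; rewrite /pair_ok leqNgt lt'.
have [ar nf] := typeB_sorted (spec_length sp j) (spec_length sp i) le'
    (spec_decr sp i) lt' okB lt0.
split=> //.
rewrite /= /free (has_free_recut _ _ pij1); apply/andP; split; last first.
  by apply/(has_freeP _ (@lrow_out f)) => -[k];
    rewrite -(free_pair f pij2) (negbTE (nf k)).
apply: (recut_plain (K1 := 0) pij2 pij1 lenN sp le') => //;
  rewrite -/(H f) -/(L f) //=.
- by move=> r ri rj; rewrite /len' /sigma' tperm_other.
- by rewrite /sigma' tpermR.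
- by rewrite /sigma' tpermL.
- move=> _ k; rewrite /pair_ok le'.
  exact: (typeA_arranged0 hL lM le' lt_lh).
by rewrite nltji.
Qed.

(** A row above that separates the pair in the basement goes on doing so to the right, by
    [between_forced_above] from column 0. *)
Lemma between_unfree f (r : 'I_n) : skyline_plain sigma len f ->
  j < r -> len j < len r <= len i -> sigma j < sigma r < sigma i -> ~~ free f.
Proof.
move=> /(skyline_plainP _ _ lenN) sp ltr lens bt.
have /andP[ri rj] : (r != i) && (r != j).
  have lt' := ltn_trans ltij ltr.
  by apply/andP; split; apply/eqP => E; move: ltr lt'; rewrite E ltnn.
have le : len j <= len i by case/andP: lens => /ltnW; apply: leq_trans.
have [hL lM hd ld lt_lh] := pair_facts pij1 sp le.
have ar : arranged (entry f i) (entry f j) 0.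
  apply: (typeA_sorted (spec_length sp i) (spec_length sp j) le (spec_decr sp j)).
    by move=> k; have := spec_pair sp k ltij; rewrite /pair_ok le.
  by rewrite !(spec_basement sp) ltnW.
have [P Q] := arranged_rows pij1 ar.
apply/(has_freeP _ (@lrow_out f)) => -[k fk].
suff : ~~ free_at (H f) (L f) k by rewrite fk.
apply: (between_forced_above lM le ld (spec_length sp r) (spec_decr sp r) (K := 0)
  (k := 0) lens) => // [m|].
  have := spec_pair sp m ltr; have := spec_pair sp m (ltn_trans ltij ltr).
  by rewrite /pair_ok /above_ok /invA /invB !P !Q => -> ->.
rewrite (between_base sp) //; by left.
Qed.

(** For equal lengths the final column [len j] is free, as the next entries are 0; so every filling
    falls under [plain_sum_free], whose ranges of obstructing lengths are empty. *)
Lemma plain_sum_ge : len i <= len j ->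
  plain_sum sigma len = plain_sum sigma' len'.
Proof.
rewrite leq_eqVlt => /orP[/eqP eqij|]; last exact: plain_sum_shorter.
have E : plain_sum sigma' len' = plain_sum sigma' len.
  apply: eq_bigl => f; rewrite /len'.
  have {}E r : len (tperm i j r) = len r by case: tpermP => // ->.
  congr [&& _, _, _, _ & _]; apply: eq_forallb => r.
    by apply: eq_forallb => k; rewrite E.
  by apply: eq_forallb => q; apply: eq_forallb => k; rewrite !E.
rewrite E -plain_sum_free ?eqij //; first last.
- by move=> r _ /andP[a b]; move: (leq_trans a b); rewrite ltnn.
- by move=> r _ /andP[a b]; move: (leq_ltn_trans a b); rewrite ltnn.
apply: eq_bigl => f; case P: (skyline_plain sigma len f) => //=; apply/esym.
move: P => /(skyline_plainP _ _ lenN) sp.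
have [hL lM hd ld lt_lh] := pair_facts pij1 sp (eq_leq (esym eqij)).
apply/(has_freeP _ (@lrow_out f)); exists (len j); rewrite /free_at lM leqnn /=.
have := hL (len j).+1; rewrite eqij ltnn => /negbFE/eqP->.
exact: leq0n.
Qed.

(** The sum is split according to the existence of a free column. A separating row above makes the
    part with a free column empty; without one this part is given by [plain_sum_free]. *)
Lemma plain_sum_lt : len j < len i ->
  (forall r : 'I_n, r < i -> ~~ (sigma j < sigma r < sigma i)) ->
  plain_sum sigma len = (plain_sum sigma' len' +
    (if [exists r : 'I_n, [&& (j < r)%N, (len j < len r <= len i)%N
           & (sigma j < sigma r < sigma i)%N]]
     then 0 else plain_sum sigma' len))%R.
Proof.
move=> lt nbb; rewrite /plain_sum (bigID free) /= plain_sum_unfree // GRing.addrC.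
congr (_ + _)%R; case: existsP => [[r /and3P[ltr lens bt]]|nba].
  apply: big_pred0 => f; case P: (skyline_plain sigma len f) => //=.
  by apply/negbTE; apply: between_unfree bt.
apply: plain_sum_free (ltnW lt) _ _ => [r ltr _|r ltr lens]; first exact: nbb.
by apply/negP => bt; apply: nba; exists r; rewrite ltr lens.
Qed.

End RowSwap.

Lemma plain_sum_ext n N (R : nmodType) (W : {ffun 'I_N -> {set 'I_n}} -> R)
    (s s' : 'I_n -> 'I_n) (len len' : 'I_n -> nat) :
  s =1 s' -> len =1 len' -> plain_sum W s len = plain_sum W s' len'.
Proof.
move=> es el; apply: eq_bigl => f.
congr [&& _, _, _, _ & _]; apply: eq_forallb => r.
- by apply: eq_forallb => k; rewrite el.
- by rewrite es.
by apply: eq_forallb => q; apply: eq_forallb => k; rewrite !el.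
Qed.

(** * The chain of basements from the reversal to the identity *)

Section Basements.

Variable n : nat.

(* The basement read from row 0 upwards is n-1, ..., y+1, 0, ..., x-1, y,
   x, ..., y-1: it moves from the reversal (y = x = 0) to the identity
   (y = x = n-1), exchanging adjacent rows y, x into x, y. *)
Definition basement_val y x p : nat :=
  if p < n.-1 - y then n.-1 - p
  else let q := p - (n.-1 - y) in
    if q < x then q else if q == x then y else q.-1.

Definition basement y x (p : 'I_n) : 'I_n := insubd p (basement_val y x p).

Lemma basementE y x p : y < n -> x <= y ->
  basement y x p = basement_val y x p :> nat.
Proof.
move=> yn xy; rewrite val_insubd ifT // /basement_val; have := ltn_ord p.
case: ifP => ?; first by lia.
by case: ifP => ?; [lia | case: ifP => ?; lia].
Qed.

Lemma basement_start p : basement 0 0 p = rev_ord p.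
Proof.
have n0 : 0 < n by apply: leq_ltn_trans (ltn_ord p).
apply: ord_inj; rewrite basementE //= /basement_val subn0 ltn0.
have := ltn_ord p; case: ifP => ?; first by lia.
case: ifP => ?; lia.
Qed.

Lemma basement_end p : basement n.-1 n.-1 p = p.
Proof.
have n0 : 0 < n by apply: leq_ltn_trans (ltn_ord p).
apply: ord_inj; rewrite basementE ?prednK // /basement_val subnn ltn0 subn0.
have := ltn_ord p; case: ifP => // ?; case: ifP => ?; lia.
Qed.

Lemma basement_next y p : y.+1 < n -> basement y y p = basement y.+1 0 p.
Proof.
move=> yn; apply: ord_inj; rewrite !basementE // ?(ltnW yn) // /basement_val ltn0.
by have := ltn_ord p; repeat case: ifP => ?; lia.
Qed.

Variables (N : nat) (R : nmodType) (W : {ffun 'I_N -> {set 'I_n}} -> R).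

(** Lengths are indexed by basement entries and not by rows, so [a] is unchanged when a row moves
    together with its basement entry. *)
Definition value_sum y x (a : 'I_n -> nat) : R :=
  plain_sum W (basement y x) (fun p => a (basement y x p)).

Lemma value_sum_ext y x a a' : a =1 a' -> value_sum y x a = value_sum y x a'.
Proof. by move=> e; apply: plain_sum_ext. Qed.

Variables (x y : 'I_n) (a : 'I_n -> nat).
Hypotheses (xy : x < y) (aN : forall c, a c < N).

Lemma swap_row_lt : n.-1 - y + x < n.
Proof. have := ltn_ord y; lia. Qed.

Lemma swap_row_lt' : (n.-1 - y + x).+1 < n.
Proof. have := ltn_ord y; lia. Qed.

Let i := Ordinal swap_row_lt.
Let j := Ordinal swap_row_lt'.

Lemma basement_i : basement y x i = y.
Proof.
apply: ord_inj; rewrite basementE ?(ltnW xy) // /basement_val /=.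
by rewrite ltnNge leq_addr /= addKn ltnn eqxx.
Qed.

Lemma basement_j : basement y x j = x.
Proof.
apply: ord_inj; rewrite basementE ?(ltnW xy) // /basement_val /=.
rewrite ltnNge leqW ?leq_addr //= -addnS addKn ltnNge leqnSn /=.
by rewrite eqn_leq ltnn.
Qed.

Lemma basement_step p : basement y x (tperm i j p) = basement y x.+1 p.
Proof.
have xi : basement y x.+1 i = x.
  apply: ord_inj; rewrite basementE // /basement_val /=.
  by rewrite ltnNge leq_addr /= addKn ltnSn.
have xj : basement y x.+1 j = y.
  apply: ord_inj; rewrite basementE // /basement_val /=.
  by rewrite ltnNge leqW ?leq_addr //= -addnS addKn ltnn eqxx.
case: tpermP => [->|->|/eqP ni /eqP nj]; rewrite ?basement_i ?basement_j ?xi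
  ?xj //.
have {}ni : p != i :> nat by []. have {}nj : p != j :> nat by [].
apply: ord_inj; rewrite !basementE ?(ltnW xy) // /basement_val.
move: ni nj => /=; case: ifP => ? // ni nj.
by repeat case: ifP => ?; lia.
Qed.

Lemma value_sum_ge : a y <= a x -> value_sum y x a = value_sum y x.+1 a.
Proof.
move=> le; rewrite /value_sum (@plain_sum_ge _ _ i j) //.
- by apply: plain_sum_ext => p; rewrite basement_step.
- by rewrite basement_i basement_j.
by rewrite basement_i basement_j.
Qed.

Definition blocked (a : 'I_n -> nat) (x y : 'I_n) :=
  [exists c : 'I_n, (x < c < y) && (a x < a c <= a y)].

Lemma value_sum_lt : a x < a y ->
  value_sum y x a = (value_sum y x.+1 a +
    if blocked a x y then 0 else value_sum y x.+1 (a \o tperm x y))%R.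
Proof.
move=> lt; have yn := ltn_ord y; have xyn : x <= y by apply: ltnW.
rewrite {1}/value_sum (@plain_sum_lt _ _ i j) //; first last.
(* The rows below the pair have basement entries greater than [y] or smaller than [x]. *)
- move=> r ltr; rewrite basement_i basement_j basementE // /basement_val.
  move: ltr => /=; case: ifP => ? ?; first by lia.
  by rewrite ifT; lia.
- by rewrite basement_i basement_j.
- by rewrite basement_i basement_j.
congr (_ + _)%R.
  by apply: plain_sum_ext => p; rewrite basement_step.
have -> : [exists r : 'I_n, [&& j < r,
      a (basement y x j) < a (basement y x r) <= a (basement y x i)
    & basement y x j < basement y x r < basement y x i]] = blocked a x y.
  rewrite basement_i basement_j; apply/existsP/existsP => -[r].
    by case/and3P=> _ A B; exists (basement y x r); rewrite B A.
  (* An entry strictly between [x] and [y] is shifted up by one row, because [y] has been inserted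
     below it. *)
  case/andP=> B A; have rn : n.-1 - y + r.+1 < n by lia.
  have Er : basement y x (Ordinal rn) = r.
    apply: ord_inj; rewrite basementE // /basement_val /=.
    by rewrite ltnNge leq_addr /= addKn; repeat case: ifP => ?; lia.
  by exists (Ordinal rn); rewrite Er A B /= !andbT; lia.
case: ifP => // _; apply: plain_sum_ext => p; first by rewrite basement_step.
rewrite /= -basement_step; congr a.
case: (tpermP i j p) => [->|->|/eqP ni /eqP nj];
  rewrite ?basement_i ?basement_j ?tpermL ?tpermR //.
have inj q : basement y x p = basement y x q -> p = q.
  move=> /(congr1 val) /=; rewrite !basementE // /basement_val => E.
  apply: ord_inj; have := ltn_ord p; have := ltn_ord q; move: E.
  by repeat case: ifP => ?; lia.
rewrite tpermD //; apply/eqP => E; [move: nj|move: ni].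
  by rewrite (inj j) ?eqxx // basement_j.
by rewrite (inj i) ?eqxx // basement_i.
Qed.

End Basements.

(** * Left swaps *)

Section Rearrangements.

Variable n : nat.
Implicit Types (a b c : 'X_{1..n}) (x y k : 'I_n) (s : {perm 'I_n}).

Definition perm_of a b := [exists s : {perm 'I_n}, [forall k, b k == a (s k)]].

Definition prefix_count b i t := \sum_(k < n | k < i) (t <= b k).

(** For rearrangements of [a] this is a tableau criterion for the Bruhat order: each sorted prefix
    of [b] dominates that of [a] entry by entry. Larger thresholds need no test, since all counts
    vanish there. *)
Definition prefix_ge a b :=
  [forall i : 'I_n.+1, forall t : 'I_(mdeg a).+1,
    prefix_count a i t <= prefix_count b i t].

Lemma perm_ofP a b :
  reflect (exists s : {perm 'I_n}, forall k, b k = a (s k)) (perm_of a b).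
Proof.
apply: (iffP existsP) => -[s H]; exists s; last by apply/forallP => k; rewrite H.
by move=> k; apply/eqP/(forallP H).
Qed.

Lemma perm_of_refl a : perm_of a a.
Proof. by apply/perm_ofP; exists 1%g => k; rewrite perm1. Qed.

Lemma perm_of_swap a b x y : perm_of a b -> perm_of a (mnm_swap x y b).
Proof.
case/perm_ofP=> s H; apply/perm_ofP; exists (tperm x y * s)%g => k.
by rewrite mnmE H permM.
Qed.

Lemma mnm_swapK x y : involutive (@mnm_swap n x y).
Proof. by move=> b; apply/mnmP => k; rewrite !mnmE tpermK. Qed.

Lemma perm_of_sum (F : nat -> nat) a b : perm_of a b ->
  \sum_(k < n) F (b k) = \sum_(k < n) F (a k).
Proof.
case/perm_ofP=> s H; rewrite [RHS](reindex_inj (@perm_inj _ s)).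
by apply: eq_bigr => k _; rewrite H.
Qed.

Lemma perm_of_mdeg a b : perm_of a b -> mdeg b = mdeg a.
Proof. by move=> H; rewrite !mdegE (perm_of_sum id H). Qed.

Lemma le_mdeg b k : b k <= mdeg b.
Proof. by rewrite mdegE (bigD1 k) //= leq_addr. Qed.

Lemma prefix_count_big b i t : mdeg b < t -> prefix_count b i t = 0.
Proof.
move=> lt; apply: big1 => k _; apply/eqP; rewrite eqb0 -ltnNge.
exact: leq_ltn_trans (le_mdeg b k) lt.
Qed.

Lemma prefix_geP a b : perm_of a b ->
  reflect (forall i t, i <= n -> prefix_count a i t <= prefix_count b i t)
    (prefix_ge a b).
Proof.
move=> ab; apply: (iffP idP) => [H i t le|H].
  have [lt|lt] := ltnP t (mdeg a).+1; last by rewrite prefix_count_big.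
  by have /forallP/(_ (Ordinal lt)) := forallP H (Ordinal (le : i < n.+1)).
by apply/forallP => i; apply/forallP => t; apply: H; rewrite -ltnS.
Qed.

Lemma prefix_count_swap_out b x y i t : ~~ (x < i <= y) -> x < y ->
  prefix_count (mnm_swap x y b) i t = prefix_count b i t.
Proof.
move=> out xy; rewrite /prefix_count [RHS](reindex_inj (@perm_inj _ (tperm x y))).
apply: eq_big => [k|k _]; last by rewrite mnmE.
by case: tpermP => [->|->|//]; move: out; lia.
Qed.

(** The prefix loses [b x] and gains [b y]; the additive form avoids truncated subtraction. *)
Lemma prefix_count_swap_in b x y i t : x < i <= y ->
  prefix_count (mnm_swap x y b) i t + (t <= b x)
    = prefix_count b i t + (t <= b y).
Proof.
case/andP=> xi iy; rewrite /prefix_count (bigD1 x) //= [in RHS](bigD1 x) //=.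
rewrite mnmE tpermL addnAC [RHS]addnAC [in RHS](addnC (t <= b x)); congr (_ + _).
apply: eq_bigr => k /andP[ki kx]; rewrite mnmE tpermD // 1?eq_sym //.
by apply/eqP => E; move: ki; rewrite E ltnNge iy.
Qed.

(* Among the entries of indices i, ..., y, those [>= t] are for b exactly those
   [> a y], while a has at least one more, namely [a y]. *)
Lemma prefix_count_strict a b i y t : perm_of a b -> prefix_ge a b ->
  (forall k, y < k -> b k = a k) -> i <= y ->
  (forall c : 'I_n, i <= c < y -> ~~ (b y < b c <= a y)) -> b y < t <= a y ->
  prefix_count a i t < prefix_count b i t.
Proof.
move=> ab /(prefix_geP ab) ge eqab iy nob /andP[byt tay].
pose mid d u := \sum_(k < n | i <= k <= y) (u <= d k).
have splitE d u : prefix_count d y.+1 u = prefix_count d i u + mid d u.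
  rewrite /prefix_count /mid (bigID (fun k : 'I_n => k < i)) /=; congr (_ + _).
    by apply: eq_bigl => k; lia.
  by apply: eq_bigl => k; lia.
have tot u : prefix_count b y.+1 u = prefix_count a y.+1 u.
  have := perm_of_sum (fun m => u <= m : nat) ab.
  rewrite (bigID (fun k : 'I_n => k < y.+1)) /= [in RHS](bigID (fun k : 'I_n
    => k < y.+1)) /=.
  rewrite [X in _ + X = _](_ : _ = \sum_(k < n | ~~ (k < y.+1)) (u <= a k)).
    by move/addIn.
  by apply: eq_bigr => k; rewrite ltnS -ltnNge => /eqab->.
have midb : mid b t = mid b (a y).+1.
  apply: eq_bigr => k /andP[ik ky]; congr nat_of_bool.
  move: ky; rewrite leq_eqVlt => /orP[/eqP/ord_inj->|ky]; first by lia.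
  by have := nob k; rewrite ik ky => /(_ isT); lia.
have mida : mid a (a y).+1 < mid a t.
  rewrite /mid (bigD1 y) /= ?iy ?leqnn // ltnn add0n.
  rewrite [X in _ < X](bigD1 y) /= ?iy ?leqnn // tay add1n ltnS.
  by apply: leq_sum => k _; case: ltnP => // lt; rewrite (leq_trans tay) // ltnW.
have := splitE b t; have := splitE a t; have := splitE b (a y).+1.
have := splitE a (a y).+1; rewrite !tot.
have := ge i (a y).+1; have := ltn_ord y; lia.
Qed.

(** Up to index [y] both have equally many entries at least [b y], and before [y] the composition
    [a] has no more of them than [b]; so [a y] is one of them. *)
Lemma last_entry_le a b y : perm_of a b -> prefix_ge a b ->
  (forall k, y < k -> b k = a k) -> b y <= a y.
Proof.
move=> ab /(prefix_geP ab) ge eqab.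
have splitE d u : prefix_count d y.+1 u = prefix_count d y u + (u <= d y).
  rewrite /prefix_count (bigD1 y) //= addnC; congr (_ + _).
  by apply: eq_bigl => k; rewrite ltnS ltn_neqAle andbC.
have := perm_of_sum (fun m => b y <= m : nat) ab.
rewrite (bigID (fun k : 'I_n => k < y.+1)) /= [in RHS](bigID (fun k : 'I_n =>
  k < y.+1)) /=.
rewrite [X in _ + X = _](_ : _ = \sum_(k < n | ~~ (k < y.+1)) (b y <= a k));
  last first.
  by apply: eq_bigr => k; rewrite ltnS -ltnNge => /eqab->.
move/addIn; rewrite -/(prefix_count b y.+1 (b y)) -/(prefix_count a y.+1 (b
  y)) !splitE.
by rewrite leqnn; have := ge y (b y) (ltnW (ltn_ord y));
  case: (leqP (b y) (a y)) => // _; lia.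
Qed.

End Rearrangements.

(** * The set of compositions produced at each basement *)

Section Stages.

Variables (n : nat) (a : 'X_{1..n}).
Implicit Types (b c : 'X_{1..n}) (x y k : 'I_n).

(* The weak compositions produced from [a] once the basement has reached
   [basement y x]. *)
Definition stage y (x : nat) b :=
  [&& perm_of a b, prefix_ge a b,
      [forall k : 'I_n, (y < k) ==> (b k == a k)]
    & [forall c : 'I_n, (x <= c < y) ==> ~~ (b y < b c <= a y)]].

Lemma stageP y (x : nat) b : reflect
  [/\ perm_of a b, prefix_ge a b, forall k, y < k -> b k = a k
    & forall c : 'I_n, x <= c < y -> ~~ (b y < b c <= a y)] (stage y x b).
Proof.
apply: (iffP and4P) => -[p g e c]; split=> //.
- by move=> k lt; apply/eqP; apply: (implyP (forallP e k)).
- by move=> k lt; apply: (implyP (forallP c k)).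
- by apply/forallP => k; apply/implyP => /e ->.
by apply/forallP => k; apply/implyP => /c.
Qed.

Definition exchangeable x y b := (b x < b y) && ~~ blocked b x y.

Lemma exchangeableP x y b : reflect
  (b x < b y /\ forall c : 'I_n, x < c < y -> ~~ (b x < b c <= b y))
  (exchangeable x y b).
Proof.
apply: (iffP andP) => -[lt nb]; split=> //.
  by move=> c cs; apply: contra nb => bc; apply/existsP; exists c; rewrite cs.
by apply/existsP => -[c /andP[cs bc]]; move: (nb c cs); rewrite bc.
Qed.

Lemma prefix_ge_swap b x y : perm_of a b -> x < y -> b x <= b y ->
  prefix_ge a b -> prefix_ge a (mnm_swap x y b).
Proof.
move=> ab xy le /(prefix_geP ab) ge; apply/(prefix_geP (perm_of_swap x y ab))
  => i t lei.
have := ge i t lei; have [ins|out] := boolP (x < i <= y); last first.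
  by rewrite prefix_count_swap_out.
have := prefix_count_swap_in b t ins.
have : (t <= b x) <= (t <= b y) by case: (leqP t (b x)) => // lt;
  rewrite (leq_trans lt).
lia.
Qed.

Variables x y : 'I_n.
Hypothesis xy : x < y.

Lemma stageS b : stage y x b -> stage y x.+1 b.
Proof.
case/stageP=> p g e nb; apply/stageP; split=> // c /andP[xc cy].
by apply: nb; rewrite cy ltnW.
Qed.

(** The new compositions are those where the last clause of [stage] fails at [c = x], that is
    [b y < b x <= a y]. This failure is the trace of the exchange just made, so each new composition
    comes from one old one. *)
Lemma stage_swap b : (stage y x.+1 b && ~~ stage y x b) =
  stage y x (mnm_swap x y b) && exchangeable x y (mnm_swap x y b).
Proof.
set d := mnm_swap x y b.
have dx : d x = b y by rewrite mnmE tpermL.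
have dy : d y = b x by rewrite mnmE tpermR.
have dk k : k != x -> k != y -> d k = b k by move=> kx ky;
  rewrite mnmE tpermD // eq_sym.
have bd : b = mnm_swap x y d by rewrite mnm_swapK.
have neq_gt k (l : 'I_n) : k < l -> k != l by move=> lt; apply/eqP => E;
  move: lt; rewrite E ltnn.
apply/andP/andP => -[].
  case/stageP=> p g e nb ns.
  have vx : b y < b x <= a y.
    apply: contraNT ns => nbx; apply/stageP; split=> // c /andP[].
    rewrite leq_eqVlt => /orP[/eqP/ord_inj<- //|xc cy].
    by apply: nb; rewrite xc.
  have bya := last_entry_le p g e.
  have pd : perm_of a d by apply: perm_of_swap.
  have md : mdeg d = mdeg b by rewrite !(perm_of_mdeg (a := a)).
  split; last first.
    apply/exchangeableP; split; first by rewrite dx dy; case/andP: vx.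
    move=> c /andP[xc cy]; rewrite dx dy dk ?(neq_gt _ _ cy) // 1?eq_sym
      ?(neq_gt _ _ xc) //.
    have := nb c; rewrite xc cy => /(_ isT); case/andP: vx => _ le.
    by apply: contra => /andP[-> /leq_trans->].
  apply/stageP; split=> //.
  (* Undoing the exchange lowers by one the counts with [x < i <= y] and [b y < t <= b x]; there
     [prefix_count_strict] provides the spare unit. *)
  - apply/(prefix_geP pd) => i t lei; have := prefix_geP p g i t lei.
    have [ins|out] := boolP (x < i <= y); last by rewrite prefix_count_swap_out.
    have := prefix_count_swap_in b t ins.
    case: (ltnP (b y) t) => [byt|tby]; last first.
      by rewrite (leq_trans tby (ltnW (proj1 (andP vx)))) => /addIn->.
    case: (leqP t (b x)) => [tbx|_]; last by rewrite !addn0 => ->.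
    have /andP[xi iy] := ins.
    have strict : prefix_count a i t < prefix_count b i t.
      apply: (prefix_count_strict p g e iy) => [c /andP[ic cy]|].
        by apply: nb; rewrite cy (leq_trans xi ic).
      by rewrite byt (leq_trans tbx) //; case/andP: vx.
    by rewrite addn0 addn1 => E _; rewrite -ltnS E.
  - move=> k yk; rewrite dk ?e // eq_sym neq_gt //; exact: ltn_trans xy yk.
  move=> c /andP[]; rewrite leq_eqVlt dy => /orP[/eqP/ord_inj<- _|xc cy].
    by rewrite dx ltnNge ltnW //; case/andP: vx.
  rewrite dk ?(neq_gt _ _ cy) // 1?eq_sym ?(neq_gt _ _ xc) //.
  have := nb c; rewrite xc cy => /(_ isT); apply: contra => /andP[A ->].
  by rewrite andbT; apply: ltn_trans A; case/andP: vx.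
case/stageP=> p g e nb /exchangeableP[]; rewrite dx dy => byx nex.
have pb : perm_of a b by rewrite bd; apply: perm_of_swap.
have dya := last_entry_le p g e; rewrite dy in dya.
(* The index [x] itself violates the clause, as [b y < b x] and [b x = d y <= a y]. *)
split; last first.
  apply/negP => /stageP[_ _ _ /(_ x)]; rewrite leqnn xy byx dya.
  by move=> /(_ isT).
apply/stageP; split=> //.
- rewrite bd; apply: prefix_ge_swap => //; rewrite dx dy; exact: ltnW.
- move=> k yk; rewrite -dk ?e // eq_sym neq_gt //; exact: ltn_trans xy yk.
move=> c /andP[xc cy].
have ck : d c = b c by rewrite dk ?(neq_gt _ _ cy) // eq_sym ?(neq_gt _ _ xc).
have := nb c; have := nex c; rewrite (ltnW xc) xc cy ck dy => /(_ isT) A /(_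
  isT) B.
apply/andP => -[lt le]; move: A B; rewrite lt le /= andbT.
by case: ltnP.
Qed.

(** The default of [insubd] never occurs, since a swap preserves the degree. *)
Definition bounded_swap (b : wcomp_upto a) : wcomp_upto a :=
  insubd b (mnm_swap x y b).

Lemma bounded_swapE (b : wcomp_upto a) : bounded_swap b = mnm_swap x y b :>
  'X_{1..n}.
Proof.
rewrite /bounded_swap val_insubd ifT //.
rewrite (perm_of_mdeg (a := bmnm b)) ?bmdeg //; exact/perm_of_swap/perm_of_refl.
Qed.

Lemma bounded_swapK : involutive bounded_swap.
Proof.
by move=> b; apply: val_inj; rewrite /= !bounded_swapE mnm_swapK.
Qed.

Variables (R : nmodType) (W : {ffun 'I_(mdeg a).+1 -> {set 'I_n}} -> R).

(** The recurrence keeps every old composition and adds the swap of each exchangeable one; by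
    [stage_swap] these are disjoint and fill the new stage. *)
Lemma stage_sumS :
  (\sum_(b : wcomp_upto a | stage y x b) value_sum W y x (b : 'X_{1..n}) =
   \sum_(b : wcomp_upto a | stage y x.+1 b) value_sum W y x.+1 (b : 'X_{1..n}))%R.
Proof.
have step (b : wcomp_upto a) : value_sum W y x b = (value_sum W y x.+1 b +
    if exchangeable x y b then value_sum W y x.+1 (bounded_swap b) else 0)%R.
  have bN k : b k < (mdeg a).+1 by apply: leq_ltn_trans (le_mdeg b k) (bmdeg b).
  rewrite /exchangeable; case: leqP => [le|lt] /=.
    by rewrite GRing.addr0 (value_sum_ge W xy bN).
  rewrite (value_sum_lt W xy bN) //; case: ifP => //= _; congr (_ + _)%R.
  by apply: value_sum_ext => c; rewrite bounded_swapE mnmE.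
under eq_bigr => b _ do rewrite step.
rewrite big_split /= -big_mkcondr /=.
rewrite [RHS](bigID (fun b : wcomp_upto a => stage y x b)) /=; congr (_ + _)%R.
  apply: eq_bigl => b; case S: (stage y x b); rewrite ?andbF ?andbT //.
  by rewrite stageS.
rewrite [RHS](reindex_inj (inv_inj bounded_swapK)) /=; apply: eq_bigl => b.
by rewrite stage_swap bounded_swapE mnm_swapK.
Qed.

End Stages.

(** * Identification of the final stage with the left swap closure *)

Section LeftSwaps.

Variables (n : nat) (n0 : 0 < n) (a : 'X_{1..n}).
Implicit Types (b c : 'X_{1..n}) (x y k : 'I_n).

(** All entries but the one of index 0 agree, and equality of degrees gives the last one. *)
Lemma stage_start y b : y = 0 :> nat -> stage a y 0 b = (b == a).
Proof.
move=> y0; apply/stageP/eqP => [[p _ e _]|->]; last first.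
  split=> //; first exact: perm_of_refl.
    by apply/(prefix_geP (perm_of_refl a)).
  by move=> c; rewrite y0 ltn0 andbF.
apply/mnmP => k; have [->|ky] := eqVneq k y; last first.
  by apply: e; rewrite y0 lt0n; apply: contra ky => /eqP k0;
    apply/eqP/ord_inj; rewrite k0.
have := perm_of_sum id p; rewrite (bigD1 y) //= [in RHS](bigD1 y) //=.
rewrite (eq_bigr (fun k => a k)); first by move/addIn.
move=> i iy; apply: e; rewrite y0 lt0n.
by apply: contra iy => /eqP k0; apply/eqP/ord_inj; rewrite k0.
Qed.

(** At [x = 0] the clause ranges over all indices before [y']. If [b y' < a y'],
    [prefix_count_strict] for the empty prefix would say that 0 is less than 0; hence
    [b y' = a y']. *)
Lemma stage_next y y' b : y' = y.+1 :> nat -> stage a y y b = stage a y' 0 b.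
Proof.
move=> yy'; apply/stageP/stageP => -[p g e nb]; split=> //.
- by move=> k lt; apply: e; apply: ltn_trans lt; rewrite yy'.
- move=> c _; rewrite (e y') ?yy' //; apply/negP => /andP[lt le].
  by move: (leq_trans lt le); rewrite ltnn.
- move=> k; rewrite leq_eqVlt -yy' => /orP[/eqP/ord_inj<-|]; last exact: e.
  have le := last_entry_le p g e.
  apply/eqP; rewrite eqn_leq le leqNgt; apply/negP => lt.
  have := prefix_count_strict (i := 0) (t := a y') p g e (leq0n _).
  by rewrite lt leqnn => /(_ nb isT); rewrite {2}/prefix_count big_pred0_eq.
by move=> c /andP[le lt]; move: (leq_ltn_trans le lt); rewrite ltnn.
Qed.

Lemma left_swap_stage b c : left_swap b c -> perm_of a b && prefix_ge a b ->
  perm_of a c && prefix_ge a c.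
Proof.
case/existsP=> i /existsP[j /and3P[ij le /eqP->]] /andP[p g].
by rewrite perm_of_swap //= prefix_ge_swap.
Qed.

Lemma lswap_stage (b : wcomp_upto a) : b \in lswap a -> perm_of a b &&
  prefix_ge a b.
Proof.
rewrite inE => /connectP[s]; have : perm_of a (self_upto a) && prefix_ge a
  (self_upto a).
  by rewrite /= perm_of_refl /=; apply/(prefix_geP (perm_of_refl a)).
elim: s (self_upto a) => [|c s IH] d Hd /=; first by move=> _ ->.
case/andP=> dc path E; apply: IH path E; exact: left_swap_stage dc Hd.
Qed.

(** A composition new at [m.+1] is, by [stage_swap], a left swap of one already present at [m]. *)
Lemma stage_lswap_row y (m : nat) : m <= y ->
  (forall b : wcomp_upto a, stage a y 0 b -> b \in lswap a) ->
  forall b : wcomp_upto a, stage a y m b -> b \in lswap a.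
Proof.
move=> + H0; elim: m => [//|m IH] my b sb.
have my' := ltnW my; pose x := Ordinal (ltn_trans my (ltn_ord y)).
have [sx|nsx] := boolP (stage a y m b); first exact: IH.
have := stage_swap a (x := x) my b; rewrite sb nsx => /esym/andP[sd].
case/exchangeableP => lt _.
have := IH my' (bounded_swap x y b); rewrite bounded_swapE => /(_ sd).
rewrite !inE => /connect_trans; apply; apply: connect1.
apply/existsP; exists x; apply/existsP; exists y.
by rewrite bounded_swapE my ltnW //= mnm_swapK.
Qed.

Lemma stage_lswap y b' : stage a y y b' -> forall b : wcomp_upto a,
  bmnm b = b' -> b \in lswap a.
Proof.
move=> sb b Eb; have {sb}: stage a y y b by rewrite Eb.
case: y => m; elim: m b {Eb b'} => [|m IH] b ltm sb.
  rewrite (stage_start b) // in sb.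
  rewrite inE (_ : b = self_upto a) ?connect0 //.
  by apply: val_inj; apply/eqP.
apply: stage_lswap_row sb => // c; pose y := Ordinal (ltnW ltm).
by rewrite -(@stage_next y) //; apply: IH.
Qed.

Definition last_row : 'I_n := Ordinal (eq_leq (prednK n0)).

(** Left swaps preserve the criterion; conversely the criterion is membership in the last stage,
    whose other two clauses are vacuous. *)
Lemma in_lswap (b : wcomp_upto a) : (b \in lswap a) = perm_of a b && prefix_ge
  a b.
Proof.
apply/idP/idP => [|/andP[p g]]; first exact: lswap_stage.
apply: (@stage_lswap last_row b) => //; apply/stageP; split=> //.
  by move=> k; rewrite /= ltnNge -ltnS prednK // ltn_ord.
by move=> c /andP[le lt]; move: (leq_ltn_trans le lt); rewrite ltnn.
Qed.

Lemma in_lswap_stage (b : wcomp_upto a) : (b \in lswap a) = stage a last_row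
  last_row b.
Proof.
rewrite in_lswap; apply/andP/stageP => [[p g]|[p g _ _]]; split=> //.
  by move=> k; rewrite /= ltnNge -ltnS prednK // ltn_ord.
by move=> c /andP[le lt]; move: (leq_ltn_trans le lt); rewrite ltnn.
Qed.

Variables (R : nmodType) (W : {ffun 'I_(mdeg a).+1 -> {set 'I_n}} -> R).

Lemma stage_sum_row y (m : nat) : m <= y ->
  (\sum_(b : wcomp_upto a | stage a y 0 b) value_sum W y 0 (b : 'X_{1..n}) =
   \sum_(b : wcomp_upto a | stage a y m b) value_sum W y m (b : 'X_{1..n}))%R.
Proof.
elim: m => [_|m IH my]; first by [].
rewrite (IH (ltnW my)).
exact: (@stage_sumS n a (Ordinal (ltn_trans my (ltn_ord y))) y).
Qed.

Lemma stage_sum y :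
  (value_sum W 0 0 a =
   \sum_(b : wcomp_upto a | stage a y y b) value_sum W y y (b : 'X_{1..n}))%R.
Proof.
case: y => m; elim: m => [|m IH] ltm.
  by rewrite (big_pred1 (self_upto a)) // => b; rewrite stage_start // -val_eqE.
rewrite (IH (ltnW ltm)) -(stage_sum_row (y := Ordinal ltm) (leqnn _)).
apply: eq_big => [b|b _]; first exact: stage_next.
by apply: plain_sum_ext => p; rewrite basement_next.
Qed.

Lemma value_sum_lswap :
  plain_sum W (@rev_ord n) (fun p => a (rev_ord p)) =
  (\sum_(b in lswap a) plain_sum W id (b : 'X_{1..n}))%R.
Proof.
have := stage_sum last_row.
rewrite (eq_bigl _ _ (fun b : wcomp_upto a => esym (in_lswap_stage b))).
rewrite (eq_bigr (fun b : wcomp_upto a => plain_sum W id (b : 'X_{1..n}))).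
  by move=> <-; apply: plain_sum_ext => p; rewrite basement_start.
by move=> b _; apply: plain_sum_ext => p /=; rewrite basement_end.
Qed.

End LeftSwaps.

(** * Set-valued fillings *)

Lemma sum_exists (I : finType) (P : pred I) :
  (forall r r', P r -> P r' -> r = r') -> \sum_r P r = [exists r, P r] :> nat.
Proof.
move=> uP; case: existsP => [[r Pr]|nP].
  rewrite (bigD1 r) //= Pr big1 // => r' neq.
  by case Pr': (P r') => //; rewrite (uP _ _ Pr Pr') eqxx in neq.
by rewrite big1 // => r _; case Pr: (P r) => //; case: nP; exists r.
Qed.

Lemma exists_andr (I : finType) (P : pred I) (b : bool) :
  [exists r, P r && b] = b && [exists r, P r].
Proof.
case: b; first by apply: eq_existsb => r; rewrite andbT.
by apply/existsP => -[r]; rewrite andbF.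
Qed.

(** * The weight of the column sets *)

Section Columns.

Variables n N : nat.
Implicit Types (C G : {ffun 'I_N -> {set 'I_n}}) (f : plain n N).

(** The value [set0] out of range stands for the empty column after the last one. *)
Definition column C (m : nat) : {set 'I_n} :=
  if insub m is Some k then C k else set0.

Definition count_above C m (e : 'I_n) := #|[set c in column C m | e < c]|.

(* By [eligible_count], an admissible free entry of column k is recognised on
   the sets of anchors of columns k and k + 1. *)
Definition column_extension C G :=
  [forall k : 'I_N, (C k \subset G k) &&
    [forall e in G k :\: C k, count_above C k.+1 e < count_above C k e]].

Definition column_term C G : {mpoly {poly int}[n]} :=
  ('X ^+ (\sum_k #|G k :\: C k|) *:
    'X_[ [multinom #|[set k : 'I_N | (0 < k) && (i \in G k)]| | i < n] ])%R.

Definition column_weight C : {mpoly {poly int}[n]} :=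
  (\sum_(G | column_extension C G) column_term C G)%R.

Lemma in_column f m (c : 'I_n) :
  (c \in column (columns f) m) = [exists r, entry f r m == c.+1].
Proof.
rewrite /column; case: insubP => [k _ <-|]; first by rewrite ffunE inE.
rewrite -leqNgt => le; rewrite inE; apply/esym/negbTE/existsP => -[r].
by rewrite entry_out.
Qed.

Definition eligible f r m (e : 'I_n) :=
  (entry f r m.+1 <= e.+1) && (e.+1 < entry f r m).

Section Spec.

Variables (f : plain n N) (sigma : 'I_n -> 'I_n) (len : 'I_n -> nat).
Hypothesis sp : skyline_spec sigma len (entry f).

Lemma entry_col_inj r r' m : entry f r m != 0 -> entry f r m = entry f r' m ->
  r = r'.
Proof.
move=> nz E; apply/eqP; apply: contraT => neq.
by have := spec_column sp neq nz; rewrite E eqxx.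
Qed.

Lemma count_aboveE m e :
  count_above (columns f) m e = #|[set r | e.+1 < entry f r m]|.
Proof.
rewrite /count_above -!sum1dep_card [LHS]big_mkcond [RHS]big_mkcond /=.
transitivity (\sum_(c < n) \sum_(r < n) ((e < c) && (entry f r m == c.+1))).
  apply: eq_bigr => c _; rewrite in_column sum_exists; last first.
    move=> r r' /andP[_ /eqP Er] /andP[_ /eqP Er'].
    by apply: (@entry_col_inj _ _ m); rewrite Er ?Er'.
  case: (e < c) => /=; first by rewrite andbT; case: [exists r, _].
  by rewrite andbF; apply/esym/eqP; rewrite eqb0; apply/existsP => -[].
rewrite exchange_big /=; apply: eq_bigr => r _; rewrite sum_exists; last first.
  by move=> c c' /andP[_ /eqP->] /andP[_ /eqP[/ord_inj->]].
case: (ltnP e.+1) => lt.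
  have lt' : (entry f r m).-1 < n.
    have := entry_le f r m; case: (entry f r m) lt => //.
  suff -> : [exists c : 'I_n, (e < c) && (entry f r m == c.+1)] by [].
  by apply/existsP; exists (Ordinal lt') => /=;
    case: (entry f r m) lt => //= l; rewrite ltnS => ->; rewrite eqxx.
suff -> : [exists c : 'I_n, (e < c) && (entry f r m == c.+1)] = false by [].
by apply/existsP => -[c /andP[ec /eqP E]]; move: lt; rewrite E ltnS leqNgt ec.
Qed.

(** Rows decrease, so those exceeding [e] in column [m.+1] are among those exceeding it in column
    [m]; the eligible rows are the difference. *)
Lemma eligible_count m e :
  [exists r, eligible f r m e] =
  (count_above (columns f) m.+1 e < count_above (columns f) m e).
Proof.
rewrite !count_aboveE.
have sub : [set r | e.+1 < entry f r m.+1] \subset [set r | e.+1 < entry f r m].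
  by apply/subsetP => r; rewrite !inE => lt;
    apply: leq_trans lt (spec_decr sp r m).
rewrite ltn_neqAle subset_leq_card // andbT (eq_sym #|_|).
apply/existsP/idP => [[r /andP[le lt]]|].
  rewrite eq_sym; apply/negP => /eqP E; have /eqP/setP/(_ r) : [set r | e.+1 <
    entry f r m.+1] == [set r | e.+1 < entry f r m].
    by rewrite eqEcard sub E leqnn.
  by rewrite !inE lt ltnNge le.
move=> neq; have /subsetPn[r] : ~~ ([set r | e.+1 < entry f r m] \subset [set
  r | e.+1 < entry f r m.+1]).
  apply: contra neq => sub'; apply/eqP; apply/eqP; rewrite eqn_leq.
  by rewrite !subset_leq_card.
by rewrite !inE -leqNgt => lt le; exists r; rewrite /eligible le.
Qed.

End Spec.

End Columns.

(** * Set-valued fillings with a basement, over a fixed filling of anchors *)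

Section SetValued.

Variables (n N : nat) (sigma : 'I_n -> 'I_n) (len : 'I_n -> nat).
Hypotheses (sigma_inj : injective sigma) (lenN : forall r, len r < N).

Implicit Types (F : filling n N) (u v w : 'I_n * 'I_N) (f : plain n N).

Definition aug_diagram : {set 'I_n * 'I_N} :=
  [set u : 'I_n * 'I_N | u.2 <= len u.1].
Let D := aug_diagram.

Definition aug_filling F :=
  [&& filling_of D F,
      [forall u : 'I_n * 'I_N, (u.2 == 0 :> nat) ==> (F u == [set sigma u.1])],
      S1 F, S2 D F, S3 D F & S4 D F].

Definition anchors F : plain n N := [ffun u => inord (\max_(e in F u) e.+1)].

Definition union_columns F : {ffun 'I_N -> {set 'I_n}} :=
  [ffun k : 'I_N => [set e | [exists r, e \in F (r, k)]]].

Definition place f (G : {ffun 'I_N -> {set 'I_n}}) : filling n N :=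
  [ffun u : 'I_n * 'I_N => [set e in G u.2 | (e.+1 == entry f u.1 u.2) ||
    [&& e \notin columns f u.2, eligible f u.1 u.2 e
      & [forall r, eligible f r u.2 e ==> (entry f u.1 u.2 <= entry f r u.2)]]]].

Lemma inD u : (u \in D) = (u.2 <= len u.1).
Proof. by rewrite inE. Qed.

Lemma row_lengthE r : row_length D r = (len r).+1.
Proof.
rewrite /row_length -sum1dep_card.
rewrite (eq_bigl (fun k : 'I_N => k < (len r).+1)); last by move=> k; rewrite inD.
by rewrite -(big_ord_widen N (fun _ => 1)) // sum_nat_const card_ord muln1.
Qed.

Lemma entry_anchors F u : entry (anchors F) u.1 u.2 = \max_(e in F u) e.+1.
Proof.
rewrite entry_ord -surjective_pairing ffunE inordK // ltnS.
by apply/bigmax_leqP => e _; apply: ltn_ord.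
Qed.

Lemma anchor_spec F u : F u != set0 ->
  exists2 e, e \in F u & [/\ entry (anchors F) u.1 u.2 = e.+1, anchor F u = e
    & forall e', e' \in F u -> e' <= e].
Proof.
case/set0Pn=> e0 Fe0.
have [e Fe le] : exists2 e, e \in F u & forall e', e' \in F u -> e' <= e.
  by case: (arg_maxnP (fun e : 'I_n => e : nat) Fe0) => e Fe le; exists e.
exists e => //; split=> //; rewrite ?entry_anchors; apply/eqP; rewrite eqn_leq.
  rewrite (@leq_bigmax_cond _ _ (fun e : 'I_n => e.+1)) // andbT.
  by apply/bigmax_leqP => e' /le.
rewrite (@leq_bigmax_cond _ _ (fun e : 'I_n => e : nat)) // andbT.
by apply/bigmax_leqP => e' /le.
Qed.

Lemma entry_anchors0 F u : (entry (anchors F) u.1 u.2 == 0) = (F u == set0).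
Proof.
have [E|nz] := eqVneq (F u) set0.
  by rewrite entry_anchors E big_set0.
by have [e _ [-> _ _]] := anchor_spec nz.
Qed.

Lemma filling_ofP F : reflect (forall u, (F u != set0) = (u \in D))
  (filling_of D F).
Proof. by apply: (iffP forallP) => H u; [move: (H u) => /eqP | rewrite H]. Qed.

Lemma S2P F : filling_of D F ->
  reflect (forall r (k k' : 'I_N) x y, k' = k.+1 :> nat -> x \in F (r, k) ->
             y \in F (r, k') -> y <= x) (S2 D F).
Proof.
move=> /filling_ofP fill; apply: (iffP forall_inP) => [H r k k' x y kk' Fx
  Fy|H [r k] _].
  have uD : (r, k) \in D by rewrite -fill; apply/set0Pn; exists x.
  have vD : (r, k') \in D by rewrite -fill; apply/set0Pn; exists y.
  have /forall_inP/(_ _ vD) := H _ uD.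
  by rewrite /= eqxx kk' eqxx => /forall_inP/(_ x Fx)/forall_inP/(_ y Fy).
apply/forall_inP => -[r' k'] _; apply/implyP => /andP[/= /eqP <- /eqP kk'].
by apply/forall_inP => x Fx; apply/forall_inP => y; apply: H kk' Fx.
Qed.

Lemma anchors_out F r k : filling_of D F -> len r < k -> entry (anchors F) r k
  = 0.
Proof.
move=> /filling_ofP fill lt; case: (ltnP k N) => kN; last by rewrite entry_out.
apply/eqP; rewrite (entry_anchors0 F (r, Ordinal kN)) -[_ == _]negbK fill inD /=.
by rewrite -ltnNge.
Qed.

Lemma entry_anchorsE F r (k : 'I_N) : filling_of D F -> (r, k) \in D ->
  entry (anchors F) r k = (anchor F (r, k)).+1.
Proof.
move=> /filling_ofP fill; rewrite -fill => /anchor_spec[e _ [-> -> _]] //.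
Qed.

(** Given decreasing rows, the inequality [alpha <= beta] in an inversion triple is automatic, and
    each missing box makes the numerical condition true. Row lengths include the basement, which
    does not affect their comparison. *)
Lemma S3P F : filling_of D F -> (forall r, weakly_decr (entry (anchors F) r)) ->
  reflect (forall (p q : 'I_n) k, p < q ->
     pair_ok (len p) (len q) (entry (anchors F) p) (entry (anchors F) q) k)
    (S3 D F).
Proof.
move=> fill decr; have out := anchors_out fill; have E := entry_anchorsE fill.
have ltN k r : k <= len r -> k < N by move=> le; apply: leq_ltn_trans le (lenN r).
apply: (iffP forall_inP) => [H p q k ltpq|H [r k] ukD].
  have H3 u v w : u \in D -> v \in D -> w \in D -> typeA D u v w || typeB D u
    v w ->
      inversion (anchor F v) (anchor F u) (anchor F w).
    move=> uD vD wD; have /forall_inP/(_ v vD)/forall_inP/(_ w wD)/implyP := H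
      u uD.
    exact.
  case: (ltnP (len q) k.+1) => [lt|le].
    by rewrite /pair_ok /invA /invB (out _ _ lt); case: ifP.
  pose k1 : 'I_N := Ordinal (ltN _ _ le);
    pose k0 : 'I_N := Ordinal (ltnW (ltN _ _ le)).
  have q1D : (q, k1) \in D by rewrite inD.
  have q0D : (q, k0) \in D by rewrite inD ltnW.
  rewrite /pair_ok; case: (leqP (len q) (len p)) => lens.
    have p1D : (p, k1) \in D by rewrite inD (leq_trans le).
    have p0D : (p, k0) \in D by rewrite inD /= ltnW // (leq_trans le).
    have := H3 _ _ _ p0D p1D q1D; rewrite /typeA /= !eqxx ltpq !row_lengthE
      ltnS lens.
    move=> /(_ isT); have := E _ _ p0D; have := E _ _ p1D; have := E _ _ q1D.
    rewrite /inversion /invA /= => -> -> ->; rewrite !ltnS.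
    by case/orP=> [/andP[->] //|/andP[_ ->]]; rewrite orbT.
  have := E _ _ q1D; have := E _ _ q0D; rewrite /invB /= => Eq0 Eq1.
  case: (leqP k (len p)) => lep; last by rewrite (out _ _ lep) Eq1.
  have p0D : (p, k0) \in D by rewrite inD.
  have tB : typeB D (q, k0) (q, k1) (p, k0).
    by rewrite /typeB /= !eqxx ltpq !row_lengthE ltnS lens.
  have := H3 _ _ _ q0D q1D p0D; rewrite tB orbT => /(_ isT);
    have := E _ _ p0D; rewrite Eq0 Eq1 /inversion /= => ->; rewrite !ltnS.
  by case/orP=> [/andP[->] //|/andP[_ ->]]; rewrite orbT.
apply/forall_inP => -[r' k'] vkD; apply/forall_inP => -[s m] wkD; apply/implyP.
case/orP; rewrite /typeA /typeB /= !row_lengthE ltnS.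
  case/and5P=> /eqP rr /eqP kk /eqP mk lt lens; subst r'.
  subst m; have := H r s k lt; rewrite /pair_ok lens /invA -kk !E //= !ltnS.
  have := decr r k; rewrite -kk !E //= ltnS /inversion => le.
  by rewrite le andbT => /orP[->|->]; rewrite ?orbT.
case/and5P=> /eqP rr /eqP kk /eqP mk lt lens; subst r'.
subst m; have := H s r k lt; rewrite /pair_ok leqNgt lens /invB -kk !E //= !ltnS.
have := decr r k; rewrite -kk !E //= ltnS /inversion => le.
by rewrite le andbT => /orP[->|->]; rewrite ?orbT.
Qed.

Lemma S1P F : reflect
  (forall r r' (k : 'I_N) e, e \in F (r, k) -> e \in F (r', k) -> r = r') (S1 F).
Proof.
apply: (iffP forallP) => [H r r' k e Fe Fe'|H [r k]].
  apply/eqP; apply: contraT => neq.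
  have /forallP/(_ (r', k))/implyP := H (r, k).
  rewrite /= xpair_eqE (negbTE neq) eqxx => /(_ isT)/pred0P/(_ e) /=.
  by rewrite Fe Fe'.
apply/forallP => -[r' k']; apply/implyP; rewrite xpair_eqE /= => /andP[neq
  /eqP kk].
subst k'; apply/pred0P => e /=; apply/negP => /andP[/H A /A E].
by rewrite E !eqxx in neq.
Qed.

(** The row of [u] only loses an entry, and in the row of [v] the left neighbour already dominates
    an anchor larger than [e]; only the right neighbour can object. *)
Lemma move_entryS2 F (e : 'I_n) u v : filling_of D F -> S2 D F -> v \in D ->
  v.2 = u.2 ->
  e < anchor F v -> S2 D (move_entry F e u v) =
    (entry (anchors F) v.1 v.2.+1 <= e.+1).
Proof.
case: v => r k fill s2 vD /= uk ev; have s2' := S2P fill s2.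
have nzv : F (r, k) != set0 by rewrite (filling_ofP _ fill).
have [a Fa [_ Ea _]] := anchor_spec nzv.
have mvE s m y : m != k -> y \in move_entry F e u (r, k) (s, m) = (y \in F (s,
  m)).
  move=> mk; rewrite ffunE xpair_eqE (negbTE mk) andbF.
  by case: eqP => [E|//]; move: mk; rewrite uk -E eqxx.
apply/idP/idP => [/forall_inP/(_ _ vD)/forall_inP H|le].
  case: (ltnP (len r) k.+1) => [lt|le]; first by rewrite (anchors_out fill lt).
  have ltN : k.+1 < N := leq_ltn_trans le (lenN r).
  pose k' : 'I_N := Ordinal ltN.
  have wD : (r, k') \in D by rewrite inD.
  have := H _ wD; rewrite /= !eqxx => /implyP/(_ isT)/forall_inP/(_ e).
  rewrite ffunE eqxx in_setU1 eqxx => /(_ isT)/forall_inP.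
  rewrite (entry_anchorsE (k := k') fill wD) ltnS => {}H.
  have [b Fb [_ -> _]] := anchor_spec (etrans (filling_ofP _ fill (r, k')) wD).
  by apply: H; rewrite mvE // -val_eqE /= eqn_leq ltnn.
apply/forall_inP => -[s m] sD; apply/forall_inP => -[s' m'] sD'; apply/implyP.
case/andP => /eqP /= ss /eqP mm; subst s'.
apply/forall_inP => x Fx; apply/forall_inP => y Fy.
have [mk|mk] := eqVneq m k.
  subst m; move: Fy; rewrite mvE => [Fy|];
    last by rewrite -val_eqE /= mm eqn_leq ltnn.
  move: Fx; rewrite ffunE; case: eqP => [[sr]|_].
    subst s; rewrite in_setU1 => /orP[/eqP->|Fx]; last exact: s2' mm Fx Fy.
    rewrite -ltnS; apply: leq_trans le; rewrite -mm.
    have nz : F (r, m') != set0 by apply/set0Pn; exists y.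
    by have [b _ [-> _ leb]] := anchor_spec nz; rewrite ltnS leb.
  by case: ifP => _ Fx; [move: Fx; rewrite in_setD1 => /andP[_ Fx]|];
    apply: s2' mm Fx Fy.
rewrite mvE // in Fx.
have [mk'|mk'] := eqVneq m' k; last by rewrite mvE // in Fy; apply: s2' mm Fx Fy.
subst m'; move: Fy; rewrite ffunE; case: eqP => [[sr]|_].
  subst s; rewrite in_setU1 => /orP[/eqP->|Fy]; last exact: s2' mm Fx Fy.
  by apply: leq_trans (ltnW ev) _; rewrite Ea; apply: s2' mm Fx Fa.
by case: ifP => _ Fy; [move: Fy; rewrite in_setD1 => /andP[_ Fy]|];
  apply: s2' mm Fx Fy.
Qed.

Lemma anchors_decr F : filling_of D F -> S2 D F ->
  forall r, weakly_decr (entry (anchors F) r).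
Proof.
move=> fill s2 r k; case: (ltnP (len r) k.+1) => [lt|le].
  by rewrite (anchors_out fill lt).
have ltN : k.+1 < N := leq_ltn_trans le (lenN r).
have w1 : (r, Ordinal ltN) \in D by rewrite inD.
have w0 : (r, Ordinal (ltnW ltN)) \in D by rewrite inD ltnW.
have := entry_anchorsE fill w1; have := entry_anchorsE fill w0;
  rewrite /= => -> ->.
have [b Fb [_ -> _]] := anchor_spec (etrans (filling_ofP _ fill _) w1).
have [c Fc [_ -> _]] := anchor_spec (etrans (filling_ofP _ fill _) w0).
rewrite ltnS; exact: (S2P fill s2 r (Ordinal (ltnW ltN)) (Ordinal ltN) c b
  (erefl _) Fc Fb).
Qed.

Lemma aug_anchors F : aug_filling F -> skyline_spec sigma len (entry (anchors F)).
Proof.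
case/and5P=> fill base s1 s2 /andP[s3 s4].
have decr := anchors_decr fill s2.
split=> //.
- move=> r k; case: (leqP k (len r)) => le.
    have kN := leq_ltn_trans le (lenN r).
    by rewrite (entry_anchors0 F (r, Ordinal kN)) (filling_ofP _ fill) inD.
  by rewrite (anchors_out fill le).
- move=> r; have N0 : 0 < N := leq_ltn_trans (leq0n _) (lenN r).
  have /eqP E := implyP (forallP base (r, Ordinal N0)) isT.
  have := entry_anchors F (r, Ordinal N0); rewrite /= => ->.
  by rewrite E big_set1.
- move=> r r' k neq nz; apply/eqP => E.
  have kN : k < N by rewrite ltnNge; apply: contra nz => /entry_out->.
  have nz' := nz; rewrite E in nz'.
  rewrite (entry_anchors0 F (r, Ordinal kN)) in nz.
  rewrite (entry_anchors0 F (r', Ordinal kN)) in nz'.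
  have [b Fb [Eb _ _]] := anchor_spec nz; have [c Fc [Ec _ _]] := anchor_spec nz'.
  move: E; rewrite Eb Ec => -[/ord_inj bc]; subst c.
  by rewrite (S1P _ s1 _ _ _ _ Fb Fc) eqxx in neq.
exact: (S3P fill decr s3).
Qed.

Lemma aug_free F r (k : 'I_N) (e : 'I_n) : aug_filling F -> e \in F (r, k) ->
  (e.+1 == entry (anchors F) r k) ||
  (e \notin columns (anchors F) k) && eligible (anchors F) r k e.
Proof.
move=> aF Fe; have sp := aug_anchors aF.
case/and5P: aF => fill base s1 s2 /andP[s3 s4].
have nz : F (r, k) != set0 by apply/set0Pn; exists e.
have [a Fa [Ea _ le]] := anchor_spec nz; rewrite /= in Ea.
rewrite Ea eqSS; have := le e Fe; rewrite leq_eqVlt => /orP[-> //|lt].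
apply/orP; right; rewrite /eligible Ea ltnS lt andbT ffunE inE; apply/andP; split.
  apply/existsP => -[r' /eqP Er'].
  have nz' : F (r', k) != set0 by rewrite -(entry_anchors0 F (r', k)) /= Er'.
  have [b Fb [Eb _ _]] := anchor_spec nz'.
  move: Er'; rewrite /= in Eb; rewrite Eb => -[/ord_inj bE]; subst b.
  have rr := S1P _ s1 _ _ _ _ Fb Fe; subst r'.
  by move: lt; rewrite -ltnS -Ea Eb ltnn.
case: (ltnP (len r) k.+1) => [lt'|le']; first by rewrite (anchors_out fill lt').
have ltN : k.+1 < N := leq_ltn_trans le' (lenN r).
have w1 : (r, Ordinal ltN) \in D by rewrite inD.
have [b Fb [Eb _ _]] := anchor_spec (etrans (filling_ofP _ fill _) w1).
rewrite /= in Eb; rewrite Eb ltnS; exact: (S2P fill s2 r k (Ordinal ltN) e b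
  (erefl _) Fe Fb).
Qed.

(* By (S4) a free entry sits in the eligible row of least anchor. *)
Lemma placeK F : aug_filling F -> place (anchors F) (union_columns F) = F.
Proof.
move=> aF; have sp := aug_anchors aF; have aF' := aF.
case/and5P: aF' => fill base s1 s2 /andP[s3 s4].
have inF r (k : 'I_N) (e : 'I_n) : e.+1 == entry (anchors F) r k -> e \in F
  (r, k).
  move=> /eqP E; have nz : F (r, k) != set0.
    by rewrite -(entry_anchors0 F (r, k)) /= -E.
  by have [b Fb [Eb _ _]] := anchor_spec nz; move: Eb;
    rewrite /= -E => -[/ord_inj->].
apply/ffunP => -[r k]; rewrite ffunE /=; apply/setP => e; rewrite !inE ffunE inE.
apply/andP/idP => [[/existsP[r' Fe']]|Fe].
  case/orP=> [/inF //|/and3P[nC el /forallP mine]].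
  have := aug_free aF Fe'; rewrite nC /= => /orP[E|el'].
    by move: nC; rewrite ffunE inE; case/existsP; exists r'; rewrite eq_sym.
  have le := implyP (mine r') el'.
  (* Minimality in [place] gives one inequality and (S4) in [F] the other; equal anchors in a column
     lie in the same row. *)
  suff rr : entry (anchors F) r' k <= entry (anchors F) r k.
    suff -> : r = r' by [].
    apply: (@entry_col_inj _ _ _ _ _ sp _ _ k); last by apply/eqP;
      rewrite eqn_leq le.
    by case/andP: el => _; rewrite -lt0n; apply: leq_trans.
  have lt' : e < anchor F (r', k).
    have nz : F (r', k) != set0 by apply/set0Pn; exists e.
    have [b Fb [Eb -> _]] := anchor_spec nz.
    by case/andP: el' => _; rewrite /= in Eb; rewrite Eb ltnS.
  have uD : (r', k) \in D by rewrite -(filling_ofP _ fill); apply/set0Pn;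
    exists e.
  have vD : (r, k) \in D.
    rewrite -(filling_ofP _ fill) -(entry_anchors0 F (r, k)) -lt0n /=.
    by case/andP: el => _; apply: leq_trans.
  have free : e \in free_entries F (r', k) by rewrite inE Fe' lt'.
  have /forall_inP/(_ _ free)/forall_inP/(_ _ vD)/implyP := forall_inP s4 _ uD.
  have lt : e < anchor F (r, k).
    by case/andP: el => _; rewrite (entry_anchorsE fill vD) ltnS.
  rewrite /= eqxx lt (move_entryS2 (u := (r', k)) fill s2 vD (erefl _) lt) /=.
  case/andP: (el) => -> _ => /(_ isT).
  by rewrite (entry_anchorsE fill vD) (entry_anchorsE fill uD).
split; first by apply/existsP; exists r.
have := aug_free aF Fe => /orP[-> //|/andP[nC el]].
rewrite nC el /=; apply/orP; right; apply/forallP => r'; apply/implyP => el'.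
have uD : (r, k) \in D by rewrite -(filling_ofP _ fill); apply/set0Pn; exists e.
have vD : (r', k) \in D.
  rewrite -(filling_ofP _ fill) -(entry_anchors0 F (r', k)) -lt0n /=.
  by case/andP: el' => _; apply: leq_trans.
have lt : e < anchor F (r, k).
  by case/andP: el => _; rewrite (entry_anchorsE fill uD) ltnS.
have lt' : e < anchor F (r', k).
  by case/andP: el' => _; rewrite (entry_anchorsE fill vD) ltnS.
have free : e \in free_entries F (r, k) by rewrite inE Fe lt.
have /forall_inP/(_ _ free)/forall_inP/(_ _ vD)/implyP := forall_inP s4 _ uD.
rewrite /= eqxx lt' (move_entryS2 (u := (r, k)) fill s2 vD (erefl _) lt') /=.
case/andP: (el') => -> _ => /(_ isT).
by rewrite (entry_anchorsE fill vD) (entry_anchorsE fill uD).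
Qed.

Lemma union_columns_free F r (k : 'I_N) e : aug_filling F ->
  (e \in free_entries F (r, k)) =
  (e \in F (r, k)) && (e \notin columns (anchors F) k).
Proof.
move=> aF; rewrite inE; case Fe: (e \in F (r, k)) => //=.
have nz : F (r, k) != set0 by apply/set0Pn; exists e.
have [b Fb [/= Eb -> _]] := anchor_spec nz.
apply/idP/idP => [lt|nC].
  have := aug_free aF Fe; rewrite Eb eqSS => /orP[/eqP E|/andP[] //].
  by move: lt; rewrite E ltnn.
have := aug_free aF Fe; rewrite (negbTE nC) /= => /orP[E|/andP[_]].
  by move: nC; rewrite ffunE inE => /existsP[]; exists r; rewrite eq_sym.
by rewrite Eb ltnS.
Qed.

Lemma aug_extension F : aug_filling F ->
  column_extension (columns (anchors F)) (union_columns F).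
Proof.
move=> aF; have sp := aug_anchors aF; apply/forallP => k; apply/andP; split.
  apply/subsetP => e; rewrite ffunE inE => /existsP[r Er].
  rewrite -(placeK aF) ffunE inE; apply/existsP; exists r.
  rewrite ffunE inE /= eq_sym Er /= andbT ffunE inE; apply/existsP; exists r.
  have nz : F (r, k) != set0 by rewrite -(entry_anchors0 F (r, k)) /= (eqP Er).
  have [b Fb [/= Eb _ _]] := anchor_spec nz.
  by move: Er; rewrite Eb eqSS => /eqP/ord_inj<-.
apply/forall_inP => e; rewrite inE => /andP[nC].
rewrite ffunE inE => /existsP[r Fe]; rewrite -(eligible_count sp).
have := aug_free aF Fe; rewrite nC /= => /orP[E|el]; last by apply/existsP;
  exists r.
by move: nC; rewrite ffunE inE => /existsP[]; exists r; rewrite eq_sym.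
Qed.

Lemma in_union_columns F (k : 'I_N) e :
  (e \in union_columns F k) = [exists r, e \in F (r, k)].
Proof. by rewrite ffunE inE. Qed.

(** By (S1) a value lies in at most one box of a column, so counting boxes amounts to counting
    columns. *)
Lemma filling_term_columns F : aug_filling F ->
  filling_term F = column_term (columns (anchors F)) (union_columns F).
Proof.
move=> aF; have /and5P[_ _ s1 _ _] := aF.
have uniq_row (k : 'I_N) e (P : bool) r r' :
    (e \in F (r, k)) && P -> (e \in F (r', k)) && P -> r = r'.
  by move=> /andP[A _] /andP[B _]; apply: (S1P _ s1 _ _ _ _ A B).
rewrite /filling_term /column_term; congr ((_ ^+ _) *: 'X_[ _ ])%R.
  rewrite /ex (eq_bigr (fun u : 'I_n * 'I_N => #|free_entries F (u.1, u.2)|)).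
    2: by case.
  rewrite -(pair_bigA _ (fun r k => #|free_entries F (r, k)|)) exchange_big /=.
  apply: eq_bigr => k _; rewrite -[RHS]sum1_card [RHS]big_mkcond /=.
  rewrite (eq_bigr (fun r => \sum_(e < n) ((e \in F (r,
    k)) && (e \notin columns (anchors F) k)))).
    rewrite exchange_big /=; apply: eq_bigr => e _.
    rewrite sum_exists; last exact: uniq_row.
    by rewrite exists_andr in_setD in_union_columns; case: (_ && _).
  move=> r _; rewrite -sum1_card big_mkcond /=; apply: eq_bigr => e _.
  by rewrite union_columns_free //; case: ifP.
apply/mnmP => i; rewrite !mnmE -!sum1dep_card [LHS]big_mkcond [RHS]big_mkcond /=.
rewrite (eq_bigr (fun u : 'I_n * 'I_N => ((i \in F (u.1,
  u.2)) && (0 < u.2)) : nat)).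
  rewrite -(pair_bigA _ (fun r (k : 'I_N) => ((i \in F (r,
    k)) && (0 < k)) : nat)).
  rewrite exchange_big /=; apply: eq_bigr => k _.
  rewrite sum_exists; last exact: uniq_row.
  by rewrite exists_andr in_union_columns; case: (_ && _).
by move=> [r k] _ /=; rewrite andbC; case: ifP.
Qed.

Section Place.

Variables (f : plain n N) (G : {ffun 'I_N -> {set 'I_n}}).
Hypotheses (sp : skyline_spec sigma len (entry f)).
Hypothesis CG : column_extension (columns f) G.

Let F := place f G.

Lemma in_place r (k : 'I_N) (e : 'I_n) : (e \in F (r, k)) =
  (e \in G k) && ((e.+1 == entry f r k) ||
    [&& e \notin columns f k, eligible f r k e
      & [forall r', eligible f r' k e ==> (entry f r k <= entry f r' k)]]).
Proof. by rewrite ffunE inE. Qed.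

Lemma place_entry r (k : 'I_N) (e : 'I_n) : e \in F (r, k) ->
  (e.+1 <= entry f r k) && (entry f r k.+1 <= e.+1).
Proof.
rewrite in_place => /andP[_ /orP[/eqP->|/and3P[_ /andP[-> lt] _]]].
  by rewrite leqnn (spec_decr sp).
by rewrite andbT ltnW.
Qed.

Lemma anchor_in_place r (k : 'I_N) (e : 'I_n) : e.+1 = entry f r k -> e \in F
  (r, k).
Proof.
move=> E; rewrite in_place E eqxx andbT.
have /andP[/subsetP sub _] := forallP CG k; apply: sub.
by rewrite ffunE inE; apply/existsP; exists r; rewrite E.
Qed.

Lemma anchors_place : anchors F = f.
Proof.
apply: entry_inj => r k; case: (ltnP k N) => kN; last by rewrite !entry_out.
rewrite (entry_anchors F (r, Ordinal kN)) /=.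
apply/eqP; rewrite eqn_leq; apply/andP; split.
  by apply/bigmax_leqP => e /place_entry/andP[].
case Ee: (entry f r k) => [//|m].
have mn : m < n by rewrite -Ee; have := entry_le f r k; rewrite Ee.
rewrite (@leq_bigmax_cond _ _ (fun e : 'I_n => e.+1) (Ordinal mn)) //.
by apply: anchor_in_place; rewrite /= Ee.
Qed.

Lemma place_filling : filling_of D F.
Proof.
apply/filling_ofP => -[r k]; rewrite -(entry_anchors0 F (r, k)) anchors_place /=.
by rewrite (spec_length sp) inD.
Qed.

(** A free entry placed in two rows would be placed at the least eligible anchor in both, hence at
    equal anchors. *)
Lemma place_row_inj r r' (k : 'I_N) (e : 'I_n) :
  e \in F (r, k) -> e \in F (r', k) -> r = r'.
Proof.
move=> Fe Fe'; have /andP[lt _] := place_entry Fe.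
have nz : entry f r k != 0 by rewrite -lt0n (leq_trans _ lt).
apply: (@entry_col_inj _ _ _ _ _ sp _ _ k) => //.
have inC s : e.+1 = entry f s k -> e \in columns f k.
  by move=> E; rewrite ffunE inE; apply/existsP; exists s; rewrite E.
move: Fe Fe'; rewrite !in_place => /andP[_ A] /andP[_ B].
case/orP: A => [/eqP A|/and3P[nC el /forallP mine]].
  case/orP: B => [/eqP <-//|/and3P[nC _ _]]; by rewrite (inC _ A) in nC.
case/orP: B => [/eqP B|/and3P[_ el' /forallP mine']].
  by rewrite (inC _ B) in nC.
apply/eqP; rewrite eqn_leq (implyP (mine r') el') (implyP (mine' r) el) //.
Qed.

Lemma place_S2 : S2 D F.
Proof.
apply/(S2P place_filling) => r k k' x y kk /place_entry/andP[_ le]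
  /place_entry/andP[lt _].
by rewrite -ltnS (leq_trans lt) // kk.
Qed.

Lemma place_aug : aug_filling F.
Proof.
have fill := place_filling; have s2 := place_S2.
apply/and5P; split=> //.
- apply/forallP => -[r k]; apply/implyP => /= /eqP k0; apply/eqP/setP => e.
  rewrite in_place k0 (spec_basement sp) in_set1 eqSS.
  (* An injective [sigma] is onto, so the basement column already contains every value and has no
     room for free entries. *)
  have -> /= : e \in columns f k.
    have [s E] : exists s, sigma s = e.
      by have [t A B] := injF_bij sigma_inj; exists (t e).
    by rewrite ffunE inE; apply/existsP; exists s;
      rewrite k0 (spec_basement sp) E.
  rewrite orbF andb_idl // => /eqP/ord_inj E.
  suff : e \in F (r, k) by rewrite in_place => /andP[].
  by apply: anchor_in_place; rewrite k0 (spec_basement sp) E.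
- by apply/S1P => *; apply: place_row_inj; eassumption.
apply/andP; split.
  apply/(S3P fill); rewrite anchors_place; last exact: (spec_pair sp).
  exact: (spec_decr sp).
apply/forall_inP => -[r k] uD; apply/forall_inP => e; rewrite inE => /andP[Fe lt].
apply/forall_inP => -[r' k'] vD; apply/implyP => /and3P[/eqP/= kk lt' s2'].
subst k'; rewrite (move_entryS2 (u := (r,
  k)) fill s2 vD (erefl _) lt') anchors_place /= in s2'.
have Eu := entry_anchorsE fill uD; have Ev := entry_anchorsE fill vD.
rewrite anchors_place in Eu Ev.
have el : eligible f r' k e by rewrite /eligible s2' Ev ltnS.
move: Fe; rewrite in_place Eu eqSS (ltn_eqF lt) => /andP[_ /and3P[_ _
  /forallP/(_ r')]].
by rewrite el Ev ltnS.
Qed.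

Lemma union_columns_place : union_columns F = G.
Proof.
apply/ffunP => k; rewrite ffunE; apply/setP => e; rewrite inE.
apply/existsP/idP => [[r]|Ge]; first by rewrite in_place => /andP[].
case C: (e \in columns f k).
  move: C; rewrite ffunE inE => /existsP[r /eqP E]; exists r.
  exact: anchor_in_place.
have /andP[_ /forall_inP/(_ e)] := forallP CG k.
rewrite in_setD C Ge -(eligible_count sp) => /(_ isT)/existsP[r0 el0].
case: (@arg_minnP _ r0 (fun r => eligible f r k e) (fun r => entry f r k) el0)
  => r el mine.
exists r; rewrite in_place Ge C el /= orbC.
by apply/orP; left; apply/forallP => r'; apply/implyP; apply: mine.
Qed.

End Place.

(** Grouping by anchors, [union_columns] and [place] are inverse bijections between the fillings
    with given anchors and the extensions of their columns. *)
Lemma aug_filling_sum :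
  (\sum_(F | aug_filling F) filling_term F =
   plain_sum (@column_weight n N) sigma len)%R.
Proof.
rewrite /plain_sum (partition_big anchors (skyline_plain sigma len)) /=;
  last first.
  by move=> F aF; apply/skyline_plainP/aug_anchors.
apply: eq_bigr => f /(skyline_plainP _ _ lenN) sp.
rewrite /column_weight (reindex_onto union_columns (place f)) /=; last first.
  by move=> G CG; apply: union_columns_place.
apply: eq_big => [F|F /andP[aF /eqP <-]]; last exact: filling_term_columns.
apply/andP/andP => [[aF /eqP <-]|[CG /eqP E]].
  by rewrite placeK // eqxx; split=> //; apply: aug_extension.
by rewrite -E anchors_place // eqxx; split=> //; apply: place_aug.
Qed.

End SetValued.

(** * Condition (S5) as the presence of the identity basement *)

Section Basement.

Variables (n N : nat) (len : 'I_n -> nat).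
Hypothesis lenN : forall r, len r < N.

Implicit Types (F H : filling n N) (u v w : 'I_n * 'I_N).

Let D : {set 'I_n * 'I_N} := aug_diagram N len.

Definition inner_diagram : {set 'I_n * 'I_N} :=
  [set u : 'I_n * 'I_N | 0 < u.2 <= len u.1].
Let D0 := inner_diagram.

Definition add_basement F : filling n N :=
  [ffun u : 'I_n * 'I_N => if u.2 == 0 :> nat then [set u.1] else F u].

Definition strip_basement F : filling n N :=
  [ffun u : 'I_n * 'I_N => if u.2 == 0 :> nat then set0 else F u].

Definition atom_filling F :=
  [&& filling_of D0 F, S1 F, S2 D0 F, S3 D0 F, S4 D0 F & S5 D0 F].

Lemma inD0 u : (u \in D0) = (0 < u.2) && (u \in D).
Proof. by rewrite !inE. Qed.

Lemma row_length_inner r : row_length D0 r = len r.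
Proof.
apply/eqP; rewrite -eqSS -(row_lengthE lenN) /row_length -/D.
have N0 : 0 < N by apply: leq_ltn_trans (leq0n _) (lenN r).
rewrite [X in _ == X](cardsD1 (Ordinal N0)) !inE /= add1n eqSS; apply/eqP.
by apply: eq_card => k; rewrite !inE -val_eqE /= lt0n.
Qed.

Lemma set_geP (A B : {set 'I_n}) :
  reflect (forall x y, x \in A -> y \in B -> y <= x) (set_ge A B).
Proof.
apply: (iffP forall_inP) => [H x y Ax By|H x Ax].
  by have /forall_inP/(_ y By) := H x Ax.
by apply/forall_inP => y; apply: H.
Qed.

Lemma S2_basement H : S2 D H <-> S2 D0 H /\ forall r (k0 k1 : 'I_N),
  k0 = 0 :> nat -> k1 = 1 :> nat -> (r, k1) \in D -> set_ge (H (r, k0)) (H (r,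
    k1)).
Proof.
split=> [/forall_inP H2|[/forall_inP H2 H0]].
  split=> [|r k0 k1 e0 e1 D1].
    apply/forall_inP => u; rewrite inD0 => /andP[_ uD].
    apply/forall_inP => v; rewrite inD0 => /andP[_ vD].
    by have /forall_inP/(_ _ vD) := H2 _ uD.
  have uD : (r, k0) \in D by rewrite inE e0.
  by have /forall_inP/(_ _ D1) := H2 _ uD; rewrite /= eqxx e0 e1.
apply/forall_inP => -[r k] uD; apply/forall_inP => -[r' k'] vD.
case: (posnP k) => [k0|kpos].
  by apply/implyP => /andP[/= /eqP rr /eqP kk]; subst r'; apply: H0 => //;
    rewrite kk k0.
apply/implyP => /andP[rr kk].
have uD0 : (r, k) \in D0 by rewrite inD0 uD kpos.
have vD0 : (r', k') \in D0 by rewrite inD0 vD andbT /= (eqP kk).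
by have /forall_inP/(_ _ vD0)/implyP := H2 _ uD0; apply; rewrite rr kk.
Qed.

Lemma S2_inner H H' : (forall u, 0 < u.2 -> H u = H' u) -> S2 D0 H = S2 D0 H'.
Proof.
move=> E; apply: eq_forallb => u; case uD: (u \in D0) => //=.
apply: eq_forallb => v; case vD: (v \in D0) => //=.
by move: uD vD; rewrite !inD0 => /andP[u0 _] /andP[v0 _]; rewrite !E.
Qed.

Variables F F' : filling n N.
Hypothesis FF' : forall u, 0 < u.2 -> F u = F' u.
Hypothesis F0 : forall u, u.2 = 0 :> nat -> F u = set0.
Hypothesis F0' : forall u, u.2 = 0 :> nat -> F' u = [set u.1].

Lemma anchor_inner u : 0 < u.2 -> anchor F u = anchor F' u.
Proof. by move=> u0; rewrite /anchor FF'. Qed.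

Lemma anchor_basement u : u.2 = 0 :> nat -> anchor F' u = u.1.
Proof. by move=> u0; rewrite /anchor F0' // big_set1. Qed.

Lemma le_anchor H u e : e \in H u -> e <= anchor H u.
Proof. by move=> He; apply: (@leq_bigmax_cond _ _ (fun e : 'I_n => e : nat)). Qed.

Lemma filling_of_basement : filling_of D0 F = filling_of D F'.
Proof.
apply: eq_forallb => u; rewrite inD0; case: (posnP u.2) => u0.
  have nz : [set u.1] != set0 by apply/set0Pn; exists u.1; rewrite set11.
  by rewrite F0 // F0' // eqxx nz inE u0.
by rewrite FF'.
Qed.

Lemma S1_basement : S1 F = S1 F'.
Proof.
apply: eq_forallb => -[r k]; apply: eq_forallb => -[r' k'].
rewrite xpair_eqE /=; case kk: (k == k'); rewrite ?andbF //= !andbT.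
move/eqP: kk => ?; subst k'; case: eqP => //= rr.
case: (posnP k) => k0; last by rewrite !FF'.
rewrite !F0 // !F0' //= -!setI_eq0 set0I eqxx; apply/esym/eqP/setP => e.
by rewrite !inE; apply/andP => -[/eqP-> /eqP].
Qed.

Lemma move_inner (e : 'I_n) u v : 0 < u.2 -> 0 < v.2 ->
  forall w, 0 < w.2 -> move_entry F e u v w = move_entry F' e u v w.
Proof. by move=> u0 v0 w w0; rewrite !ffunE FF'. Qed.

Lemma free_basement u : u.2 = 0 :> nat -> free_entries F' u = set0.
Proof.
move=> u0; apply/setP => e; rewrite !inE F0' // in_set1 anchor_basement //.
by case: eqP => // ->; rewrite ltnn.
Qed.

Lemma free_inner u : 0 < u.2 -> free_entries F u = free_entries F' u.
Proof. by move=> u0; apply/setP => e; rewrite !inE FF' // anchor_inner. Qed.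

Lemma S5P : reflect (forall r (k : 'I_N), k = 1 :> nat -> (r,
  k) \in D -> anchor F' (r, k) = r)
  (S5 D0 F).
Proof.
apply: (iffP forall_inP) => [H r k k1 uD|H [r k]].
  have uD0 : (r, k) \in D0 by rewrite inD0 uD k1.
  by have := H _ uD0; rewrite /= k1 eqxx anchor_inner ?k1 // => /eqP.
rewrite inD0 => /andP[/= k0 uD]; apply/implyP => /eqP k1.
by rewrite anchor_inner // H.
Qed.

Lemma S2_basement_S5 : S5 D0 F -> S2 D0 F -> S2 D F'.
Proof.
move=> /S5P s5 s2; apply/S2_basement; split; first by rewrite -(S2_inner FF').
move=> r k0 k1 e0 e1 D1; apply/set_geP => x y;
  rewrite F0' // in_set1 => /eqP-> /le_anchor.
by rewrite s5.
Qed.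

(** An entry moved into the first column is less than the anchor there, which equals the basement
    entry of the row; so the basement adds no restriction. *)
Lemma move_basement (e : 'I_n) u v : S5 D0 F -> S2 D0 F -> 0 < u.2 -> 0 < v.2
  -> v \in D ->
  e < anchor F' v -> S2 D (move_entry F' e u v) = S2 D0 (move_entry F e u v).
Proof.
move=> s5 s2 u0 v0 vD ev; rewrite (S2_inner (move_inner e u0 v0)).
apply/idP/idP => [/S2_basement[] //|s2m]; apply/S2_basement; split=> //.
move=> r k0 k1 e0 e1 D1; apply/set_geP => x y.
have /S2_basement[_ /(_ r k0 k1 e0 e1 D1)/set_geP ge] := S2_basement_S5 s5 s2.
have col0 w : w.2 = k1 -> (r, k0) != w.
  by move=> E; apply/eqP => Ew; move: E; rewrite -Ew => /(congr1 val) /=;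
    rewrite e0 e1.
have col0' w : 0 < w.2 -> ((r, k0) == w) = false.
  by move=> w0; apply/eqP => Ew; move: w0; rewrite -Ew /= e0.
rewrite !ffunE !col0' // => Fx; case: eqP => [Ev|_].
  rewrite in_setU1 => /orP[/eqP->|Fy]; last exact: ge.
  apply: leq_trans (ltnW ev) _; rewrite -Ev (S5P s5) //.
  by move: Fx; rewrite F0' // in_set1 => /eqP->.
by case: ifP => _ Fy; [move: Fy; rewrite in_setD1 => /andP[_ Fy]|]; apply: ge.
Qed.

Lemma atom_aug : atom_filling F -> aug_filling id len F'.
Proof.
case/and5P=> fill s1 s2 s3 /andP[s4 s5].
have s2' := S2_basement_S5 s5 s2.
have A1 := S5P s5.
apply/and5P; split=> //.
- by rewrite -filling_of_basement.
- by apply/forallP => u; apply/implyP => /eqP u0; rewrite F0'.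
- by rewrite -S1_basement.
apply/andP; split.
  apply/forall_inP => -[r k] uD; apply/forall_inP => -[r' k'] vD.
  apply/forall_inP => -[s m] wD; apply/implyP.
  case: (posnP k) => k0; last first.
    have uD0 : (r, k) \in D0 by rewrite inD0 k0.
    move=> tr; have [k'0 m0] : 0 < k' /\ 0 < m.
      by case/orP: tr => /and5P[_ /= /eqP e1 /eqP e2 _ _]; rewrite e2 e1 ?k0.
    have vD0 : (r', k') \in D0 by rewrite inD0 k'0.
    have wD0 : (s, m) \in D0 by rewrite inD0 m0.
    have /forall_inP/(_ _ vD0)/forall_inP/(_ _ wD0)/implyP := forall_inP s3 _ uD0.
    rewrite !anchor_inner //; apply.
    by move: tr; rewrite /typeA /typeB !(row_lengthE lenN) !row_length_inner
      !ltnS.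
  have kk : typeA D (r, k) (r', k') (s, m) || typeB D (r, k) (r', k') (s,
    m) -> r' = r /\ k' = 1 :> nat.
    by case/orP=> /and5P[/= /eqP -> /eqP-> _ _ _]; rewrite k0.
  move=> tr; have [rr k1] := kk tr; subst r'.
  (* In a triple meeting the basement both boxes of row [r] have anchor [r] and the third has its
     row index [s]; type A has [r < s], type B has [s < r], so it is an inversion triple. *)
  rewrite (anchor_basement (u := (r, k))) //= A1 //.
  case/orP: tr => /and5P[_ _ /= /eqP mk lt _]; subst m.
    by rewrite A1 // /inversion leqnn lt orbT.
  by rewrite anchor_basement // /inversion /= leqnn lt.
apply/forall_inP => u uD; apply/forall_inP => e.
case: (posnP u.2) => u0; first by rewrite free_basement // inE.
move=> fe; apply/forall_inP => v vD; apply/implyP => /and3P[vu ev].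
have v0 : 0 < v.2 by rewrite (eqP vu).
rewrite move_basement // => s2m.
have uD0 : u \in D0 by rewrite inD0 u0.
have vD0 : v \in D0 by rewrite inD0 v0.
rewrite -free_inner // in fe.
have /forall_inP/(_ _ fe)/forall_inP/(_ _ vD0)/implyP := forall_inP s4 _ uD0.
by rewrite vu !anchor_inner // ev s2m => /(_ isT).
Qed.

(* An anchor [v < j] in row [j] of the first column would contradict the
   inversion triple formed with row [v]. *)
Lemma aug_S5 : aug_filling id len F' -> S5 D0 F.
Proof.
move=> aF; have sp := aug_anchors lenN aF.
have /and5P[fill _ _ s2 _] := aF.
have first r : len r != 0 -> entry (anchors F') r 1 = r.+1.
  move=> lr; have nz := spec_length sp r 1; rewrite lt0n lr in nz.
  have := spec_decr sp r 0; rewrite (spec_basement sp) leq_eqVlt => /orP[/eqP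
    //|].
  case E: (entry (anchors F') r 1) nz => [//|v] _; rewrite !ltnS => vr.
  have vn : v < n by apply: ltn_trans vr (ltn_ord r).
  have := spec_pair sp (p := Ordinal vn) (q := r) 0 vr.
  rewrite /pair_ok /invA /invB !(spec_basement sp) E /= ltnn.
  case: ifP => [|_]; last by rewrite ltnNge ltnW.
  move=> _; rewrite orbF => lt.
  have := spec_decr sp (Ordinal vn) 0; rewrite (spec_basement sp) /=.
  by rewrite leqNgt lt.
apply/S5P => r k k1 uD.
have := entry_anchorsE (len := len) fill uD; rewrite k1 first; first by case.
by move: uD; rewrite inE /= k1 lt0n.
Qed.

Lemma aug_atom : aug_filling id len F' -> atom_filling F.
Proof.
move=> aF; have s5 := aug_S5 aF.
have /and5P[fill base s1 s2 /andP[s3 s4]] := aF.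
have s20 : S2 D0 F by have /S2_basement[] := s2; rewrite -(S2_inner FF').
apply/and5P; split=> //.
- by rewrite filling_of_basement.
- by rewrite S1_basement.
- apply/forall_inP => u; rewrite inD0 => /andP[u0 uD].
  apply/forall_inP => v; rewrite inD0 => /andP[v0 vD].
  apply/forall_inP => w; rewrite inD0 => /andP[w0 wD].
  have /forall_inP/(_ _ vD)/forall_inP/(_ _ wD) := forall_inP s3 _ uD.
  by rewrite !anchor_inner // /typeA /typeB !(row_lengthE lenN)
    !row_length_inner !ltnS.
apply/andP; split=> //.
apply/forall_inP => u; rewrite inD0 => /andP[u0 uD].
apply/forall_inP => e; rewrite free_inner // => fe.
apply/forall_inP => v; rewrite inD0 => /andP[v0 vD].
have /forall_inP/(_ _ fe)/forall_inP/(_ _ vD)/implyP := forall_inP s4 _ uD.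
rewrite !anchor_inner // => H; apply/implyP => /and3P[vu ev s2m]; apply: H.
by rewrite vu ev move_basement.
Qed.

Lemma basement_term : filling_term F = filling_term F'.
Proof.
rewrite /filling_term; congr ('X ^+ _ *: 'X_[_])%R.
  apply: eq_bigr => u _; case: (posnP u.2) => u0; last by rewrite free_inner.
  by rewrite free_basement //; apply: eq_card => e; rewrite !inE F0 // inE.
apply/mnmP => i; rewrite !mnmE; apply: eq_card => u; rewrite !inE.
by case: (posnP u.2) => //= u0; rewrite FF'.
Qed.

End Basement.

Section Sums.

Variable n : nat.
Implicit Types a b : 'X_{1..n}.

(** The equation on [N] lets the atoms of all compositions of one degree be expressed over the same
    boxes, with the same weight. *)
Lemma lascoux_atom_plain N b : N = (mdeg b).+1 ->
  lascoux_atom b = plain_sum (@column_weight n N) id b.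
Proof.
move=> ->; have bN r : b r < (mdeg b).+1 by rewrite ltnS le_mdeg.
rewrite -(aug_filling_sum (sigma := id)) // /lascoux_atom.
have addE (F : filling n (mdeg b).+1) (u : 'I_n * 'I_(mdeg b).+1) : 0 < u.2 ->
  F u = add_basement F u.
  by move=> u0; rewrite ffunE eqn0Ngt u0.
have add0 (F : filling n (mdeg b).+1) (u : 'I_n * 'I_(mdeg b).+1) : u.2 = 0 :>
  nat -> add_basement F u = [set u.1].
  by move=> u0; rewrite ffunE u0.
have stripE (F : filling n (mdeg b).+1) (u : 'I_n * 'I_(mdeg b).+1) : 0 < u.2
  -> strip_basement F u = F u.
  by move=> u0; rewrite ffunE eqn0Ngt u0.
have strip0 (F : filling n (mdeg b).+1) (u : 'I_n * 'I_(mdeg b).+1) : u.2 = 0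
  :> nat -> strip_basement F u = set0.
  by move=> u0; rewrite ffunE u0.
have atom0 F (u : 'I_n * 'I_(mdeg b).+1) : F \in atom_fillings b -> u.2 = 0 :>
  nat -> F u = set0.
  rewrite inE => /andP[/forallP/(_ u)/eqP + _] u0.
  by rewrite inE u0 /=; case: eqP.
have aug0 F (u : 'I_n * 'I_(mdeg b).+1) : aug_filling id b F -> u.2 = 0 :> nat
  -> F u = [set u.1].
  by case/and5P=> _ /forallP/(_ u)/implyP H _ _ _ u0; apply/eqP/H; rewrite u0.
rewrite (reindex_onto (@strip_basement n _) (@add_basement n _)) /=; last first.
  move=> F aF; apply/ffunP => u; rewrite !ffunE; case: eqP => // u0.
  by rewrite (atom0 F).
apply: eq_big => [F|F /andP[aF /eqP E]]; last first.
  apply: basement_term; [exact: stripE|exact: strip0|].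
  by move=> u u0; rewrite -E add0.
apply/andP/idP => [[+ /eqP E]|aF].
  rewrite inE => aF; apply: (atom_aug bN _ _ _ aF);
    [exact: stripE|exact: strip0|].
  by move=> u u0; rewrite -E add0.
have E0 (u : 'I_n * 'I_(mdeg b).+1) : u.2 = 0 :> nat -> F u = [set u.1] by
  apply: aug0.
split.
  by rewrite inE; apply: (aug_atom bN _ _ E0 aF); [exact: stripE|exact: strip0].
by apply/eqP/ffunP => u; rewrite !ffunE; case: eqP => // /E0.
Qed.

Lemma lascoux_plain N a : N = (mdeg (mnm_rev a)).+1 ->
  lascoux a = plain_sum (@column_weight n N) (@rev_ord n) (fun p => a (rev_ord
    p)).
Proof.
move=> ->; have aN r : mnm_rev a r < (mdeg (mnm_rev a)).+1 by rewrite ltnS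
  le_mdeg.
rewrite (plain_sum_ext _ (frefl _) (fun p => esym (mnmE _ p))).
rewrite -(aug_filling_sum (sigma := @rev_ord n) rev_ord_inj aN) /lascoux.
by apply: eq_bigl => F; rewrite inE.
Qed.

Lemma mdeg_rev a : mdeg (mnm_rev a) = mdeg a.
Proof.
rewrite !mdegE [RHS](reindex_inj rev_ord_inj).
by apply: eq_bigr => i _; rewrite mnmE.
Qed.

Lemma lascoux_lswap (n0 : 0 < n) a :
  lascoux a = (\sum_(b in lswap a) lascoux_atom b)%R.
Proof.
rewrite (@lascoux_plain (mdeg a).+1) ?mdeg_rev // value_sum_lswap //.
apply: eq_bigr => b ba; rewrite (@lascoux_atom_plain (mdeg a).+1) //.
by have /andP[/perm_of_mdeg-> _] := lswap_stage ba.
Qed.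

End Sums.

(** * Positive parts *)

Section PositiveParts.

Variable n : nat.
Implicit Types a b c d : 'X_{1..n}.

Definition pos_prefix b i : seq nat := [seq x <- take i (b : n.-tuple nat) | x
  != 0].

Lemma pos_prefixS b (i : 'I_n) :
  pos_prefix b i.+1 = if b i != 0 then rcons (pos_prefix b i) (b i) else
    pos_prefix b i.
Proof.
rewrite /pos_prefix (take_nth 0) ?size_tuple // filter_rcons.
by rewrite -(tnth_nth 0) -mnm_tnth.
Qed.

Lemma pos_prefix_total b : pos_prefix b n = pos_part b.
Proof. by rewrite /pos_prefix take_oversize // size_tuple. Qed.

Lemma prefix_pos_prefix b i : prefix (pos_prefix b i) (pos_part b).
Proof. by rewrite /pos_part -(cat_take_drop i b) filter_cat prefix_prefix. Qed.

Lemma pos_prefixE b i : pos_prefix b i = take (size (pos_prefix b i))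
  (pos_part b).
Proof. by apply/eqP; rewrite eq_sym -prefixE prefix_pos_prefix. Qed.

Lemma prefix_sumS (F : nat -> nat) b (i : 'I_n) :
  \sum_(j < n | j < i.+1) F (b j) = \sum_(j < n | j < i) F (b j) + F (b i).
Proof.
rewrite (bigD1 i) //= addnC; congr (_ + _); apply: eq_bigl => j.
by rewrite ltnS ltn_neqAle andbC.
Qed.

Lemma prefix_sum (F : nat -> nat) b i : F 0 = 0 -> i <= n ->
  \sum_(j < n | j < i) F (b j) = \sum_(x <- pos_prefix b i) F x.
Proof.
move=> F0; elim: i => [_|i IH lt]; first by rewrite big_pred0_eq /pos_prefix
  take0 big_nil.
rewrite (prefix_sumS F b (Ordinal lt)) /= IH 1?ltnW //.
rewrite (pos_prefixS b (Ordinal lt)) /=.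
by case: eqP => [->|_] /=; rewrite ?F0 ?addn0 // -cats1 big_cat big_seq1.
Qed.

Lemma sum_take_le (F : nat -> nat) (s : seq nat) i j : i <= j ->
  \sum_(x <- take i s) F x <= \sum_(x <- take j s) F x.
Proof.
move=> ij; rewrite -(cat_take_drop i (take j s)) take_takel // big_cat
  leq_addr //.
Qed.

Lemma sum_pos_take_lt (s : seq nat) i j : all (fun x => x != 0) s ->
  i < j -> j <= size s -> \sum_(x <- take i s) x < \sum_(x <- take j s) x.
Proof.
move=> /allP pos ij js; apply: leq_trans (sum_take_le id s ij).
have lt : i < size s := leq_trans ij js.
rewrite (take_nth 0) // -cats1 big_cat big_seq1 -[X in X < _]addn0 ltn_add2l lt0n.
exact/pos/mem_nth.
Qed.

Lemma dominatesE b c : dominates b c =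
  [forall i : 'I_n, \sum_(j < n | j < i.+1) c j <= \sum_(j < n | j < i.+1) b j].
Proof. by []. Qed.

(** The positive entries of each prefix form an initial segment of the common positive part, and
    sums of initial segments of positive numbers increase strictly with the length. *)
Lemma dominates_pos_part b c : pos_part b = pos_part c ->
  dominates c b = [forall i : 'I_n.+1, size (pos_prefix b i) <= size
    (pos_prefix c i)].
Proof.
move=> E; have S i : i <= n ->
    (\sum_(j < n | j < i) b j <= \sum_(j < n | j < i) c j) =
    (size (pos_prefix b i) <= size (pos_prefix c i)).
  move=> lt; rewrite !(@prefix_sum id) // (pos_prefixE b) (pos_prefixE c) -E
    !size_take_min.
  set s := pos_part b; have pos : all (fun x => x != 0) s by apply: filter_all.
  have szb : size (pos_prefix b i) <= size s by rewrite size_prefix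
    ?prefix_pos_prefix.
  have szc : size (pos_prefix c i) <= size s by rewrite /s E size_prefix
    ?prefix_pos_prefix.
  rewrite (minn_idPl szb) (minn_idPl szc).
  case: (leqP (size (pos_prefix b i))) => [le|lt']; first exact: sum_take_le.
  by apply/negbTE; rewrite -ltnNge sum_pos_take_lt.
rewrite dominatesE; apply/forallP/forallP => H i.
  case: i => -[|i] lt /=; first by rewrite /pos_prefix !take0.
  by have := H (Ordinal (lt : i < n)); rewrite /= S.
have := H (lift ord0 i); rewrite /= /bump /= add1n => le.
by rewrite S.
Qed.

Lemma dominates_anti b c : dominates b c -> dominates c b -> b = c.
Proof.
move=> /forallP bc /forallP cb; apply/mnmP => i.
have eqS k : k <= n -> \sum_(j < n | j < k) b j = \sum_(j < n | j < k) c j.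
  case: k => [_|k lt]; first by rewrite !big_pred0_eq.
  by apply/eqP; rewrite eqn_leq (bc (Ordinal lt)) (cb (Ordinal lt)).
have := eqS _ (ltn_ord i); rewrite !(prefix_sumS id) eqS 1?ltnW //.
exact: addnI.
Qed.

Lemma perm_of_perm_eq a b : perm_of a b = perm_eq (b : n.-tuple nat) (a :
  n.-tuple nat).
Proof.
apply/perm_ofP/tuple_permP => -[s H]; exists s.
  rewrite (_ : (b : n.-tuple nat) = [tuple tnth a (s i) | i < n]) //.
  by apply: eq_from_tnth => i; rewrite tnth_mktuple -!mnm_tnth H.
move=> k; rewrite !mnm_tnth (_ : (b : n.-tuple nat) = [tuple tnth a (s i) | i
  < n]).
  by rewrite tnth_mktuple.
exact: val_inj.
Qed.

(** The total length is fixed, so the positive part also determines the number of zeros. *)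
Lemma pos_part_perm b c : pos_part b = pos_part c ->
  perm_eq (b : n.-tuple nat) (c : n.-tuple nat).
Proof.
move=> E; have key d : perm_eq (d : n.-tuple nat) (pos_part d ++ nseq (n -
  size (pos_part d)) 0).
  rewrite -(perm_filterC (fun x => x != 0) (d : n.-tuple nat)) perm_cat2l.
  have -> : [seq x <- (d : n.-tuple nat) | ~~ (x != 0)] = nseq (n - size
    (pos_part d)) 0.
    rewrite (eq_filter (a2 := pred1 0)); last by move=> x /=; rewrite negbK.
    rewrite -[LHS]/(filter (pred1 0) _).
    have /all_pred1P -> := filter_all (pred1 0) (d : n.-tuple nat).
    congr nseq; rewrite !size_filter.
    have := count_predC (fun x => x != 0) (d : n.-tuple nat); rewrite size_tuple.
    rewrite (eq_count (a1 := predC _) (a2 := pred1 0)) => [E'|x /=];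
      last by rewrite negbK.
    by rewrite -[X in _ = X - _]E' addKn.
  by [].
by apply: perm_trans (key b) _; rewrite perm_sym E; apply: key.
Qed.

Lemma prefix_count_pos b i t : 0 < t -> i <= n ->
  prefix_count b i t = \sum_(x <- pos_prefix b i) (t <= x).
Proof. by move=> t0 le; apply: (@prefix_sum (fun x => t <= x));
  rewrite ?leqn0 ?eqn0Ngt ?t0. Qed.

Lemma prefix_count0 b i : prefix_count b i 0 = \sum_(j < n | j < i) 1.
Proof. by []. Qed.

(* The composition whose positive entries sit, for each prefix, like those of
   the one of b and c having fewer of them in this prefix. *)
Definition delay b c : 'X_{1..n} := [multinom
  (if size (pos_prefix b i) < size (pos_prefix c i) then b i
   else if size (pos_prefix c i) < size (pos_prefix b i) then c i
   else minn (b i) (c i)) | i < n].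

(** The composition that is behind catches up by at most one entry per step, so it is not overtaken
    in that step. At equal sizes two positive next entries coincide, and [minn] advances only if
    both do. *)
Lemma pos_prefix_delay b c i : pos_part b = pos_part c -> i <= n ->
  pos_prefix (delay b c) i =
  if size (pos_prefix b i) <= size (pos_prefix c i) then pos_prefix b i else
    pos_prefix c i.
Proof.
move=> E; elim: i => [_|i IH lt]; first by rewrite /pos_prefix !take0.
have {}IH := IH (ltnW lt); pose j := Ordinal lt.
have Sd := pos_prefixS (delay b c) j; have Sb := pos_prefixS b j;
  have Sc := pos_prefixS c j.
rewrite /= in Sd Sb Sc.
have eqP d : pos_part d = pos_part c -> forall i,
  pos_prefix d i = take (size (pos_prefix d i)) (pos_part c).
  by move=> <- k; apply: pos_prefixE.
have Eb := eqP b E; have Ec := eqP c (erefl _).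
have Eb' := Eb i; have Ec' := Ec i; have Eb1 := Eb i.+1; have Ec1 := Ec i.+1.
rewrite Sd mnmE IH /=.
have szb : size (pos_prefix b i.+1) = (b j != 0) + size (pos_prefix b i).
  by rewrite Sb; case: ifP => //; rewrite size_rcons.
have szc : size (pos_prefix c i.+1) = (c j != 0) + size (pos_prefix c i).
  by rewrite Sc; case: ifP => //; rewrite size_rcons.
case: (ltngtP (size (pos_prefix b i)) (size (pos_prefix c i))) => [lt'|lt'|eq'].
- rewrite -Sb ifT // szb szc; case: (b j != 0) => //=; rewrite ?add1n ?add0n.
    by apply: leq_trans lt' _; apply: leq_addl.
  by apply: leq_trans (ltnW lt') _; apply: leq_addl.
- rewrite -Sc szb szc; case: ifP => // le.
  have e : size (pos_prefix b i.+1) = size (pos_prefix c i.+1).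
    by rewrite szb szc; move: le lt'; case: (b j != 0); case: (c j != 0);
      rewrite /= ?add1n ?add0n; lia.
  by rewrite Eb1 Ec1 e.
have eqi : pos_prefix b i = pos_prefix c i by rewrite Eb' Ec' eq'.
have [b0|b0] := eqVneq (b j) 0.
  rewrite b0 min0n /= szb szc b0 /= add0n eq' leq_addl.
  by rewrite Sb b0.
have [c0|c0] := eqVneq (c j) 0.
  rewrite c0 minn0 /= szb szc b0 c0 /= add0n add1n eq' ltnn.
  by rewrite Sc c0 eqi.
have e1 : pos_prefix b i.+1 = pos_prefix c i.+1 by rewrite Eb1 Ec1 szb szc b0
  c0 eq'.
have : rcons (pos_prefix b i) (b j) = rcons (pos_prefix c i) (c j).
  by move: e1; rewrite Sb Sc b0 c0.
move/rcons_inj => [_ bc]; rewrite e1 if_same Sc c0 eqi -bc minnn bc c0.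
by [].
Qed.

Lemma pos_part_delay b c : pos_part b = pos_part c -> pos_part (delay b c) =
  pos_part b.
Proof.
move=> E; rewrite -!pos_prefix_total pos_prefix_delay // !pos_prefix_total E.
by rewrite leqnn.
Qed.

Section Classes.

Variables (n0 : 0 < n) (a : 'X_{1..n}).
Implicit Types u v w : wcomp_upto a.

Lemma pos_part_mdeg b c : pos_part b = pos_part c -> mdeg b = mdeg c.
Proof.
by move=> E; apply: perm_of_mdeg; rewrite perm_of_perm_eq pos_part_perm.
Qed.

Lemma perm_of_pos_part b c : pos_part b = pos_part c -> perm_of a b -> perm_of
  a c.
Proof.
move=> E; rewrite !perm_of_perm_eq; apply: perm_trans.
by rewrite perm_sym pos_part_perm.
Qed.

(** Prefix counts for positive thresholds are sums over the positive prefix, and those of [v] are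
    longer; for threshold 0 they depend only on the prefix length. *)
Lemma lswap_dominates u v : u \in lswap a -> dominates v u ->
  pos_part v = pos_part u -> v \in lswap a.
Proof.
rewrite !in_lswap // => /andP[p /(prefix_geP p) g] dom E.
have pv := perm_of_pos_part (esym E) p; rewrite pv /=.
apply/(prefix_geP pv) => i [|t] le; first by rewrite !prefix_count0.
apply: leq_trans (g i t.+1 le) _; rewrite !prefix_count_pos //.
rewrite (dominates_pos_part (esym E)) in dom.
have := forallP dom (Ordinal (le : i < n.+1)); rewrite /= => le'.
by rewrite (pos_prefixE u) (pos_prefixE v) E sum_take_le.
Qed.

(** Each positive prefix of [delay u v] is one of [u] or of [v], so each count inherits the bound
    from one of them. *)
Lemma lswap_delay u v w : u \in lswap a -> v \in lswap a ->
  pos_part u = pos_part v -> bmnm w = delay u v -> w \in lswap a.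
Proof.
rewrite !in_lswap // => /andP[p /(prefix_geP p) g] /andP[q /(prefix_geP q) h]
  E Ew.
have Ed : pos_part w = pos_part u by rewrite Ew pos_part_delay.
have pw := perm_of_pos_part (esym Ed) p; rewrite pw /=.
apply/(prefix_geP pw) => i [|t] le; first by rewrite !prefix_count0.
rewrite [X in _ <= X]prefix_count_pos // Ew pos_prefix_delay //.
by case: ifP => _; rewrite -prefix_count_pos // ?g ?h.
Qed.

(** An element of its class with minimal [height] is dominated by the whole class: otherwise its
    [delay] with a counterexample would stay in the class and have smaller height. *)
Lemma Qlswap_exists u : u \in lswap a ->
  exists2 v, v \in Qlswap a & (pos_part v == pos_part u) && dominates u v.
Proof.
move=> ua; pose P v := (v \in lswap a) && (pos_part v == pos_part u).
pose height v := \sum_(i < n.+1) size (pos_prefix v i).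
have Pu : P u by rewrite /P ua eqxx.
case: (@arg_minnP _ u P height Pu) => v /andP[va /eqP Ev] vmin.
have dom w : P w -> dominates w v.
  case/andP=> wa /eqP Ew; have E : pos_part v = pos_part w by rewrite Ev Ew.
  rewrite (dominates_pos_part E); apply/forallP => i; rewrite leqNgt;
    apply/negP => lt.
  have dd : mdeg (delay v w) < (mdeg a).+1.
    by rewrite (pos_part_mdeg (pos_part_delay E)) bmdeg.
  pose d : wcomp_upto a := BMultinom dd.
  have /vmin : P d by rewrite /P (lswap_delay va wa E) //= pos_part_delay ?Ev.
  have le (k : 'I_n.+1) : size (pos_prefix d k) <= size (pos_prefix v k).
    rewrite (pos_prefix_delay E (ltn_ord k : k <= n)).
    by case: (leqP (size (pos_prefix v k))) => // /ltnW.
  rewrite /height (bigD1 i) //= [X in _ <= X](bigD1 i) //= leqNgt.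
  rewrite -addSn leq_add //; last by apply: leq_sum => k _; apply: le.
  by rewrite (pos_prefix_delay E (ltn_ord i : i <= n)) [_ <= size (pos_prefix
    w i)]leqNgt lt.
exists v; last by rewrite Ev eqxx dom.
rewrite inE va; apply/forall_inP => w wa; apply/implyP => /eqP E.
by apply: dom; rewrite /P wa -E Ev eqxx.
Qed.

Lemma quasi_lascouxE b N : N = (mdeg b).+1 -> quasi_lascoux b =
  (\sum_(c : 'X_{1..n < N} | dominates c b && (pos_part c == pos_part b))
    lascoux_atom c)%R.
Proof. by move=> ->. Qed.

(** By antisymmetry of [dominates], each element of lswap belongs to the sum of a single [v] in
    [Qlswap a], so exchanging the two sums leaves one term for it. *)
Lemma sum_lswap_quasi :
  (\sum_(b in lswap a) lascoux_atom b = \sum_(b in Qlswap a) quasi_lascoux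
    (bmnm b))%R.
Proof.
have sub v : v \in Qlswap a -> v \in lswap a by rewrite inE => /andP[].
pose R v w := dominates w v && (pos_part w == pos_part v).
transitivity (\sum_(v in Qlswap a) \sum_(w : wcomp_upto a | R v w)
  lascoux_atom w)%R; last first.
  apply: eq_bigr => v /sub va; rewrite (@quasi_lascouxE v (mdeg a).+1) //.
  by have /andP[/perm_of_mdeg-> _] := lswap_stage va.
rewrite (exchange_big_dep (fun w => w \in lswap a)) /=; last first.
  by move=> v w /sub va /andP[dom /eqP E]; apply: lswap_dominates va dom E.
apply: eq_bigr => w wa; have [v vQ /andP[/eqP E dom]] := Qlswap_exists wa.
rewrite (big_pred1 v) // => v' /=; apply/andP/eqP => [[vQ' /andP[_ /eqP E']]|->].
  have min x y : x \in Qlswap a -> y \in lswap a -> pos_part x = pos_part y ->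
    dominates y x.
    by rewrite inE => /andP[_ /forall_inP H] /H/implyP H' /eqP/H'.
  apply: val_inj; apply: dominates_anti; apply: min => //; rewrite ?sub //.
    by rewrite E -E'.
  by rewrite E -E'.
by rewrite vQ /R dom E eqxx.
Qed.

End Classes.

End PositiveParts.

Theorem theorem4p42 (n : nat) (hn : 0 < n) (a : 'X_{1..n}) :
  lascoux a = (\sum_(b in Qlswap a) quasi_lascoux (bmnm b))%R
  /\ exists (s : seq 'X_{1..n}) (m : 'X_{1..n} -> nat),
       [/\ uniq s, {in s, forall b, 0 < m b}
         & lascoux a = (\sum_(b <- s) quasi_lascoux b *+ m b)%R].
Proof.
have E : lascoux a = (\sum_(b in Qlswap a) quasi_lascoux (bmnm b))%R.
  by rewrite lascoux_lswap // sum_lswap_quasi.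
split=> //; exists [seq bmnm b | b <- enum (Qlswap a)], (fun=> 1); split=> //.
  by rewrite map_inj_uniq ?enum_uniq //; apply: val_inj.
by rewrite E big_map big_enum.
Qed.
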